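(* Let $u:\mathbb{R}^N\to\mathbb{R}$ be bounded and Borel, let $x\in\mathbb{R}^N$ and $r_x>0$. Assume that $u\in C^2(\bar B_{r_x}(x))$, that $p_x:=\nabla u(x)\neq 0$, and denote $C_x:=\frac12\|\nabla^2u\|_{L^\infty(B_{r_x}(x))}$. Assume that $u$ is uniformly continuous on $\mathbb{R}^N\setminus \bar B_{r_x}(x)$ with modulus of continuity $$\omega_u(a)=\sup\{|u(z)-u(\bar z)|:\ z,\bar z\in\mathbb{R}^N\setminus \bar B_{r_x}(x),\ |z-\bar z|\le a\}.$$ For every $0<\epsilon<r_x$ such that $\epsilon|\nabla^2u(x)|\le|p_x|$, denote $B_\epsilon=B_\epsilon(x)$ and consider the average $$\bar{\mathcal{A}}_\epsilon u(x)=\frac{(1-s)(N+\mathbf p-2)}{N+\mathbf p-2+2s}\cdot\frac12\Big(\sup_{|y|=1}⨍_{T_{\mathbf p}^{\epsilon,\infty}(y)}u(x+z)\,\mathrm{d}\mu_s^N(z)+\inf_{|y|=1}⨍_{T_{\mathbf p}^{\epsilon,\infty}(y)}u(x+z)\,\mathrm{d}\mu_s^N(z)\Big)$$ $$+\frac{s(\mathbf p-2)}{N+\mathbf p-2+2s}\cdot\frac12\big(\sup_{B_\epsilon}u+\inf_{B_\epsilon}u\big)+\frac{s(N+2)}{N+\mathbf p-2+2s}⨍_{B_\epsilon}u(y)\,\mathrm{d}y.$$ Then $$\Big|\bar{\mathcal{A}}_\epsilon u(x)-u(x)-\frac{(1-s)s}{C(N,s)|A_{\mathbf p}|}\cdot\frac{N+\mathbf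 p-2}{N+\mathbf p-2+2s}\,\epsilon^{2s}\,\mathcal{L}_{s,\mathbf p}[u](x)\Big|$$ $$\le\frac{4s(N+\mathbf p-2)}{N+\mathbf p-2+2s}C_x\,(r_x^{2-2s}-\epsilon^{2-2s})\,\epsilon^{2s}m_\epsilon+\frac{(1-s)(N+\mathbf p-2)}{N+\mathbf p-2+2s}\Big(r_x^{-2s}+\frac{2s}{2s-1}r_x^{1-2s}\Big)\epsilon^{2s}\omega_u(m_\epsilon)$$ $$+\frac{s(N+\mathbf p-2)}{N+\mathbf p-2+2s}\,\epsilon^2\sup_{y\in B_\epsilon}|\nabla^2u(y)-\nabla^2u(x)|+\frac{2s(\mathbf p-2)}{N+\mathbf p-2+2s}\,\epsilon^3\frac{|\nabla^2u(x)|^2}{|p_x|},$$ where $$m_\epsilon=\max\Big\{\frac{16(N+\mathbf p-2)}{\mathbf p-1}\cdot\frac{C_x}{|p_x|}\cdot\frac{2s-1}{1-s}\cdot\frac{r_x^{2-2s}-\epsilon^{2-2s}}{\epsilon^{1-2s}-r_x^{1-2s}},\ \kappa_\epsilon\Big\},$$ $$\kappa_\epsilon=\sup\Big\{m:\ m\in[0,2]\ \text{ and }\ m^2\le\frac{N+\mathbf p-2}{\mathbf p-1}\cdot\frac{8\omega_u(m)}{|p_x|}\cdot\frac{\frac{2s-1}{2s}r_x^{-2s}+r_x^{1-2s}}{\epsilon^{1-2s}-r_x^{1-2s}}\Big\}.$$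
   Context: Fix an integer $N\ge 2$, $\mathbf p\in[2,\infty)$ and $s\in(\frac12,1)$. $B_r(x)$ is the open ball, $e_1,e_2,\dots$ the standard basis of $\mathbb{R}^N$, $\angle(y,z)$ the angle between vectors. Define the measure $\mathrm{d}\mu_s^N(z)=\frac{C(N,s)}{|z|^{N+2s}}\,\mathrm{d}z$ on Borel subsets of $\mathbb{R}^N$, with $C(N,s)=\frac{4^s s\,\Gamma(\frac N2+s)}{\pi^{N/2}\Gamma(1-s)}$. Let $\alpha_{\mathbf p}\in(0,\frac\pi2]$ be the angle such that, with $A_{\mathbf p}=\{|z|=1:\ \angle(e_1,z)<\alpha_{\mathbf p}\}$ and $\sigma$ the surface measure on the unit sphere, $\mathbf p-1=\int_{A_{\mathbf p}}\langle z,e_1\rangle^2\,\mathrm{d}\sigma(z)\big/\int_{A_{\mathbf p}}\langle z,e_2\rangle^2\,\mathrm{d}\sigma(z)$; $|A_{\mathbf p}|=\sigma(A_{\mathbf p})$. For $0\le a\le b\le\infty$ and $|y|=1$ let $T_{\mathbf p}^{a,b}(y)=\{z\in\mathbb{R}^N:\ \angle(y,z)<\alpha_{\mathbf p},\ a<|z|<b\}$. $⨍_T f\,\mathrm{d}\mu_s^N=\frac{1}{\mu_s^N(T)}\int_T f\,\mathrm{d}\mu_s^N$, while $⨍_{B_\epsilon}u(y)\,\mathrm{d}y$ is the usual Lebesgue average. $|\nabla^2u|$ denotes the (operator) norm of the Hessian matrix. For $p_x=\nabla u(x)\ne0$ (with $u$ being $C^2$ near $x$) define $$\mathcal{L}_{s,\mathbf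 p}[u](x)=\int_{T_{\mathbf p}^{0,\infty}(p_x/|p_x|)}\big(u(x+z)+u(x-z)-2u(x)\big)\,\mathrm{d}\mu_s^N(z).$$ *)

(* Defs.v *)
From HB Require Import structures.
From mathcomp Require Import all_boot all_order all_algebra.
From mathcomp Require Import all_classical all_reals all_analysis.
From mathcomp Require Import measurable_realfun.

Set Implicit Arguments.
Unset Strict Implicit.
Unset Printing Implicit Defensive.

Import Order.TTheory GRing.Theory Num.Theory.
Import numFieldNormedType.Exports.

Local Open Scope classical_set_scope.
Local Open Scope ring_scope.

Section rV_borel.
Context {R : realType} {n : nat}.
Let G := @open 'rV[R]_n.

HB.instance Definition _ := @isMeasurable.Build (sigma_display G)
  'rV[R]_n <<s G >> (@sigma_algebra0 _ setT G) (@sigma_algebraC _ G)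
  (@sigma_algebra_bigcup _ setT G).
End rV_borel.

Section rV_measurability.
Context {R : realType} {n : nat}.

Lemma rV_open_measurable (O : set 'rV[R]_n) : open O -> measurable O.
Proof. exact: sub_sigma_algebra. Qed.

Lemma rV_continuous_measurable (f : 'rV[R]_n -> R) :
  continuous f -> measurable_fun setT f.
Proof.
move=> /continuousP cf; apply: (measurability _ (RGenOInfty.measurableE R)).
move=> _ [_ [a ->] <-]; rewrite setTI.
by apply: rV_open_measurable; apply: cf; exact: interval_open.
Qed.

Lemma measurable_fun_row d (T : measurableType d) (f : T -> 'rV[R]_n) :
  (forall i, measurable_fun setT (fun t => f t 0 i)) -> measurable_fun setT f.
Proof.
move=> mf; apply: (@measurability _ _ _ _ _ _ (@open 'rV[R]_n)) => //.
move=> _ [V oV <-]; rewrite setTI.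
pose box (qk : 'rV[rat]_n * nat) := [set y : 'rV[R]_n |
  forall i, `|ratr (qk.1 0 i) - y 0 i| < qk.2.+1%:R^-1].
have -> : f @^-1` V = \bigcup_qk
    (if `[< box qk `<=` V >] then f @^-1` box qk else set0).
  apply/seteqP; split => t /=; last first.
    by move=> [qk _]; case: asboolP => // bO /bO.
  move=> Vft; have /nbhs_ballP[e /= e0 eV] := open_nbhs_nbhs (conj oV Vft).
  have [k ke] : exists k : nat, k.+1%:R^-1 < e / 2.
    exists (Num.truncn (e / 2)^-1).
    by rewrite invf_plt ?posrE ?divr_gt0// truncnS_gt.
  have k0 : 0 < k.+1%:R^-1 :> R by rewrite invr_gt0.
  have q i : {q : rat | `|ratr q - f t 0 i| < k.+1%:R^-1}.
    apply: cid.
    have : f t 0 i - k.+1%:R^-1 < f t 0 i + k.+1%:R^-1.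
      by rewrite ltrBlDr -addrA ltrDl addr_gt0.
    move=> /rat_in_itvoo[q]; rewrite in_itv/= => /andP[q1 q2].
    by exists q; rewrite ltr_distl q1.
  exists (\row_i sval (q i), k) => //.
  case: asboolP => [_|]; first by move=> i /=; rewrite mxE; exact: (svalP (q i)).
  apply: contra_notP => _ y /= hy; apply: eV; split => // i j; rewrite !ord1.
  rewrite /ball/= (splitr e).
  rewrite (_ : f t 0 j - y 0 j =
    (f t 0 j - ratr (sval (q j))) + (ratr (sval (q j)) - y 0 j)); last first.
    by rewrite addrA subrK.
  apply: (le_lt_trans (ler_normD _ _)); apply: ltrD.
    by rewrite distrC (lt_trans _ ke)//; exact: (svalP (q j)).
  by have := hy j; rewrite mxE => /lt_trans; exact.
apply: countable_bigcupT_measurable => // qk.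
case: asboolP => // _.
have -> : f @^-1` box qk = \bigcap_i
    ((fun t => `|ratr (qk.1 0 i) - f t 0 i|) @^-1` `]-oo, qk.2.+1%:R^-1[).
  apply/seteqP; split => t /= h i; first by move=> _; rewrite /= in_itv/=; exact: h.
  by have := h i I; rewrite /= in_itv.
apply: fin_bigcap_measurable => // i _.
rewrite -[X in measurable X]setTI.
have : measurable_fun setT (fun t => `|ratr (qk.1 0 i) - f t 0 i|).
  by apply: measurableT_comp => //; exact: measurable_funB.
by apply.
Qed.

Lemma measurable_coord i : measurable_fun setT (fun z : 'rV[R]_n => z 0 i).
Proof. by apply: rV_continuous_measurable; exact: coord_continuous. Qed.

End rV_measurability.

(* Lebesgue measure on R^n is built by iterating the product measure on
   n.-tuple R, and then transported to row vectors. *)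
Section tuple_lebesgue.
Context {R : realType}.
Local Notation tuple n := (n.-tuple (measurableTypeR R)).

Definition tcons n (p : measurableTypeR R * tuple n) : tuple n.+1 :=
  [tuple of p.1 :: p.2].

Lemma measurable_tcons n : measurable_fun setT (@tcons n).
Proof. exact: (measurable_cons measurable_fst measurable_snd). Qed.

Section step.
Variables (n : nat) (m : {sigma_finite_measure set (tuple n) -> \bar R}).

Definition tuple_lebesgueS : set (tuple n.+1) -> \bar R :=
  pushforward (@lebesgue_measure R \x m)%E (@tcons n).

Let mtc := @measurable_tcons n.

Let leb0 : tuple_lebesgueS set0 = 0%E.
Proof. by rewrite /tuple_lebesgueS /pushforward preimage_set0 measure0. Qed.

Let leb_ge0 A : (0 <= tuple_lebesgueS A)%E.
Proof. exact: measure_ge0. Qed.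

Let leb_sigma_additive : semi_sigma_additive tuple_lebesgueS.
Proof. exact: measure_semi_sigma_additive. Qed.

HB.instance Definition _ := isMeasure.Build _ _ _ tuple_lebesgueS
  leb0 leb_ge0 leb_sigma_additive.

Let leb_sigma_finite : sigma_finite setT tuple_lebesgueS.
Proof.
have /sigma_finiteP[F [TF ndF Foo]] := sigma_finiteT (@lebesgue_measure R).
have /sigma_finiteP[G [TG ndG Goo]] := sigma_finiteT m.
pose uncons (t : tuple n.+1) : measurableTypeR R * tuple n :=
  (tnth t ord0, [tuple of behead t]).
have mu : measurable_fun setT uncons.
  apply/measurable_fun_pairP; split; last exact: measurable_behead.
  exact: measurable_tnth.
exists (fun i => uncons @^-1` (F i `*` G i)).
  rewrite -preimage_bigcup (_ : \bigcup_i _ = setT) ?preimage_setT//.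
  rewrite -subTset => -[a t] _.
  have [i _ Fia] : (\bigcup_i F i) a by rewrite -TF.
  have [j _ Gjt] : (\bigcup_i G i) t by rewrite -TG.
  exists (maxn i j) => //; split => /=.
    by move: a Fia; exact/subsetPset/ndF/leq_maxl.
  by move: t Gjt; exact/subsetPset/ndG/leq_maxr.
move=> i; have [mFi Fioo] := Foo i; have [mGi Gioo] := Goo i; split.
  by rewrite -[X in measurable X]setTI; apply: mu => //; exact: measurableX.
rewrite /tuple_lebesgueS /pushforward -comp_preimage.
rewrite (_ : uncons \o @tcons n = id); last first.
  by apply/funext => -[a t]; rewrite /uncons /tcons /=; congr pair; exact/val_inj.
rewrite preimage_id product_measure1E//.
by apply: lte_mul_pinfty => //; rewrite ge0_fin_numE.
Qed.

HB.instance Definition _ := Measure_isSigmaFinite.Build _ _ _ tuple_lebesgueS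
  leb_sigma_finite.

End step.

Fixpoint tuple_lebesgue n : {sigma_finite_measure set (tuple n) -> \bar R} :=
  match n with
  | 0 => @dirac _ (tuple 0) [tuple] R
  | n'.+1 => tuple_lebesgueS (tuple_lebesgue n')
  end.

End tuple_lebesgue.

Section rV_lebesgue.
Context {R : realType} {n : nat}.

Definition row_of_tuple (t : n.-tuple (measurableTypeR R)) : 'rV[R]_n :=
  \row_i tnth t i.

Lemma measurable_row_of_tuple : measurable_fun setT row_of_tuple.
Proof.
apply: measurable_fun_row => i.
rewrite (_ : (fun _ => _) = fun t : n.-tuple (measurableTypeR R) => tnth t i).
  exact: measurable_tnth.
by apply/funext => t; rewrite mxE.
Qed.

Definition lebesgue_rV : set 'rV[R]_n -> \bar R :=
  pushforward (@tuple_lebesgue R n) row_of_tuple.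

Let mrow := measurable_row_of_tuple.

Let leb0 : lebesgue_rV set0 = 0%E.
Proof. by rewrite /lebesgue_rV /pushforward preimage_set0 measure0. Qed.

Let leb_ge0 A : (0 <= lebesgue_rV A)%E.
Proof. exact: measure_ge0. Qed.

Let leb_sigma_additive : semi_sigma_additive lebesgue_rV.
Proof. exact: measure_semi_sigma_additive. Qed.

HB.instance Definition _ := isMeasure.Build _ _ _ lebesgue_rV
  leb0 leb_ge0 leb_sigma_additive.

Let leb_sigma_finite : sigma_finite setT lebesgue_rV.
Proof.
have [F FT Foo] := sigma_finiteT (@tuple_lebesgue R n).
pose tuple_of_row (v : 'rV[R]_n) : n.-tuple (measurableTypeR R) :=
  [tuple v 0 i | i < n].
have mt : measurable_fun setT tuple_of_row.
  apply/measurable_fun_tnthP => i.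
  rewrite (_ : _ \o _ = fun v : 'rV[R]_n => v 0 i); first exact: measurable_coord.
  by apply/funext => v; rewrite /= tnth_mktuple.
exists (fun i => tuple_of_row @^-1` F i).
  by rewrite -preimage_bigcup -FT preimage_setT.
move=> i; have [mFi Fioo] := Foo i; split.
  by rewrite -[X in measurable X]setTI; exact: mt.
rewrite /lebesgue_rV /pushforward -comp_preimage.
rewrite (_ : tuple_of_row \o row_of_tuple = id)//.
apply/funext => t; apply: eq_from_tnth => j.
by rewrite /= tnth_mktuple mxE.
Qed.

HB.instance Definition _ := Measure_isSigmaFinite.Build _ _ _ lebesgue_rV
  leb_sigma_finite.

End rV_lebesgue.

Section euclidean.
Context {R : realType} {n : nat}.
Implicit Types y z : 'rV[R]_n.

(* MathComp-Analysis puts the sup norm on row vectors, hence a separate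
   Euclidean norm; both induce the same topology. *)
Definition dotv y z : R := \sum_i y 0 i * z 0 i.
Definition enorm z : R := Num.sqrt (dotv z z).
Definition eball y (r : R) : set 'rV[R]_n := [set z | enorm (z - y) < r].
Definition ecball y (r : R) : set 'rV[R]_n := [set z | enorm (z - y) <= r].
Definition esphere : set 'rV[R]_n := [set z | enorm z = 1].
Definition angle y z : R := acos (dotv y z / (enorm y * enorm z)).

(* [basisv k] is e_{k+1} *)
Definition basisv (k : nat) : 'rV[R]_n := \row_j (j == k :> nat)%:R.

Lemma measurable_enorm : measurable_fun setT enorm.
Proof.
apply: (@measurableT_comp _ _ _ _ _ _ (@Num.sqrt R)).
  by apply: continuous_measurable_fun; exact: sqrt_continuous.
apply: measurable_sum => i.
by apply: measurable_funM; exact: measurable_coord.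
Qed.

End euclidean.

Section surface_measure.
Context {R : realType} {n : nat}.

Definition pball : set 'rV[R]_n := [set z | 0 < enorm z < 1].

Lemma measurable_pball : measurable pball.
Proof.
rewrite (_ : pball = enorm @^-1` `]0, 1[).
  by rewrite -[X in measurable X]setTI; exact: measurable_enorm.
by apply/seteqP; split=> z /=; rewrite in_itv.
Qed.

Definition normalize (z : 'rV[R]_n) : 'rV[R]_n := (enorm z)^-1 *: z.

Lemma measurable_normalize : measurable_fun setT normalize.
Proof.
apply: measurable_fun_row => i.
rewrite (_ : (fun _ => _) = (fun z => enorm z `^ (-1) * z 0 i)).
  apply: measurable_funM; last exact: measurable_coord.
  apply: (measurableT_comp (measurable_powR _)); exact: measurable_enorm.
by apply/funext => z; rewrite mxE powR_inv1 ?sqrtr_ge0.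
Qed.

(* surface measure of the unit sphere, extended by zero to R^n: the measure of
   A is n times the volume of the part of the unit ball lying under A *)
Definition sphere_measure (A : set 'rV[R]_n) : \bar R :=
  (n%:R%:E * lebesgue_rV (normalize @^-1` A `&` pball))%E.

Let mnorm := measurable_normalize.

Let sph0 : sphere_measure set0 = 0%E.
Proof. by rewrite /sphere_measure preimage_set0 set0I measure0 mule0. Qed.

Let mu : {measure set 'rV[R]_n -> \bar R}.
Proof.
unshelve refine
  (pushforward (mrestr (@lebesgue_rV R n) measurable_pball) normalize :
   {measure set _ -> \bar R}).
exact: mnorm.
Defined.

Let sph_ge0 A : (0 <= sphere_measure A)%E.
Proof. exact: (measure_ge0 (mscale n%:R%:nng mu)). Qed.

Let sph_sigma_additive : semi_sigma_additive sphere_measure.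
Proof. exact: (@measure_semi_sigma_additive _ _ _ (mscale n%:R%:nng mu)). Qed.

HB.instance Definition _ := isMeasure.Build _ _ _ sphere_measure
  sph0 sph_ge0 sph_sigma_additive.

End surface_measure.

Section fractional_measure.
Context {R : realType}.

Definition Gamma (a : R) : R :=
  \int[lebesgue_measure]_(t in `]0, +oo[) (t `^ (a - 1) * expR (- t)).

Definition fracC (N : nat) (s : R) : R :=
  4 `^ s * s * Gamma (N%:R / 2 + s) / (pi `^ (N%:R / 2) * Gamma (1 - s)).

Variables (N : nat) (s : R).

Definition frac_density (z : 'rV[R]_N) : R :=
  fracC N s / enorm z `^ (N%:R + 2 * s).

Definition frac_measure (A : set 'rV[R]_N) : \bar R :=
  (\int[@lebesgue_rV R N]_(z in A) (frac_density z)%:E)%E.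

Lemma Gamma_ge0 (a : R) : 0 <= Gamma a.
Proof.
rewrite /Gamma; apply: Rintegral_ge0 => t _.
by rewrite mulr_ge0 ?powR_ge0 ?expR_ge0.
Qed.

Lemma measurable_frac_density : measurable_fun setT frac_density.
Proof.
rewrite (_ : frac_density =
    fun z => fracC N s * enorm z `^ (- (N%:R + 2 * s))); last first.
  by apply/funext => z; rewrite powRN.
apply: measurable_funM => //.
apply: (measurableT_comp (measurable_powR _)); exact: measurable_enorm.
Qed.

Hypothesis s0 : 0 <= s.

Lemma frac_density_ge0 z : 0 <= frac_density z.
Proof.
by rewrite /frac_density /fracC !(mulr_ge0, invr_ge0) ?powR_ge0 ?Gamma_ge0.
Qed.

Let frac0 : frac_measure set0 = 0%E.
Proof. by rewrite /frac_measure integral_set0. Qed.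

Let frac_ge0 A : (0 <= frac_measure A)%E.
Proof. by apply: integral_ge0 => z _; rewrite lee_fin frac_density_ge0. Qed.

Let frac_sigma_additive : semi_sigma_additive frac_measure.
Proof.
apply: (@semi_sigma_additive_nng_induced _ _ _ _ (EFin \o frac_density)).
  by apply/measurable_EFinP; exact: measurable_frac_density.
by move=> z /=; rewrite lee_fin frac_density_ge0.
Qed.

HB.instance Definition _ := isMeasure.Build _ _ _ frac_measure
  frac0 frac_ge0 frac_sigma_additive.

End fractional_measure.

Section calculus.
Context {R : realType} {n : nat}.
Implicit Types (u : 'rV[R]_n -> R) (x y : 'rV[R]_n).

Definition partial (i : 'I_n) u y : R := 'D_(basisv i) u y.
Definition grad u y : 'rV[R]_n := \row_i partial i u y.
Definition hessian u y : 'M[R]_n := \matrix_(i, j) partial i (partial j u) y.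

Definition opnorm (A : 'M[R]_n) : R :=
  sup [set enorm (v *m A^T) | v in @esphere R n].

(* [f], restricted to the open ball, extends continuously to the closed one *)
Definition extends_to_closure x (r : R) (f : 'rV[R]_n -> R) :=
  exists g : 'rV[R]_n -> R, {within ecball x r, continuous g} /\
    forall y, eball x r y -> g y = f y.

Definition C2_closed_ball u x (r : R) :=
  [/\ {within ecball x r, continuous u},
      forall i y, eball x r y -> derivable u y (basisv i),
      forall i j y, eball x r y -> derivable (partial i u) y (basisv j),
      forall i, extends_to_closure x r (partial i u) &
      forall i j, extends_to_closure x r (partial j (partial i u))].

End calculus.

Section setting.
Context {R : realType} {N : nat}.
Implicit Types (u : 'rV[R]_N -> R) (x y z : 'rV[R]_N) (p s alpha eps : R).

Definition avg (mu : set 'rV[R]_N -> \bar R) (D : set 'rV[R]_N) u : R :=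
  fine (\int[mu]_(z in D) (u z)%:E)%E / fine (mu D).

Definition cap alpha : set 'rV[R]_N :=
  [set z | enorm z = 1 /\ angle (basisv 0) z < alpha].

Definition cap_area alpha : R := fine (sphere_measure (cap alpha)).

Definition is_aperture p alpha :=
  0 < alpha <= pi / 2 /\
  p - 1 =
    (\int[@sphere_measure R N]_(z in cap alpha) (dotv z (basisv 0) ^+ 2)) /
    (\int[@sphere_measure R N]_(z in cap alpha) (dotv z (basisv 1) ^+ 2)).

Definition cone alpha (a b : \bar R) y : set 'rV[R]_N :=
  [set z | angle y z < alpha /\ (a < (enorm z)%:E < b)%E].

Definition Lsp s alpha u x : R :=
  fine (\int[@frac_measure R N s]_(z in cone alpha 0 +oo (normalize (grad u x)))
    (u (x + z) + u (x - z) - 2 * u x)%:E)%E.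

Definition cone_avg s alpha eps u x y : R :=
  avg (frac_measure s) (cone alpha eps%:E +oo y) (fun z => u (x + z)).

Definition Abar p s alpha eps u x : R :=
  (1 - s) * (N%:R + p - 2) / (N%:R + p - 2 + 2 * s) *
    (2^-1 * (sup [set cone_avg s alpha eps u x y | y in @esphere R N] +
             inf [set cone_avg s alpha eps u x y | y in @esphere R N])) +
  s * (p - 2) / (N%:R + p - 2 + 2 * s) *
    (2^-1 * (sup [set u y | y in eball x eps] +
             inf [set u y | y in eball x eps])) +
  s * (N%:R + 2) / (N%:R + p - 2 + 2 * s) *
    avg (@lebesgue_rV R N) (eball x eps) u.

(* C_x = 1/2 || |D^2 u| ||_{L^oo(B_r(x))} *)
Definition Cx u x (r : R) : R :=
  2^-1 * fine (Lnorm (@lebesgue_rV R N) +oo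
    (EFin \o ((fun y => opnorm (hessian u y)) \_ (eball x r)))).

Definition unif_cont_outside u x (r : R) :=
  forall e : R, 0 < e -> exists2 d : R, 0 < d &
    forall z z', ~ ecball x r z -> ~ ecball x r z' ->
      enorm (z - z') <= d -> `|u z - u z'| <= e.

Definition modulus u x (r a : R) : R :=
  sup [set d | exists z z', [/\ ~ ecball x r z, ~ ecball x r z',
    enorm (z - z') <= a & d = `|u z - u z'|]].

Definition kappa p s u x (r eps : R) : R :=
  sup [set m : R | 0 <= m <= 2 /\
    m ^+ 2 <= (N%:R + p - 2) / (p - 1) *
      (8 * modulus u x r m / enorm (grad u x)) *
      (((2 * s - 1) / (2 * s) * r `^ (- 2 * s) + r `^ (1 - 2 * s)) /
       (eps `^ (1 - 2 * s) - r `^ (1 - 2 * s)))].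

Definition m_eps p s u x (r eps : R) : R :=
  Num.max
    (16 * (N%:R + p - 2) / (p - 1) * (Cx u x r / enorm (grad u x)) *
     ((2 * s - 1) / (1 - s)) *
     ((r `^ (2 - 2 * s) - eps `^ (2 - 2 * s)) /
      (eps `^ (1 - 2 * s) - r `^ (1 - 2 * s))))
    (kappa p s u x r eps).

End setting.

(* Main.v *)
From HB Require Import structures.
Require Import Defs.
From mathcomp Require Import all_boot all_order all_algebra.
From mathcomp Require Import all_classical all_reals all_analysis.
From mathcomp Require Import measurable_realfun ess_sup_inf hoelder ring lra.

(** Let [g] and [H] be the gradient and the Hessian of [u] at [x], let [y0] be the
    direction of [g], and let [F y] be the average of [u] over the cone of axis [y]
    outside the ball of radius [eps]. The three weights of the mean value add up
    to 1.

    If the supremum and the infimum of [F] are replaced by [F y0] and [F (- y0)],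
    the expansion is a second-order computation. Cut the cone in the definition of
    the operator at [|z| = eps]. Its outer part is a multiple of
    [F y0 + F (- y0) - 2 * u x]. Its inner part is, up to the oscillation of the
    Hessian on the ball of radius [eps], the integral of [<z H, z>] over a sector;
    by symmetry about the axis it is a combination of [<y0 H, y0>] and of the trace
    of [H] ([Lsp_expansion], [sector_second]). The aperture is chosen so that this
    combination is [(p - 2) * <y0 H, y0> + tr H] up to a factor
    ([aperture_moments], [operator_share]). The same terms, with the same factors,
    come from the half-sum of the supremum and the infimum on the ball, which sees
    [<y0 H, y0>] ([midrange_expansion]), and from the average on the ball, which
    sees the trace ([ball_average]). [mean_value_split] adds up the errors.

    It remains to compare [F y] with [F y0], and [F (- y0)] with [F y]. Let [y] and
    [y'] be two axes at distance [d]. After a rotation in their plane both integrals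
    are over the same cone ([cone_int_difference]). At distances between [eps] and
    [r] the function is its linear part up to a remainder whose increments are
    controlled by the bound on the Hessian; the linear part yields a multiple of
    [<g, y> - <g, y'>] and the remainder a multiple of [d]. Beyond [r] the points
    [z] and their images are joined by at most [2 * (1 + |z|)] chords of length at
    most [d] that stay outside the ball ([rotation_between]), so only the modulus of
    continuity at [d] appears; the factor [1 + |z|] is integrable because [2 * s > 1].
    For [y' = y0] the scalar product loses [|g| * d ^ 2 / 2], so an axis can only
    beat [y0] when this quadratic loss is compensated by the two gains. This forces
    [d <= m], where [m] is the maximum in the statement, and the gains at [m] bound
    the difference ([quadratic_loss_le], [cone_int_gain]).

    The integrals over sectors are computed in polar coordinates. These follow from
    the uniqueness of Lebesgue measure among translation-invariant measures, which
    gives its behaviour under orthogonal maps and scalings ([lebesgue_rV_unique],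
    [polar_integral]). *)

Set Implicit Arguments.
Unset Strict Implicit.
Unset Printing Implicit Defensive.

Import Order.TTheory GRing.Theory Num.Theory.
Import numFieldNormedType.Exports.

Local Open Scope classical_set_scope.
Local Open Scope ring_scope.

(** * Euclidean geometry of row vectors *)

Section euclid.
Context {R : realType} {n : nat}.
Implicit Types (y z w : 'rV[R]_n) (a b : R) (M : 'M[R]_n).

Lemma dotvC y z : dotv y z = dotv z y.
Proof. by apply: eq_bigr => i _; rewrite mulrC. Qed.

Lemma dotvDl y z w : dotv (y + z) w = dotv y w + dotv z w.
Proof. by rewrite -big_split; apply: eq_bigr => i _; rewrite mxE mulrDl. Qed.

Lemma dotvZl a y w : dotv (a *: y) w = a * dotv y w.
Proof. by rewrite mulr_sumr; apply: eq_bigr => i _; rewrite mxE mulrA. Qed.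

Lemma dotvDr y z w : dotv w (y + z) = dotv w y + dotv w z.
Proof. by rewrite dotvC dotvDl !(dotvC _ w). Qed.

Lemma dotvZr a y w : dotv w (a *: y) = a * dotv w y.
Proof. by rewrite dotvC dotvZl dotvC. Qed.

Lemma dotvNl y w : dotv (- y) w = - dotv y w.
Proof. by rewrite -scaleN1r dotvZl mulN1r. Qed.

Lemma dotvNr y w : dotv w (- y) = - dotv w y.
Proof. by rewrite dotvC dotvNl dotvC. Qed.

Definition dotvE := (dotvDl, dotvDr, dotvZl, dotvZr, dotvNl, dotvNr).

Lemma dotv0 y : dotv 0 y = 0.
Proof. by rewrite -(scale0r y) dotvZl mul0r. Qed.

Lemma dotv_ge0 y : 0 <= dotv y y.
Proof. by apply: sumr_ge0 => i _; rewrite -expr2 sqr_ge0. Qed.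

Lemma dotv_mx y z : dotv y z = (y *m z^T) 0 0.
Proof. by rewrite mxE; apply: eq_bigr => i _; rewrite mxE. Qed.

Lemma enorm_ge0 y : 0 <= enorm y.
Proof. exact: sqrtr_ge0. Qed.

Lemma enorm_sq y : enorm y ^+ 2 = dotv y y.
Proof. by rewrite sqr_sqrtr ?dotv_ge0. Qed.

Lemma dotv_eq0 y : (dotv y y == 0) = (y == 0).
Proof.
apply/eqP/eqP => [|->]; last by rewrite dotv0.
move=> /eqP; rewrite psumr_eq0; last by move=> i _; rewrite -expr2 sqr_ge0.
move=> /allP h; apply/rowP => i; rewrite mxE; apply/eqP.
by have := h i (mem_index_enum i); rewrite /= -expr2 sqrf_eq0.
Qed.

Lemma enorm_eq0 y : (enorm y == 0) = (y == 0).
Proof. by rewrite -dotv_eq0 -enorm_sq sqrf_eq0. Qed.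

Lemma enorm0 : enorm (0 : 'rV[R]_n) = 0.
Proof. by apply/eqP; rewrite enorm_eq0. Qed.

Lemma enorm_gt0 y : (0 < enorm y) = (y != 0).
Proof. by rewrite lt_def enorm_ge0 enorm_eq0 andbT. Qed.

Lemma enormZ a y : enorm (a *: y) = `|a| * enorm y.
Proof. by rewrite /enorm !dotvE mulrA -expr2 sqrtrM ?sqr_ge0// sqrtr_sqr. Qed.

Lemma enormN y : enorm (- y) = enorm y.
Proof. by rewrite -scaleN1r enormZ normrN1 mul1r. Qed.

Lemma enormBC y z : enorm (y - z) = enorm (z - y).
Proof. by rewrite -enormN opprB. Qed.

Lemma dotv_le y z : dotv y z <= enorm y * enorm z.
Proof.
have [->|z0] := eqVneq z 0; first by rewrite dotvC dotv0 enorm0 mulr0.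
have z_gt0 : 0 < dotv z z by rewrite lt_def dotv_eq0 z0 dotv_ge0.
apply: (@le_trans _ _ `|dotv y z|); first exact: ler_norm.
rewrite -(@ler_pXn2r _ 2)// ?nnegrE ?mulr_ge0 ?enorm_ge0//.
rewrite exprMn !enorm_sq real_normK ?num_real//.
have := dotv_ge0 (dotv z z *: y - dotv y z *: z).
rewrite !dotvE (dotvC z y) => h.
rewrite -subr_ge0 -(pmulr_rge0 _ z_gt0).
by rewrite (le_trans h)// le_eqVlt; apply/orP; left; apply/eqP; ring.
Qed.

Lemma normr_dotv y z : `|dotv y z| <= enorm y * enorm z.
Proof.
by rewrite ler_norml dotv_le andbT lerNl -dotvNl (le_trans (dotv_le _ _))// enormN.
Qed.

Lemma enormD y z : enorm (y + z) <= enorm y + enorm z.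
Proof.
rewrite -(@ler_pXn2r _ 2)// ?nnegrE ?addr_ge0 ?enorm_ge0//.
rewrite sqrrD !enorm_sq !dotvE (dotvC z y).
by have := dotv_le y z; lra.
Qed.

Lemma enormB y z : enorm (y - z) <= enorm y + enorm z.
Proof. by rewrite (le_trans (enormD _ _))// enormN. Qed.

Lemma ler_coord_enorm y i : `|y 0 i| <= enorm y.
Proof.
rewrite -(@ler_pXn2r _ 2)// ?nnegrE ?enorm_ge0// enorm_sq real_normK ?num_real//.
rewrite /dotv (bigD1 i)//= -expr2 lerDl.
by apply: sumr_ge0 => j _; rewrite -expr2 sqr_ge0.
Qed.

Lemma enorm_le_sum y : enorm y <= \sum_i `|y 0 i|.
Proof.
rewrite -(@ler_pXn2r _ 2)// ?nnegrE ?enorm_ge0 ?sumr_ge0// enorm_sq.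
rewrite expr2 mulr_suml; apply: ler_sum => i _.
rewrite (le_trans (ler_norm _))// normrM ler_wpM2l//.
by rewrite (bigD1 i)//= lerDl sumr_ge0.
Qed.

Lemma enorm_normalize y : y != 0 -> enorm (normalize y) = 1.
Proof.
move=> y0; rewrite /normalize enormZ ger0_norm ?invr_ge0 ?enorm_ge0//.
by rewrite mulVf// enorm_eq0.
Qed.

Lemma enorm_sqB y z : enorm y = 1 -> enorm z = 1 ->
  enorm (y - z) ^+ 2 = 2 * (1 - dotv y z).
Proof.
move=> y1 z1; rewrite enorm_sq !dotvE (dotvC z y) -!enorm_sq y1 z1; ring.
Qed.

Lemma basisvE k (i : 'I_n) : basisv k 0 i = (i == k :> nat)%:R :> R.
Proof. by rewrite mxE. Qed.

Lemma dotv_basisv y (i : 'I_n) : dotv y (basisv i) = y 0 i.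
Proof.
rewrite /dotv (bigD1 i)//= basisvE eqxx mulr1 big1 ?addr0// => j ji.
by rewrite basisvE val_eqE (negbTE ji) mulr0.
Qed.

Lemma dotv_basisvl y (i : 'I_n) : dotv (basisv i) y = y 0 i.
Proof. by rewrite dotvC dotv_basisv. Qed.

Lemma enorm_basisv (i : 'I_n) : enorm (basisv i : 'rV[R]_n) = 1.
Proof. by rewrite /enorm dotv_basisv basisvE eqxx sqrtr1. Qed.

(** Maps act on row vectors from the right. *)
Definition isomx M := M *m M^T = 1%:M.

Lemma isomxC M : isomx M -> M^T *m M = 1%:M.
Proof. exact: mulmx1C. Qed.

Lemma isomxK M : isomx M -> cancel (mulmx^~ M) (@mulmx _ 1 _ _ ^~ M^T).
Proof. by move=> h z; rewrite -mulmxA h mulmx1. Qed.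

Lemma isomxKV M : isomx M -> cancel (mulmx^~ M^T) (@mulmx _ 1 _ _ ^~ M).
Proof. by move=> h z; rewrite -mulmxA isomxC// mulmx1. Qed.

Lemma dotv_ortho M y z : isomx M -> dotv (y *m M) (z *m M) = dotv y z.
Proof. by move=> h; rewrite !dotv_mx trmx_mul mulmxA -(mulmxA y) h mulmx1. Qed.

Lemma enorm_ortho M y : isomx M -> enorm (y *m M) = enorm y.
Proof. by move=> h; rewrite /enorm dotv_ortho. Qed.

Lemma dotv_orthoT M y z : isomx M -> dotv (y *m M) z = dotv y (z *m M^T).
Proof. by move=> h; rewrite -[in LHS](isomxKV h z) dotv_ortho. Qed.

Lemma normalize_ortho M y : isomx M -> normalize (y *m M) = normalize y *m M.
Proof. by move=> h; rewrite /normalize enorm_ortho// scalemxAl. Qed.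

(** Householder reflection in the hyperplane orthogonal to [w]. *)
Definition reflmx w : 'M[R]_n := 1%:M - 2 *: (w^T *m w).

Lemma mul_reflmx w z : z *m reflmx w = z - (2 * dotv z w) *: w.
Proof.
rewrite /reflmx mulmxBr mulmx1 -scalemxAr mulmxA; congr (_ - _).
by rewrite [z *m w^T]mx11_scalar -dotv_mx mul_scalar_mx scalerA.
Qed.

Lemma ortho_refl w : enorm w = 1 -> isomx (reflmx w).
Proof.
move=> w1.
have sym : (reflmx w)^T = reflmx w.
  by rewrite /reflmx linearB/= linearZ/= trmx1 trmx_mul trmxK.
rewrite /isomx sym; apply/row_matrixP => i; rewrite !rowE mulmxA !mul_reflmx mulmx1.
rewrite !dotvE -(enorm_sq w) w1 expr1n mulr1.
set c := dotv _ _; rewrite -addrA -opprD -scalerDl.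
by rewrite [X in X *: w](_ : _ = 0) ?scale0r ?subr0//; ring.
Qed.

Lemma refl_swap y z : enorm y = 1 -> enorm z = 1 -> y != z ->
  y *m reflmx (normalize (y - z)) = z.
Proof.
move=> y1 z1 yz; have h0 : y - z != 0 by rewrite subr_eq0.
rewrite mul_reflmx /normalize dotvZr scalerA.
have e2 : enorm (y - z) ^+ 2 = 2 * dotv y (y - z).
  by rewrite enorm_sqB// !dotvE -enorm_sq y1; ring.
have e0 : enorm (y - z) != 0 by rewrite enorm_eq0.
rewrite (_ : _ * _ = 1); first by rewrite scale1r opprB addrC subrK.
have -> : dotv y (y - z) = enorm (y - z) ^+ 2 / 2 by rewrite e2; field.
by field.
Qed.

(** A single reflection, in the hyperplane bisecting the two vectors,
    suffices. *)
Lemma ortho_exists y z : enorm y = 1 -> enorm z = 1 ->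
  exists2 M, isomx M & y *m M = z.
Proof.
move=> y1 z1; have [->|yz] := eqVneq y z.
  by exists 1%:M; rewrite ?mulmx1// /isomx trmx1 mulmx1.
exists (reflmx (normalize (y - z))); last exact: refl_swap.
by apply: ortho_refl; rewrite enorm_normalize// subr_eq0.
Qed.

End euclid.

(** * Lebesgue measure: translations, rotations and scalings *)

Section measurable_rows.
Context {R : realType} {n : nat} {d} {T : measurableType d}.
Implicit Types f g : T -> 'rV[R]_n.

Lemma measurable_fun_coord f i :
  measurable_fun setT f -> measurable_fun setT (fun t => f t 0 i).
Proof. by move=> mf; apply: measurableT_comp (measurable_coord i) mf. Qed.

Lemma measurable_rowD f g : measurable_fun setT f -> measurable_fun setT g ->
  measurable_fun setT (fun t => f t + g t).
Proof.
move=> mf mg; apply: measurable_fun_row => i.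
rewrite (_ : (fun _ => _) = (fun t => f t 0 i + g t 0 i)).
  by apply: measurable_funD; exact: measurable_fun_coord.
by apply/funext => t; rewrite mxE.
Qed.

Lemma measurable_rowZ (a : T -> R) f :
  measurable_fun setT a -> measurable_fun setT f ->
  measurable_fun setT (fun t => a t *: f t).
Proof.
move=> ma mf; apply: measurable_fun_row => i.
rewrite (_ : (fun _ => _) = (fun t => a t * f t 0 i)).
  by apply: measurable_funM => //; exact: measurable_fun_coord.
by apply/funext => t; rewrite mxE.
Qed.

Lemma measurable_rowB f g : measurable_fun setT f -> measurable_fun setT g ->
  measurable_fun setT (fun t => f t - g t).
Proof.
move=> mf mg; apply: measurable_rowD => //.
rewrite (_ : (fun _ => _) = (fun t => (-1) *: g t)).
  exact: measurable_rowZ.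
by apply/funext => t; rewrite scaleN1r.
Qed.

Lemma measurable_dotv f g : measurable_fun setT f -> measurable_fun setT g ->
  measurable_fun setT (fun t => dotv (f t) (g t)).
Proof.
move=> mf mg; apply: measurable_sum => i.
by apply: measurable_funM; exact: measurable_fun_coord.
Qed.

Lemma measurable_rowM (M : 'M[R]_n) f : measurable_fun setT f ->
  measurable_fun setT (fun t => f t *m M).
Proof.
move=> mf; apply: measurable_fun_row => j.
rewrite (_ : (fun _ => _) = (fun t => \sum_i f t 0 i * M i j)).
  apply: measurable_sum => i; apply: measurable_funM => //.
  exact: measurable_fun_coord.
by apply/funext => t; rewrite mxE.
Qed.

Lemma measurable_enorm_comp f :
  measurable_fun setT f -> measurable_fun setT (fun t => enorm (f t)).
Proof. by move=> mf; exact: measurableT_comp measurable_enorm mf. Qed.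

End measurable_rows.

Section preimages.
Context d1 d2 (T1 : measurableType d1) (T2 : measurableType d2).

Lemma measurable_preimage (f : T1 -> T2) (A : set T2) :
  measurable_fun setT f -> measurable A -> measurable (f @^-1` A).
Proof. by move=> mf mA; rewrite -[X in measurable X]setTI; exact: mf. Qed.

End preimages.

Section bundled_measures.
Context {R : realType} d1 d2 (T1 : measurableType d1) (T2 : measurableType d2).

(** The measurability proof is an argument, so that the structure of measure
    does not depend on finding one by unification. *)
Definition pushm (f : T1 -> T2) (mf : measurable_fun setT f)
    (m : {measure set T1 -> \bar R}) : {measure set T2 -> \bar R}.
Proof. by unshelve refine (pushforward m f : {measure set T2 -> \bar R}). Defined.

Lemma pushmE f (mf : measurable_fun setT f) m A : pushm mf m A = m (f @^-1` A).
Proof. by []. Qed.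

Lemma sigma_finite_pushm (f : T1 -> T2) (g : T2 -> T1)
    (mf : measurable_fun setT f) (mg : measurable_fun setT g)
    (m : {sigma_finite_measure set T1 -> \bar R}) :
  cancel f g -> sigma_finite setT (pushm mf m).
Proof.
move=> fK; have [F FT Foo] := sigma_finiteT m.
exists (fun i => g @^-1` F i); first by rewrite -preimage_bigcup -FT preimage_setT.
move=> i; have [mFi Fioo] := Foo i; split; first exact: measurable_preimage.
by rewrite pushmE -comp_preimage (_ : g \o f = id)//; apply/funext => t /=.
Qed.

End bundled_measures.

Section sigma_finite_bundle.
Context {R : realType} d (T : measurableType d) (m : {measure set T -> \bar R}).

(** The same measure, carrying a given proof of sigma-finiteness. *)
Definition sfinm (sf : sigma_finite setT m) : set T -> \bar R := m.

HB.instance Definition _ sf := Measure.copy (sfinm sf) m.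
HB.instance Definition _ sf :=
  Measure_isSigmaFinite.Build _ _ _ (sfinm sf) sf.

End sigma_finite_bundle.

Section translation.
Context {R : realType}.
Local Notation leb := (@lebesgue_measure R).
Local Notation tuple n := (n.-tuple (measurableTypeR R)).

Lemma lebesgue_measure_shift (h : R) A : measurable A ->
  leb ((fun x : measurableTypeR R => x + h : measurableTypeR R) @^-1` A) = leb A.
Proof.
pose f (x : measurableTypeR R) : measurableTypeR R := x + h.
have mf : measurable_fun [set: measurableTypeR R] f by exact: measurable_funD.
move=> mA; rewrite -(pushmE mf); apply/esym.
apply: (@lebesgue_measure_unique R (pushm mf leb)) => //= _ [[a b]] _ <-.
rewrite (pushmE mf); transitivity (leb `]a - h, b - h]%classic).
  rewrite !lebesgue_measure_itv/= !lte_fin ltrD2r -!EFinB.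
  by rewrite (_ : b - h - (a - h) = b - a)//; ring.
congr (_ _); apply/seteqP; split => x /=;
  by rewrite !in_itv/= /f ltrBlDr lerBrDr.
Qed.

Lemma measurable_tuple_shift n (h : 'I_n -> R) :
  measurable_fun setT (fun t : tuple n => [tuple tnth t i + h i | i < n] : tuple n).
Proof.
apply/measurable_fun_tnthP => i.
rewrite (_ : _ \o _ = fun t : tuple n => tnth t i + h i).
  by apply: measurable_funD => //; exact: measurable_tnth.
by apply/funext => t; rewrite /= tnth_mktuple.
Qed.

(** By Tonelli, one coordinate at a time. *)
Lemma tuple_lebesgue_shift n (h : 'I_n -> R) (A : set (tuple n)) : measurable A ->
  tuple_lebesgue n ((fun t : tuple n => [tuple tnth t i + h i | i < n]) @^-1` A) =
  tuple_lebesgue n A.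
Proof.
elim: n h A => [|n IH] h A mA.
  by congr (_ _); apply/seteqP; split => t /=; rewrite (tuple0 t) (tuple0 [tuple _ | _ < 0]).
rewrite /= /tuple_lebesgueS /pushforward.
pose h' (i : 'I_n) := h (lift ord0 i).
pose f (x : measurableTypeR R) : measurableTypeR R := x + h ord0.
pose g (t : tuple n) : tuple n := [tuple tnth t i + h' i | i < n].
pose fg (p : measurableTypeR R * tuple n) := (f p.1, g p.2).
have mg : measurable_fun setT g by exact: measurable_tuple_shift.
have mf : measurable_fun [set: measurableTypeR R] f by exact: measurable_funD.
have mfg : measurable_fun setT fg.
  apply/measurable_fun_pairP; split.
    by apply: (measurableT_comp mf); exact: measurable_fst.
  by apply: (measurableT_comp mg); exact: measurable_snd.
have fgE p : [tuple tnth (tcons p) i + h i | i < n.+1] = tcons (fg p) :> tuple n.+1.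
  apply: eq_from_tnth => i; rewrite tnth_mktuple.
  have [j ->|->] := unliftP ord0 i; last by rewrite !tnth0.
  by rewrite !tnthS tnth_mktuple.
have mtA : measurable ((@tcons R n) @^-1` A).
  by apply: measurable_preimage => //; exact: measurable_tcons.
rewrite (_ : _ @^-1` (_ @^-1` A) = fg @^-1` ((@tcons R n) @^-1` A)); last first.
  by apply/funext => p; apply: (f_equal A); exact: fgE.
rewrite -(pushmE mfg); apply/esym.
apply: product_measure_unique => // B C mB mC.
rewrite pushmE (_ : fg @^-1` _ = (f @^-1` B) `*` (g @^-1` C)) //.
have mfB := measurable_preimage mf mB; have mgC := measurable_preimage mg mC.
apply: (etrans (product_measure1E _ _ mfB mgC)).
by rewrite IH//; congr (_ * _)%E; exact: lebesgue_measure_shift.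
Qed.

Lemma tuple_lebesgue_cube n (a b : R) : a <= b ->
  tuple_lebesgue n [set t : tuple n | forall i, a < tnth t i <= b] =
  ((b - a) ^+ n)%:E.
Proof.
move=> ab; elim: n => [|n IH].
  by rewrite /= diracE mem_set ?expr0// => -[].
rewrite /= /tuple_lebesgueS /pushforward.
pose B : set (measurableTypeR R) := `]a, b]%classic.
pose C := [set t : tuple n | forall i, a < tnth t i <= b].
have mC : measurable C.
  rewrite (_ : C = \bigcap_i ((fun t : tuple n => tnth t i) @^-1` B)).
    apply: fin_bigcap_measurable => // i _; apply: measurable_preimage.
      exact: measurable_tnth.
    exact: measurable_itv.
  apply/seteqP; split => t /= h i; first by move=> _; rewrite /B /= in_itv/=; exact: h.
  by have := h i I; rewrite /B /= in_itv.
rewrite (_ : _ @^-1` _ = B `*` C); last first.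
  apply/seteqP; split => -[x t] /=.
    move=> h; split; first by have := h ord0; rewrite tnth0 /B /= in_itv.
    by move=> i; have := h (lift ord0 i); rewrite tnthS.
  move=> [Bx Ct] i; have [j ->|->] := unliftP ord0 i; first by rewrite tnthS.
  by move: Bx; rewrite tnth0 /B /= in_itv.
rewrite product_measure1E//; last exact: measurable_itv.
rewrite IH /B; have := @lebesgue_measure_itv R (Interval (BRight a) (BRight b)).
rewrite /= lte_fin => ->; rewrite exprS; case: ltP => [_|ba].
  by rewrite -EFinB -EFinM.
by rewrite mul0e (_ : a = b) ?subrr ?mul0r//; apply/eqP; rewrite eq_le ab.
Qed.

End translation.

Section lebesgue_rV_theory.
Context {R : realType} {n : nat}.
Local Notation leb := (@lebesgue_rV R n).
Implicit Types (A B : set 'rV[R]_n) (h : 'rV[R]_n).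

Lemma measurable_shift h : measurable_fun setT (fun z : 'rV[R]_n => z + h).
Proof. exact: measurable_rowD. Qed.

Lemma measurable_opprV : measurable_fun setT (fun z : 'rV[R]_n => - z).
Proof.
rewrite (_ : (fun _ => _) = (fun z => 0 - z)); first exact: measurable_rowB.
by apply/funext => z; rewrite sub0r.
Qed.

Lemma lebesgue_rV_shift h A : measurable A -> leb ((fun z => z + h) @^-1` A) = leb A.
Proof.
move=> mA; have mA' : measurable (@row_of_tuple R n @^-1` A).
  by apply: measurable_preimage => //; exact: measurable_row_of_tuple.
rewrite /lebesgue_rV /pushforward.
apply: etrans (tuple_lebesgue_shift (h 0) mA'); apply: (f_equal (tuple_lebesgue n)).
apply/funext => t; apply: (f_equal A).
by apply/rowP => i; rewrite !mxE tnth_mktuple.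
Qed.

Definition cube (a b : R) : set 'rV[R]_n := [set z | forall i, a < z 0 i <= b].

Lemma measurable_cube a b : measurable (cube a b).
Proof.
rewrite (_ : cube a b = \bigcap_i ((fun t : 'rV[R]_n => t 0 i) @^-1` `]a, b])).
  apply: fin_bigcap_measurable => // i _; apply: measurable_preimage => //.
  exact: measurable_coord.
apply/seteqP; split => t /= h i; first by move=> _; rewrite /= in_itv/=; exact: h.
by have := h i I; rewrite /= in_itv.
Qed.

Lemma lebesgue_rV_cube a b : a <= b -> leb (cube a b) = ((b - a) ^+ n)%:E.
Proof.
move=> ab; apply: etrans (tuple_lebesgue_cube n ab); rewrite /lebesgue_rV /pushforward.
apply: (f_equal (tuple_lebesgue n)); apply/seteqP.
by split => t h i; have := h i; rewrite /= mxE.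
Qed.

End lebesgue_rV_theory.

Section uniqueness.
Context {R : realType} {n : nat}.
Local Notation leb := (@lebesgue_rV R n).
Implicit Types (A B : set 'rV[R]_n) (h : 'rV[R]_n).
Local Open Scope ereal_scope.

Definition translation_invariant (mu : set 'rV[R]_n -> \bar R) :=
  forall h A, measurable A -> mu ((fun z => z + h)%R @^-1` A) = mu A.

(** Both sides are the measure of the set of pairs [(x, y)] such that [x] is in
    [A] and [x + y] is in [B], computed in the two possible orders. *)
Lemma translation_invariant_swap (mu nu : {sigma_finite_measure set 'rV[R]_n -> \bar R}) A B :
  translation_invariant mu -> translation_invariant nu ->
  measurable A -> measurable B ->
  mu A * nu B = mu B * nu ((fun z => - z)%R @^-1` A).
Proof.
move=> tmu tnu mA mB.
have mfst : measurable_fun setT (fun p : 'rV[R]_n * 'rV[R]_n => p.1).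
  exact: measurable_fst.
have msnd : measurable_fun setT (fun p : 'rV[R]_n * 'rV[R]_n => p.2).
  exact: measurable_snd.
pose E1 : set ('rV[R]_n * 'rV[R]_n) := (fun p => p.1) @^-1` A `&` (fun p => p.1 + p.2)%R @^-1` B.
pose E2 : set ('rV[R]_n * 'rV[R]_n) := (fun p => p.1 - p.2)%R @^-1` A `&` (fun p => p.1) @^-1` B.
have mE1 : measurable E1.
  by apply: measurableI; apply: measurable_preimage => //; exact: measurable_rowD.
have mE2 : measurable E2.
  by apply: measurableI; apply: measurable_preimage => //; exact: measurable_rowB.
have tonelli (E : set ('rV[R]_n * 'rV[R]_n)) : measurable E ->
    \int[mu]_x nu (xsection E x) = \int[nu]_y mu (ysection E y).
  move=> mE; have := @indic_fubini_tonelli _ _ _ _ _ mu nu E mE.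
  rewrite indic_fubini_tonelli_FE// indic_fubini_tonelli_GE//.
transitivity (\int[mu]_x nu (xsection E1 x)).
  transitivity (\int[mu]_(x in A) nu B); first by rewrite integral_cst// muleC.
  rewrite integral_mkcond; apply: eq_integral => x _; rewrite patchE.
  case: ifPn => xA.
    rewrite -(tnu x)//; congr (_ _); apply/seteqP.
    split => y; rewrite /xsection/= inE /E1/= addrC => h.
      by split => //; exact/set_mem.
    by case: h.
  rewrite (_ : xsection _ _ = set0) ?measure0//.
  rewrite -subset0 => y; rewrite /xsection/= inE /E1/= => -[/mem_set xA' _].
  by rewrite xA' in xA.
rewrite tonelli//.
transitivity (\int[nu]_y mu (ysection E2 y)).
  apply: eq_integral => y _.
  rewrite -(tmu y (ysection E2 y)); last exact: measurable_ysection.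
  congr (_ _); apply/seteqP; split => x; rewrite /ysection/= !inE /E1 /E2/= addrK //.
rewrite -tonelli//.
transitivity (\int[mu]_(x in B) nu ((fun z => - z)%R @^-1` A)); last first.
  by rewrite integral_cst// muleC.
rewrite [RHS]integral_mkcond; apply: eq_integral => x _; rewrite patchE.
case: ifPn => xB.
  rewrite -(tnu (- x)%R ((fun z => - z)%R @^-1` A)); last first.
    by apply: measurable_preimage => //; exact: measurable_opprV.
  congr (_ _); apply/seteqP; split => y; rewrite /xsection/= inE /E2/= opprD opprK addrC.
    by case.
  by move=> h; split => //; exact/set_mem.
rewrite (_ : xsection _ _ = set0) ?measure0//.
rewrite -subset0 => y; rewrite /xsection/= inE /E2/= => -[_ /mem_set xB'].
by rewrite xB' in xB.
Qed.

Lemma translation_invariant_leb : translation_invariant leb.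
Proof. by move=> h A mA; rewrite lebesgue_rV_shift. Qed.

Local Notation Q := (cube (0 : R) 1 : set 'rV[R]_n).

Lemma lebesgue_rV_unit_cube : leb Q = 1.
Proof. by rewrite lebesgue_rV_cube// subr0 expr1n. Qed.

Lemma lebesgue_rVN A : measurable A -> leb ((fun z => - z)%R @^-1` A) = leb A.
Proof.
move=> mA; have mQ := measurable_cube 0%R (1%R : R) (n := n).
have : leb A * leb Q = leb Q * leb ((fun z => - z)%R @^-1` A).
  exact: translation_invariant_swap translation_invariant_leb
    translation_invariant_leb mA mQ.
by rewrite lebesgue_rV_unit_cube mule1 mul1e => ->.
Qed.

(** Exchange the given set with the unit cube, whose Lebesgue measure is 1. *)
Lemma lebesgue_rV_unique (mu : {measure set 'rV[R]_n -> \bar R}) :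
  sigma_finite setT mu -> translation_invariant mu ->
  forall A, measurable A -> mu A = mu Q * leb A.
Proof.
move=> sf tmu A mA; have mQ := measurable_cube 0%R (1%R : R) (n := n).
have : mu A * leb Q = mu Q * leb ((fun z => - z)%R @^-1` A).
  exact: (@translation_invariant_swap (sfinm sf) leb A Q tmu
    translation_invariant_leb mA mQ).
by rewrite lebesgue_rV_unit_cube mule1 lebesgue_rVN.
Qed.

End uniqueness.

Section linear_maps.
Context {R : realType} {n : nat}.
Local Notation leb := (@lebesgue_rV R n).
Implicit Types (A B : set 'rV[R]_n) (h : 'rV[R]_n).

Lemma measurable_mulmx (M : 'M[R]_n) : measurable_fun setT (fun z : 'rV[R]_n => z *m M).
Proof. exact: measurable_rowM. Qed.

Lemma measurable_scale (t : R) : measurable_fun setT (fun z : 'rV[R]_n => t *: z).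
Proof. exact: measurable_rowZ. Qed.

Lemma measurable_eball x r : measurable (eball x r : set 'rV[R]_n).
Proof.
rewrite (_ : eball x r = (fun z => enorm (z - x)) @^-1` `]-oo, r[); last first.
  by apply/seteqP; split => z /=; rewrite /eball/= in_itv.
apply: measurable_preimage => //; apply: measurable_enorm_comp.
exact: measurable_rowB.
Qed.

Lemma lebesgue_rV_eball0_fin (r : R) : (leb (eball 0%R r) < +oo)%E.
Proof.
have [r0|r0] := leP r 0.
  rewrite (_ : eball _ _ = set0) ?measure0// -subset0 => z /= /lt_le_trans/(_ r0).
  by rewrite ltNge enorm_ge0.
apply: (@le_lt_trans _ _ (leb (cube (- r)%R r))).
  apply: le_measure; rewrite ?inE; [exact: measurable_eball|exact: measurable_cube|].
  move=> z; rewrite /eball/= subr0 => zr i.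
  have := le_lt_trans (ler_coord_enorm z i) zr; rewrite ltr_norml => /andP[-> /ltW].
  by [].
by rewrite lebesgue_rV_cube ?ltry//; lra.
Qed.

Lemma lebesgue_rV_eball0_gt0 (r : R) : 0 < r -> (0 < leb (eball 0%R r))%E.
Proof.
move=> r0; have c0 : 0 < r / n.+1%:R by rewrite divr_gt0.
apply: (@lt_le_trans _ _ (leb (cube 0%R (r / n.+1%:R)))).
  by rewrite lebesgue_rV_cube ?ltW// subr0 lte_fin exprn_gt0.
apply: le_measure; rewrite ?inE; [exact: measurable_cube|exact: measurable_eball|].
move=> z /= zc; rewrite /eball/= subr0 (le_lt_trans (enorm_le_sum z))//.
apply: (@le_lt_trans _ _ (\sum_(i < n) r / n.+1%:R)).
  apply: ler_sum => i _; have /andP[z0 zle] := zc i.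
  by rewrite ger0_norm// ltW.
rewrite sumr_const card_ord -[X in X < _]mulr_natr -mulrA gtr_pMr// ltr_pdivrMl//.
by rewrite mulr1 ltr_nat.
Qed.

Lemma lebesgue_rV_eball_gt0 x (r : R) : 0 < r -> (0 < leb (eball x r))%E.
Proof.
move=> r0; rewrite -(@lebesgue_rV_shift _ _ x); last exact: measurable_eball.
apply: (lt_le_trans (lebesgue_rV_eball0_gt0 r0)).
apply: le_measure; rewrite ?inE; first exact: measurable_eball.
  exact: (measurable_preimage (measurable_shift x) (measurable_eball _ _)).
by move=> z; rewrite /eball/= addrK subr0.
Qed.

(** Orthogonal maps preserve Lebesgue measure up to a constant by uniqueness,
    and the constant is read off the unit ball. *)
Lemma lebesgue_rV_ortho (M : 'M[R]_n) A : isomx M -> measurable A ->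
  leb ((fun z : 'rV[R]_n => (z *m M)%R) @^-1` A) = leb A.
Proof.
move=> oM mA; pose mu := pushm (measurable_mulmx M) leb.
have sf : sigma_finite setT mu.
  exact: sigma_finite_pushm (measurable_mulmx M^T) _ (isomxK oM).
have tmu : translation_invariant mu.
  move=> h B mB; apply: etrans (lebesgue_rV_shift (h *m M^T) _); last first.
    exact: (measurable_preimage (measurable_mulmx M) mB).
  apply: (f_equal leb); apply/funext => z; apply: (f_equal B).
  by rewrite mulmxDl isomxKV.
have uniq := lebesgue_rV_unique sf tmu.
pose B1 : set 'rV[R]_n := eball 0 1.
have mB1 : measurable B1 by exact: measurable_eball.
have B1E : leb B1 = (mu (cube 0 1) * leb B1)%E.
  apply: etrans (uniq _ mB1); apply: (f_equal leb).
  by apply/seteqP; split => z; rewrite /B1 /eball/= !subr0 enorm_ortho.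
transitivity (mu A) => //; rewrite (uniq _ mA); move: B1E.
have B1f : leb B1 \is a fin_num.
  by rewrite ge0_fin_numE//; exact: lebesgue_rV_eball0_fin.
have B1_gt0 : 0 < fine (leb B1).
  by rewrite fine_gt0// lebesgue_rV_eball0_gt0//= lebesgue_rV_eball0_fin.
rewrite -(fineK B1f); case: (mu (cube 0 1)) => [c||].
- rewrite -EFinM => -[]; rewrite -[LHS]mul1r => /(mulIf (lt0r_neq0 B1_gt0)) <-.
  by rewrite mul1e.
- by rewrite gt0_mulye.
- by rewrite gt0_mulNye.
Qed.

(** The image measure is again invariant under translations; the factor is its
    value on the unit cube. *)
Lemma lebesgue_rV_scale (t : R) A : 0 < t -> measurable A ->
  leb ((fun z : 'rV[R]_n => t *: z) @^-1` A) = ((t ^- n)%:E * leb A)%E.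
Proof.
move=> t0 mA; pose mu := pushm (measurable_scale t) leb.
have tN0 : t != 0 by rewrite gt_eqF.
have sf : sigma_finite setT mu.
  have sK : cancel (fun z : 'rV[R]_n => t *: z) (fun z => t^-1 *: z).
    by move=> z; rewrite scalerA mulVf// scale1r.
  exact: sigma_finite_pushm (measurable_scale _) _ sK.
have tmu : translation_invariant mu.
  move=> h B mB; apply: etrans (lebesgue_rV_shift (t^-1 *: h) _); last first.
    exact: (measurable_preimage (measurable_scale t) mB).
  apply: (f_equal leb); apply/funext => z; apply: (f_equal B).
  by rewrite scalerDr scalerA mulfV// scale1r.
apply: (etrans (lebesgue_rV_unique sf tmu mA)); congr (_ * _)%E.
transitivity (leb (cube 0 t^-1)); last first.
  by rewrite lebesgue_rV_cube ?invr_ge0 ?ltW// subr0 exprVn.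
apply: (f_equal leb); apply/seteqP; split => z /= h i; have := h i;
  by rewrite mxE pmulr_rgt0// -(ler_pdivlMl _ _ t0) mulr1.
Qed.

End linear_maps.

(** * Densities and polar coordinates *)

Section density.
Context d (T : measurableType d) {R : realType}.
Variables (mu : {measure set T -> \bar R}) (w : T -> R).
Hypotheses (mw : measurable_fun setT w) (w0 : forall x, 0 <= w x).
Local Open Scope ereal_scope.

Definition densm (A : set T) : \bar R := \int[mu]_(x in A) (w x)%:E.

Let densm0 : densm set0 = 0.
Proof. by rewrite /densm integral_set0. Qed.

Let densm_ge0 A : 0 <= densm A.
Proof. by apply: integral_ge0 => x _; rewrite lee_fin. Qed.

Let densm_sigma_additive : semi_sigma_additive densm.
Proof.
apply: (@semi_sigma_additive_nng_induced _ _ _ mu (EFin \o w)).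
  exact/measurable_EFinP.
by move=> x /=; rewrite lee_fin.
Qed.

HB.instance Definition _ := isMeasure.Build _ _ _ densm
  densm0 densm_ge0 densm_sigma_additive.

Definition densm_measure : {measure set T -> \bar R} := densm.

End density.

Section density_integral.
Context d (T : measurableType d) {R : realType}.
Variables (mu nu : {measure set T -> \bar R}) (w : T -> R).
Hypotheses (mw : measurable_fun setT w) (w0 : forall x, (0 <= w x)%R).
Local Open Scope ereal_scope.
Hypothesis nuE : forall A, measurable A -> nu A = \int[mu]_(x in A) (w x)%:E.

Import HBNNSimple.

Let mew : measurable_fun setT (EFin \o w). Proof. exact/measurable_EFinP. Qed.
Let ew0 x : 0 <= (w x)%:E. Proof. by rewrite lee_fin. Qed.

(** Both sides are linear in [h], and on indicators the equality is the
    definition of the density. *)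
Lemma integral_density_nnsfun (h : {nnsfun T >-> R}) :
  \int[nu]_x (h x)%:E = \int[mu]_x ((h x)%:E * (w x)%:E).
Proof.
pose I y x : \bar R := (y * \1_(h @^-1` [set y]) x)%:E.
have I0 y x : 0 <= I y x by exact: nnfun_muleindic_ge0.
have mI y : measurable_fun setT (I y).
  by apply/measurable_EFinP; exact: measurable_funM.
have hE x : (h x)%:E = \sum_(y \in range h) I y x by rewrite fsumEFin// -fimfunE.
transitivity (\sum_(y \in range h) \int[nu]_x I y x).
  by rewrite -ge0_integral_fsum//; apply: eq_integral => x _; exact: hE.
transitivity (\sum_(y \in range h) \int[mu]_x (I y x * (w x)%:E)); last first.
  rewrite -ge0_integral_fsum//.
  - by apply: eq_integral => x _; rewrite hE ge0_mule_fsuml.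
  - by move=> y; exact: emeasurable_funM.
  - by move=> y x _; rewrite mule_ge0.
apply: eq_fsbigr => y /set_mem[t _ <-{y}].
have mB : measurable (h @^-1` [set h t]) by exact: measurable_sfunP.
have ht0 : 0 <= (h t)%:E by rewrite lee_fin.
rewrite /I; under eq_integral do rewrite EFinM.
under [RHS]eq_integral do rewrite EFinM -muleA.
rewrite !ge0_integralZl//.
- rewrite integral_indic// setIT nuE// integral_mkcond; congr (_ * _).
  apply: eq_integral => x _; rewrite patchE indicE.
  by case: ifP; rewrite ?mul1e ?mul0e.
- by apply: emeasurable_funM => //; exact/measurable_EFinP.
- by move=> x _; rewrite mule_ge0// lee_fin.
- exact/measurable_EFinP.
Qed.

(** By monotone approximation with simple functions. *)
Lemma ge0_integral_density (f : T -> \bar R) E : (forall x, 0 <= f x) ->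
    measurable E -> measurable_fun E f ->
  \int[nu]_(x in E) f x = \int[mu]_(x in E) (f x * (w x)%:E).
Proof.
move=> f0 mE mf; pose g : T -> \bar R := f \_ E.
have mg : measurable_fun setT g by exact: (proj1 (measurable_restrictT f mE) mf).
have g0 x : 0 <= g x by rewrite /g patchE; case: ifP.
rewrite integral_mkcond [RHS]integral_mkcond -/g.
have -> : (fun x => f x * (w x)%:E) \_ E = fun x => g x * (w x)%:E.
  by apply/funext => x; rewrite /g !patchE; case: ifP; rewrite ?mul0e.
pose h := nnsfun_approx measurableT mg.
have hg x : (h n x)%:E @[n --> \oo] --> g x by exact: (cvg_nnsfun_approx measurableT mg).
have hmono x : {homo (fun n => (h n x)%:E) : a b / (a <= b)%N >-> a <= b}.
  by move=> a b ab; rewrite lee_fin; exact/lefP/nd_nnsfun_approx.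
have mh n : measurable_fun setT (fun x => (h n x)%:E).
  by apply/measurable_EFinP; exact/measurable_funP.
have h0 n x : 0 <= (h n x)%:E by rewrite lee_fin.
have := @cvg_monotone_convergence _ _ _ nu setT measurableT (fun n x => (h n x)%:E)
  (fun n => mh n) (fun n x _ => h0 n x) (fun x _ => hmono x).
under eq_integral do rewrite (cvg_lim _ (hg _))//.
have := @cvg_monotone_convergence _ _ _ mu setT measurableT (fun n x => (h n x)%:E * (w x)%:E)
  (fun n => emeasurable_funM (mh n) mew) (fun n x _ => mule_ge0 (h0 n x) (ew0 x)) _.
have hgw x : (h n x)%:E * (w x)%:E @[n --> \oo] --> g x * (w x)%:E by exact: cvgeZr.
under [X in _ --> X]eq_integral do rewrite (cvg_lim _ (hgw _))//.
move=> cmu cnu; apply: (cvg_unique _ cnu) => //.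
rewrite (_ : (fun n => _) = fun n => \int[mu]_x ((h n x)%:E * (w x)%:E)); last first.
  by apply/funext => n; exact: integral_density_nnsfun.
by apply: cmu => x _ a b ab; rewrite lee_wpmul2r//; exact: hmono.
Qed.

End density_integral.

Section power_integrals.
Context {R : realType}.
Local Notation mu := (@lebesgue_measure R).
Implicit Types a b g t : R.

Lemma is_derive_powR_div g t : g != 0 -> 0 < t ->
  is_derive t 1 (fun t => t `^ g / g) (t `^ (g - 1)).
Proof.
move=> g0 t0; have h := is_derive1_powR g t0.
rewrite (_ : (fun _ => _) = g^-1 *: ((fun x : R => x `^ g) : R -> R)).
  have := is_deriveZ g^-1 h.
  by rewrite /GRing.scale/= mulrA mulVf// mul1r.
by apply/funext => x; rewrite /= mulrC.
Qed.

Lemma measurable_powR_itv g (D : set R) : measurable D ->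
  measurable_fun D (fun t : R => (t `^ g)%:E).
Proof.
move=> mD; apply/measurable_EFinP.
by apply: measurable_funTS; exact: measurable_powR.
Qed.

Lemma integral_powR_oo a b g : 0 < a -> a < b -> g != 0 ->
  (\int[mu]_(t in `]a, b[) (t `^ (g - 1))%:E)%E = ((b `^ g - a `^ g) / g)%:E.
Proof.
move=> a0 ab g0.
rewrite -(@integral_itv_bndoo _ a b _ true false); last exact: measurable_powR_itv.
rewrite (@continuous_FTC2 _ _ (fun t => t `^ g / g))//.
- by rewrite -EFinB mulrBl.
- apply: derivable_within_continuous => t; rewrite in_itv/= => /andP[at_ _].
  by apply: derivable_powR; rewrite in_itv/= (lt_le_trans a0).
- have cont t : 0 < t -> {for t, continuous (fun t : R => t `^ g / g)}.
    move=> t0; apply: differentiable_continuous; apply/derivable1_diffP.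
    by have [] := is_derive_powR_div g0 t0.
  split.
  + move=> t; rewrite in_itv/= => /andP[at_ _].
    by have [] := is_derive_powR_div g0 (lt_trans a0 at_).
  + by apply: cvg_at_right_filter; exact: cont.
  + by apply: cvg_at_left_filter; apply: cont; exact: lt_trans ab.
- move=> t; rewrite in_itv/= => /andP[at_ _]; rewrite derive1E.
  by have [_ ->] := is_derive_powR_div g0 (lt_trans a0 at_).
Qed.

Lemma integral_powR_y a g : 0 < a -> g < 0 ->
  (\int[mu]_(t in `]a, +oo[) (t `^ (g - 1))%:E)%E = (a `^ g / - g)%:E.
Proof.
move=> a0 g0; have gN0 : g != 0 by rewrite lt_eqF.
rewrite integral_itv_obnd_cbnd; last exact: measurable_powR_itv.
have cont t : 0 < t -> {for t, continuous (fun t : R => t `^ g / g)}.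
  move=> t0; apply: differentiable_continuous; apply/derivable1_diffP.
  by have [] := is_derive_powR_div gN0 t0.
rewrite (@ge0_continuous_FTC2y _ _ (fun t => t `^ g / g) _ 0)//.
- by rewrite -EFinB sub0r invrN mulrN.
- by move=> t _; exact: powR_ge0.
- apply: derivable_within_continuous => t; rewrite in_itv/= andbT => at_.
  by apply: derivable_powR; rewrite in_itv/= (lt_le_trans a0).
- rewrite -(mul0r g^-1); apply: cvgM; last exact: cvg_cst.
  apply/cvgrPdist_le => e e0; near=> t.
  have t0 : 0 < t by near: t; exact: nbhs_pinfty_gt.
  rewrite sub0r normrN ger0_norm ?powR_ge0//.
  rewrite -[g]opprK powRN -[leRHS]invrK lef_pV2 ?posrE ?powR_gt0 ?invr_gt0//.
  have -> : e^-1 = (e `^ g^-1) `^ (- g).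
    by rewrite -powRrM mulrN mulVf// powR_inv1 ?ltW.
  apply: ge0_ler_powR; rewrite ?nnegrE ?powR_ge0//.
  by rewrite oppr_ge0 ltW.
- move=> t at_; by have [] := is_derive_powR_div gN0 (lt_trans a0 at_).
- by apply: cvg_at_right_filter; exact: cont.
- move=> t; rewrite in_itv/= andbT => at_; rewrite derive1E.
  by have [_ ->] := is_derive_powR_div gN0 (lt_trans a0 at_).
Unshelve. all: by end_near. Qed.

(** The integrand may blow up at 0, so the interval is exhausted by intervals
    that avoid it. *)
Lemma integral_powR_0 b g : 0 < b -> 0 < g ->
  (\int[mu]_(t in `]0%R, b[) (t `^ (g - 1))%:E)%E = (b `^ g / g)%:E.
Proof.
move=> b0 g0; have gN0 : g != 0 by rewrite gt_eqF.
pose a n : R := b / n.+2%:R.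
have a_gt0 n : 0 < a n by rewrite divr_gt0.
have ab n : a n < b by rewrite gtr_pMr// invf_lt1// ltr1n.
pose F n : set R := `]a n, b[%classic.
have F0 : \bigcup_n F n = `]0, b[%classic.
  apply/seteqP; split => t.
    by move=> [n _]; rewrite /F/= !in_itv/= => /andP[/(lt_trans (a_gt0 n)) -> ->].
  rewrite /= in_itv/= => /andP[t0 tb]; exists (Num.truncn (b / t)) => //.
  rewrite /F /= in_itv/= tb andbT /a ltr_pdivrMr// mulrC -ltr_pdivrMr//.
  by rewrite (lt_trans (truncnS_gt _))// ltr_nat.
have := @ge0_nondecreasing_set_cvg_integral _ (measurableTypeR R) R F
  (fun t => (t `^ (g - 1))%:E) mu.
rewrite F0 => cv; apply: (cvg_unique _ (cv _ _ _ _)) => //.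
- apply/nondecreasing_seqP => n; apply/subsetPset => t; rewrite /F/= !in_itv/=.
  move=> /andP[h ->]; rewrite andbT (le_lt_trans _ h)// ler_wpM2l ?ltW//.
  by rewrite ltf_pV2 ?posrE// ltr_nat.
- by move=> n; exact: measurable_itv.
- by move=> n; apply: measurable_powR_itv; exact: measurable_itv.
- by move=> n t _; rewrite lee_fin powR_ge0.
apply: (@cvg_trans _ (((b `^ g - a n `^ g) / g)%:E @[n --> \oo])).
  by apply: near_eq_cvg; apply: nearW => n; apply/esym/integral_powR_oo.
apply: cvg_EFin; first by near=> n.
rewrite (_ : _ \o _ = fun n => (b `^ g - a n `^ g) / g)//.
rewrite -{2}(subr0 (b `^ g)).
apply: cvgM; last exact: cvg_cst.
apply: cvgB; first exact: cvg_cst.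
apply: (@cvg_comp _ _ _ a (fun x : R => x `^ g) _ (0^'+)); last exact: powR_cvg0.
move=> A [e /= e0 h]; near=> n; apply: h => //=.
rewrite sub0r normrN gtr0_norm// /a ltr_pdivrMr// mulrC -ltr_pdivrMr//.
rewrite (lt_le_trans (truncnS_gt _))// ler_nat -ltnS -addn1.
near: n; exists (Num.truncn (b / e)) => // n /= hn.
by rewrite addn1; rewrite ltnS leqW.
Unshelve. all: by end_near. Qed.

End power_integrals.

Section polar.
Context {R : realType} {n : nat}.
Hypothesis n_gt0 : (0 < n)%N.
Local Notation leb := (@lebesgue_rV R n).
Local Notation sigma := (@sphere_measure R n).
Local Notation mu := (@lebesgue_measure R).
Implicit Types (A B : set 'rV[R]_n).

Lemma measurable_sector A : measurable A -> measurable (normalize @^-1` A).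
Proof. by move=> mA; apply: measurable_preimage => //; exact: measurable_normalize. Qed.

Lemma measurable_shell (i : interval R) : measurable [set z : 'rV[R]_n | enorm z \in i].
Proof. exact: (measurable_preimage measurable_enorm (measurable_itv i)). Qed.

Lemma normalizeZ (t : R) (z : 'rV[R]_n) : 0 < t -> normalize (t *: z) = normalize z.
Proof.
move=> t0; rewrite /normalize enormZ gtr0_norm// invfM scalerA.
by rewrite mulrAC mulVf ?mul1r// gt_eqF.
Qed.

(** Homogeneity of Lebesgue measure reduces a radial set of size [t] to the
    unit ball. *)
Lemma lebesgue_sector A t : measurable A -> 0 < t ->
  leb (normalize @^-1` A `&` [set z | 0 < enorm z < t]) =
  ((t ^+ n)%:E * leb (normalize @^-1` A `&` pball))%E.
Proof.
move=> mA t0; have tV0 : 0 < t^-1 by rewrite invr_gt0.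
have mE : measurable (normalize @^-1` A `&` (pball : set 'rV[R]_n)).
  by apply: measurableI; [exact: measurable_sector|exact: measurable_pball].
have := lebesgue_rV_scale tV0 mE; rewrite -exprVn invrK => <-.
apply: (f_equal leb); apply/seteqP.
by split => z /=; rewrite /pball/= normalizeZ// enormZ gtr0_norm//
  pmulr_rgt0// ltr_pdivrMl// mulr1.
Qed.

Lemma lebesgue_sector_fin A : measurable A -> (leb (normalize @^-1` A `&` pball) < +oo)%E.
Proof.
move=> mA; apply: le_lt_trans (lebesgue_rV_eball0_fin 1); apply: le_measure; rewrite ?inE.
- by apply: measurableI; [exact: measurable_sector|exact: measurable_pball].
- exact: measurable_eball.
- by move=> z [_ /andP[_ z1]]; rewrite /eball/= subr0.
Qed.

Lemma sphere_measure_fin A : measurable A -> sigma A \is a fin_num.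
Proof.
move=> mA; rewrite /sphere_measure fin_numM//.
by rewrite ge0_fin_numE ?measure_ge0//; exact: lebesgue_sector_fin.
Qed.

Definition radial_weight (t : R) : R := t `^ (n%:R - 1) * (0 < t)%R%:R.

Lemma radial_weight_ge0 t : 0 <= radial_weight t.
Proof. by rewrite mulr_ge0 ?powR_ge0. Qed.

Lemma measurable_pos d (T : measurableType d) (f : T -> R) :
  measurable_fun setT f -> measurable_fun setT (fun t => (0 < f t)%R%:R : R).
Proof.
move=> mf; rewrite (_ : (fun _ => _) = \1_(`]0, +oo[%classic : set R) \o f).
  exact: measurableT_comp.
by apply/funext => t /=; rewrite indicE mem_setE in_itv/= andbT.
Qed.

Lemma measurable_radial_weight : measurable_fun setT radial_weight.
Proof. by apply: measurable_funM; [exact: measurable_powR|exact: measurable_pos]. Qed.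

Lemma integral_radial_weight (b : R) : 0 < b ->
  (\int[mu]_(t in `]-oo, b[) (radial_weight t)%:E)%E = (b ^+ n / n%:R)%:E.
Proof.
move=> b0; have nR : 0 < n%:R :> R by rewrite ltr0n.
rewrite -(powR_mulrn _ (ltW b0)) -integral_powR_0//.
rewrite [LHS]integral_mkcond [RHS]integral_mkcond; apply: eq_integral => t _.
rewrite !patchE /radial_weight !mem_setE !in_itv/=.
by case: (0 < t); case: (t < b); rewrite ?mulr1 ?mulr0.
Qed.

(** Both sides are measures in the radial variable; they agree on half-lines by
    homogeneity of Lebesgue measure. *)
Lemma polar_sector A (f : R -> R) : measurable A ->
  measurable_fun setT f -> (forall t, 0 <= f t) ->
  (\int[leb]_z (f (enorm z) * (\1_(normalize @^-1` A) z * (0 < enorm z)%R%:R))%:E)%E =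
  (sigma A * \int[mu]_t (f t * radial_weight t)%:E)%E.
Proof.
move=> mA mf f0.
pose w (z : 'rV[R]_n) : R := \1_(normalize @^-1` A) z * (0 < enorm z)%R%:R.
have mn := measurable_sector mA.
have mw : measurable_fun setT w.
  by apply: measurable_funM => //; apply: measurable_pos; exact: measurable_enorm.
have w0 z : 0 <= w z by rewrite mulr_ge0.
pose c := fine (sigma A).
have c0 : 0 <= c by rewrite fine_ge0.
pose v t := c * radial_weight t.
have mv : measurable_fun setT v.
  by apply: measurable_funM => //; exact: measurable_radial_weight.
have v0 t : 0 <= v t by rewrite mulr_ge0 ?radial_weight_ge0.
have me : measurable_fun setT (enorm : 'rV[R]_n -> measurableTypeR R).
  exact: measurable_enorm.
pose nu1 : {measure set (measurableTypeR R) -> \bar R} :=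
  pushm me (densm_measure leb mw w0).
pose nu2 : {measure set (measurableTypeR R) -> \bar R} := densm_measure mu mv v0.
have vE (B : set (measurableTypeR R)) : measurable B -> nu2 B = (c%:E * \int[mu]_(t in B) (radial_weight t)%:E)%E.
  move=> mB; rewrite -ge0_integralZl_EFin//.
    by move=> t _; rewrite lee_fin radial_weight_ge0.
  by apply/measurable_EFinP; apply: measurable_funTS; exact: measurable_radial_weight.
have half (b : R) : nu1 `]-oo, b[%classic = nu2 `]-oo, b[%classic.
  rewrite vE//.
  have -> : nu1 `]-oo, b[%classic = leb (normalize @^-1` A `&` [set z | 0 < enorm z < b]).
    have mS : measurable [set z : 'rV[R]_n | 0 < enorm z < b].
      by have := measurable_shell `]0, b[; rewrite (_ : [set z | _] = [set z | 0 < enorm z < b])//; apply/seteqP; split => z /=; rewrite in_itv.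
    transitivity (\int[leb]_z (\1_(normalize @^-1` A `&` [set z | 0 < enorm z < b]) z)%:E)%E.
      rewrite /nu1 pushmE [LHS]integral_mkcond; apply: eq_integral => z _.
      have e1 : (z \in enorm @^-1` `]-oo, b[) = (enorm z < b).
        by apply/idP/idP; rewrite inE/= in_itv.
      have e2 : (z \in [set z : 'rV[R]_n | 0 < enorm z < b]) = (0 < enorm z < b).
        by apply/idP/idP; rewrite inE.
      rewrite patchE /w !indicE in_setI e1 e2.
      by case: (_ \in normalize @^-1` A); case: (0 < enorm z); case: (enorm z < b);
        rewrite ?mulr0 ?mul0r ?mulr1.
    by rewrite integral_indic// ?setIT//; exact: measurableI.
  have [b0|b0] := ltP 0 b; last first.
    rewrite [X in leb X](_ : _ = set0) ?measure0; last first.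
      rewrite -subset0 => z [_ /= /andP[z0 zb]].
      by have := lt_trans z0 zb; rewrite ltNge b0.
    rewrite integral0_eq ?mule0// => t; rewrite /= in_itv/= => tb.
    by rewrite /radial_weight (ltNge 0 t) (le_trans (ltW tb) b0) mulr0.
  rewrite lebesgue_sector// integral_radial_weight// /c /sphere_measure.
  have fl : leb (normalize @^-1` A `&` pball) \is a fin_num.
    by rewrite ge0_fin_numE//; exact: lebesgue_sector_fin.
  rewrite -(fineK fl) -!EFinM; congr EFin => /=; field.
  by rewrite pnatr_eq0 -lt0n.
have nuE (B : set (measurableTypeR R)) : measurable B -> nu1 B = nu2 B.
  move=> mB; refine (@measure_unique _ R (measurableTypeR R) (@RGenInftyO.G R)
    (fun k : nat => `]-oo, k%:R[%classic) _ _ _ _ nu1 nu2 _ _ B mB).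
  - exact: RGenInftyO.measurableE.
  - move=> _ _ [a ->] [b ->]; exists (Num.min a b).
    by apply/seteqP; split => t /=; rewrite !in_itv/= lt_min => /andP.
  - by move=> k; exists k%:R.
  - apply/seteqP; split => // t _; exists (Num.truncn t).+1 => //=.
    by rewrite in_itv/= truncnS_gt.
  - by move=> _ [b ->]; exact: half.
  - move=> k; rewrite half vE//; have [k0|k0] := ltP 0 (k%:R : R).
      by rewrite integral_radial_weight// -EFinM ltry.
    rewrite integral0_eq ?mule0// => t; rewrite /= in_itv/= => tb.
    by rewrite /radial_weight (ltNge 0 t) (le_trans (ltW tb) k0) mulr0.
have ef : measurable_fun setT (EFin \o f) by exact/measurable_EFinP.
have ef0 t : (0 <= (EFin \o f) t)%E by rewrite /= lee_fin.
transitivity (\int[nu1]_t (f t)%:E)%E.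
  apply/esym; apply: (etrans (ge0_integral_pushforward me _ measurableT ef _)).
    by move=> t _; exact: ef0.
  have dE B : measurable B -> densm_measure leb mw w0 B = (\int[leb]_(z in B) (w z)%:E)%E.
    by [].
  rewrite preimage_setT (ge0_integral_density mw w0 dE)//.
    by move=> z; exact: ef0.
  exact: measurableT_comp ef me.
transitivity (\int[nu2]_t (f t)%:E)%E.
  by apply: eq_measure_integral => B mB _; exact: nuE.
have dE (B : set (measurableTypeR R)) : measurable B ->
  nu2 B = (\int[mu]_(t in B) (v t)%:E)%E by [].
rewrite (@ge0_integral_density _ (measurableTypeR R) R mu nu2 v mv v0 dE (EFin \o f))//.
rewrite -(fineK (sphere_measure_fin mA)) -/c -ge0_integralZl_EFin//.
- by apply: eq_integral => t _; rewrite -!EFinM /v mulrCA.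
- by move=> t _; rewrite lee_fin mulr_ge0// radial_weight_ge0.
- apply/measurable_EFinP; apply: measurable_funM => //.
  exact: measurable_radial_weight.
Qed.

End polar.

Section polar_integral.
Context {R : realType} {n : nat}.
Hypothesis n_gt0 : (0 < n)%N.
Local Notation leb := (@lebesgue_rV R n).
Local Notation sigma := (@sphere_measure R n).
Local Notation mu := (@lebesgue_measure R).

(** By [polar_sector], the image under normalization of Lebesgue measure
    weighted by a radial function is a multiple of the surface measure. *)
Lemma polar_integral (f : R -> R) (h : 'rV[R]_n -> R) (j : R) :
  measurable_fun setT f -> (forall t, 0 <= f t) ->
  measurable_fun setT h -> (forall z, 0 <= h z) ->
  (\int[mu]_t (f t * radial_weight (n := n) t)%:E)%E = j%:E ->
  (\int[leb]_z (h (normalize z) * (f (enorm z) * (0 < enorm z)%R%:R))%:E)%E =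
  (j%:E * \int[sigma]_z (h z)%:E)%E.
Proof.
move=> mf f0 mh h0 jE.
have j0 : 0 <= j.
  rewrite -lee_fin -jE; apply: integral_ge0 => t _.
  by rewrite lee_fin mulr_ge0 ?radial_weight_ge0.
pose w (z : 'rV[R]_n) : R := f (enorm z) * (0 < enorm z)%R%:R.
have mw : measurable_fun setT w.
  apply: measurable_funM.
    by apply: measurableT_comp => //; exact: measurable_enorm.
  by apply: measurable_pos; exact: measurable_enorm.
have w0 z : 0 <= w z by rewrite mulr_ge0.
pose nu := pushm (@measurable_normalize R n) (densm_measure leb mw w0).
have nuE A : measurable A -> nu A = mscale (NngNum j0) sigma A.
  move=> mA; rewrite /mscale/= muleC -jE -polar_sector//.
  transitivity (\int[leb]_(z in normalize @^-1` A) (w z)%:E)%E; first by [].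
  rewrite integral_mkcond; apply: eq_integral => z _; rewrite patchE indicE /w.
  by case: ifP => _; rewrite ?mul1r// mul0r mulr0.
have eh : measurable_fun setT (EFin \o h) by exact/measurable_EFinP.
have eh0 z : (0 <= (EFin \o h) z)%E by rewrite /= lee_fin.
have dE B : measurable B ->
  densm_measure leb mw w0 B = (\int[leb]_(z in B) (w z)%:E)%E by [].
transitivity (\int[nu]_z (h z)%:E)%E.
  apply/esym; apply: (etrans (ge0_integral_pushforward _ _ measurableT eh _)) => //.
    exact: measurable_normalize.
  rewrite preimage_setT (ge0_integral_density mw w0 dE)//.
    by move=> z; exact: eh0.
  by apply: measurableT_comp => //; exact: measurable_normalize.
transitivity (\int[mscale (NngNum j0) sigma]_z (h z)%:E)%E.
  by apply: eq_measure_integral => A mA _; exact: nuE.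
by rewrite ge0_integral_mscale// => z _; exact: eh0.
Qed.

End polar_integral.

(** * Sectors and the fractional measure *)

(** Every set used below is cut out by a bound on the cosine of the angle with
    a fixed direction and by a condition on the norm. *)
Definition sector {R : realType} {n : nat} (k : R) (I : set R) (y : 'rV[R]_n) :
  set 'rV[R]_n := [set z | k * enorm z < dotv y z /\ I (enorm z)].

Section sectors.
Context {R : realType} {n : nat}.
Implicit Types (y z : 'rV[R]_n) (k : R) (I J : set R).

Lemma measurable_sector_set k I y : measurable I -> measurable (sector k I y).
Proof.
move=> mI; rewrite (_ : sector k I y =
    (fun z => dotv y z - k * enorm z) @^-1` `]0, +oo[ `&` enorm @^-1` I).
  apply: measurableI; last exact: (measurable_preimage measurable_enorm mI).
  apply: measurable_preimage => //; apply: measurable_funB.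
    exact: measurable_dotv.
  by apply: measurable_funM => //; exact: measurable_enorm.
by apply/seteqP; split => z; rewrite /sector/= in_itv/= andbT subr_gt0.
Qed.

Lemma preimage_sector_ortho (M : 'M[R]_n) k I y : isomx M ->
  (fun z => (z *m M)%R) @^-1` sector k I (y *m M) = sector k I y.
Proof.
by move=> oM; apply/seteqP; split => z; rewrite /sector/= enorm_ortho// dotv_ortho.
Qed.

(** The arc cosine is decreasing, so that an angular condition is a bound on a
    scalar product. *)
Lemma angle_lt alpha y z : 0 <= alpha <= pi -> y != 0 -> z != 0 ->
  (angle y z < alpha) = (cos alpha * (enorm y * enorm z) < dotv y z).
Proof.
move=> a0pi y0 z0; have yz0 : 0 < enorm y * enorm z by rewrite mulr_gt0// enorm_gt0.
rewrite -ltr_pdivlMr// /angle; set c := _ / _.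
have c1 : -1 <= c <= 1.
  rewrite -ler_norml normrM normrV ?unitfE ?gt_eqF// (gtr0_norm yz0).
  by rewrite ler_pdivrMr// mul1r normr_dotv.
have ac : 0 <= acos c <= pi by rewrite acos_ge0// acos_lepi.
rewrite -[in RHS](@acosK _ c) ?in_itv//=.
by rewrite ltr_cos ?in_itv.
Qed.

End sectors.

Section cones.
Context {R : realType} {n : nat}.
Implicit Types (y z : 'rV[R]_n) (alpha : R).

Lemma coneE alpha (a b : \bar R) y : 0 <= alpha <= pi -> enorm y = 1 ->
  (0 <= a)%E ->
  cone alpha a b y = sector (cos alpha) [set t | (a < t%:E < b)%E] y.
Proof.
move=> a0pi y1 a0; have y0 : y != 0 by rewrite -enorm_gt0 y1.
apply/seteqP; split => z; rewrite /cone /sector/= => -[zy /andP[az zb]].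
  have z0 : z != 0.
    by rewrite -enorm_gt0 -lte_fin (le_lt_trans a0 az).
  by split; [move: zy; rewrite angle_lt// y1 mul1r|rewrite az].
have z0 : z != 0.
  by rewrite -enorm_gt0 -lte_fin (le_lt_trans a0 az).
by split; [rewrite angle_lt// y1 mul1r|rewrite az].
Qed.

Lemma capE alpha : (0 < n)%N -> 0 <= alpha <= pi ->
  cap alpha = sector (cos alpha) [set 1] (basisv 0) :> set 'rV[R]_n.
Proof.
move=> n0 a0pi; have e1 : enorm (basisv 0 : 'rV[R]_n) = 1.
  exact: (enorm_basisv (Ordinal n0)).
have e0 : (basisv 0 : 'rV[R]_n) != 0 by rewrite -enorm_gt0 e1.
by apply/seteqP; split => z; rewrite /cap /sector/= => -[];
  [move=> z1; have z0 : z != 0 by [rewrite -enorm_gt0 z1] |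
   move=> + z1; have z0 : z != 0 by [rewrite -enorm_gt0 z1]];
  rewrite angle_lt// e1 z1 !mul1r.
Qed.

End cones.

Section frac.
Context {R : realType} {n : nat}.
Variable s : R.
Hypotheses (n_gt0 : (0 < n)%N) (s0 : 0 <= s).
Local Notation leb := (@lebesgue_rV R n).
Local Notation sigma := (@sphere_measure R n).
Local Notation mu := (@lebesgue_measure R).

Definition fracm : {measure set 'rV[R]_n -> \bar R}.
Proof. by unshelve refine (@frac_measure R n s : {measure set _ -> \bar R}). Defined.

Lemma fracmE A : fracm A = (\int[leb]_(z in A) (frac_density s z)%:E)%E.
Proof. by []. Qed.

Lemma ge0_integral_fracm D (f : 'rV[R]_n -> R) : measurable D ->
  measurable_fun setT f -> (forall z, 0 <= f z) ->
  (\int[fracm]_(z in D) (f z)%:E)%E =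
  (\int[leb]_(z in D) (f z * frac_density s z)%:E)%E.
Proof.
move=> mD mf f0.
have dE A : measurable A -> fracm A = (\int[leb]_(z in A) (frac_density s z)%:E)%E.
  by move=> _; exact: fracmE.
rewrite (ge0_integral_density (measurable_frac_density s) (frac_density_ge0 s0) dE)//.
by apply/measurable_EFinP; apply: measurable_funTS.
Qed.

(** The density of the fractional measure is radial: with the Jacobian
    [t ^ (n - 1)] the dimension cancels out of the exponent. The cap over which
    [h] is integrated is the sector at the single radius 1. *)
Lemma integral_sector k (I : set R) y (q : R) (h : 'rV[R]_n -> R) (j : R) :
  measurable I -> I `<=` `]0, +oo[ ->
  measurable_fun setT h -> (forall z, 0 <= h z) ->
  (\int[mu]_(t in I) (t `^ (q - 2 * s - 1))%:E)%E = j%:E ->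
  (\int[fracm]_(z in sector k I y) (enorm z `^ q * h (normalize z))%:E)%E =
  ((fracC n s * j)%:E * \int[sigma]_(z in sector k [set 1%R] y) (h z)%:E)%E.
Proof.
move=> mI I0 mh h0 jE.
have C0 : 0 <= fracC n s.
  by rewrite /fracC !(mulr_ge0, invr_ge0) ?powR_ge0 ?Gamma_ge0.
have mc : measurable [set z : 'rV[R]_n | k * enorm z < dotv y z].
  have := @measurable_sector_set R n k setT y measurableT.
  by rewrite (_ : sector k setT y = [set z | k * enorm z < dotv y z])//;
    apply/seteqP; split => z /=; [case|].
pose H (z : 'rV[R]_n) : R := \1_[set z : 'rV[R]_n | k * enorm z < dotv y z] z * h z.
pose f (t : R) : R := t `^ q * (fracC n s * t `^ (- (n%:R + 2 * s))) * \1_I t.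
have mH : measurable_fun setT H by apply: measurable_funM => //.
have H0 z : 0 <= H z by rewrite mulr_ge0.
have mf : measurable_fun setT f.
  apply: measurable_funM => //; apply: measurable_funM; first exact: measurable_powR.
  by apply: measurable_funM => //; exact: measurable_powR.
have f0 t : 0 <= f t.
  apply: mulr_ge0 => //; apply: mulr_ge0; first exact: powR_ge0.
  by apply: mulr_ge0 => //; exact: powR_ge0.
have fj : (\int[mu]_t (f t * radial_weight (n := n) t)%:E)%E = (fracC n s * j)%:E.
  rewrite EFinM -jE -ge0_integralZl_EFin//; last 2 first.
  - by move=> t _; rewrite lee_fin powR_ge0.
  - by apply: measurable_powR_itv.
  rewrite [RHS]integral_mkcond; apply: eq_integral => t _.
  rewrite patchE /f indicE; case: ifPn => tI; last by rewrite mulr0 mul0r.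
  have /I0 : I t by exact/set_mem.
  rewrite /= in_itv/= andbT => t0; rewrite -EFinM /radial_weight t0 !mulr1.
  have -> : t `^ (q - 2 * s - 1) = t `^ q * t `^ (- (n%:R + 2 * s)) * t `^ (n%:R - 1).
    have tN0 : t != 0 by rewrite gt_eqF.
    by rewrite -!powRD ?tN0 ?implybT//; congr (_ `^ _); ring.
  congr EFin; ring.
rewrite ge0_integral_fracm//; last 3 first.
- exact: measurable_sector_set.
- apply: measurable_funM.
    by apply: (measurableT_comp (measurable_powR _)); exact: measurable_enorm.
  by apply: measurableT_comp => //; exact: measurable_normalize.
- by move=> z; rewrite mulr_ge0 ?powR_ge0.
transitivity (\int[leb]_z (H (normalize z) * (f (enorm z) * (0 < enorm z)%R%:R))%:E)%E.
  rewrite integral_mkcond; apply: eq_integral => z _; rewrite patchE.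
  have [z0|z0] := eqVneq z 0.
    rewrite z0 enorm0 ltxx !mulr0 ifF//; apply/negbTE.
    by apply/negP; rewrite inE => -[_ /I0]; rewrite /= enorm0 in_itv/= ltxx.
  have ez : 0 < enorm z by rewrite enorm_gt0.
  rewrite ez mulr1 /H /f !indicE.
  have -> : (z \in sector k I y) =
      (normalize z \in [set z | k * enorm z < dotv y z]) && (enorm z \in I).
    have nzE : (k * enorm (normalize z) < dotv y (normalize z)) = (k * enorm z < dotv y z).
      rewrite enorm_normalize// mulr1 /normalize dotvZr.
      by rewrite -ltr_pdivrMl ?invr_gt0// invrK mulrC.
    apply/idP/andP; rewrite !inE /sector/=; rewrite ?nzE; first by case.
    by move=> [h1 h2]; split => //; rewrite -?nzE.
  case: (normalize z \in _) => /=; last by rewrite !mul0r.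
  case: (enorm z \in I); last by rewrite !mulr0.
  rewrite mul1r mulr1 /frac_density powRN; congr EFin; ring.
rewrite (polar_integral n_gt0 mf f0 mH H0 fj); congr (_ * _)%E.
have mS : measurable (@esphere R n).
  exact: (measurable_preimage measurable_enorm (measurable_set1 (1 : R))).
have sC0 : sigma (~` esphere) = 0%E.
  rewrite /sphere_measure (_ : _ `&` _ = set0) ?measure0 ?mule0//.
  rewrite -subset0 => z [/= zC /andP[z0 _]]; apply: zC.
  by apply: enorm_normalize; rewrite -enorm_gt0.
rewrite (@ge0_negligible_integral _ _ _ sigma setT (~` esphere))//.
- rewrite setTD setCK [LHS]integral_mkcond [RHS]integral_mkcond.
  apply: eq_integral => z _; rewrite !patchE /H indicE.
  have -> : (z \in sector k [set 1] y) =
      (z \in [set z | k * enorm z < dotv y z]) && (z \in esphere).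
    by apply/idP/andP; rewrite !inE.
  case: (z \in esphere); rewrite ?andbF// andbT.
  by case: ifP; rewrite ?mul1r// mul0r.
- exact: measurableC.
- exact/measurable_EFinP.
- by move=> z _; rewrite lee_fin.
Qed.

End frac.

(** * Moments of sets with an axis of symmetry *)

Section ortho_invariance.
Context {R : realType} {n : nat}.
Implicit Types (A D : set 'rV[R]_n) (M : 'M[R]_n) (y z w : 'rV[R]_n).

Definition ortho_invariant (m : set 'rV[R]_n -> \bar R) :=
  forall M A, isomx M -> measurable A -> m ((fun z => (z *m M)%R) @^-1` A) = m A.

Lemma lebesgue_rV_ortho_invariant : ortho_invariant (@lebesgue_rV R n).
Proof. by move=> M A oM mA; exact: lebesgue_rV_ortho. Qed.

Lemma sphere_measure_ortho_invariant : ortho_invariant (@sphere_measure R n).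
Proof.
move=> M A oM mA; rewrite /sphere_measure; congr (_ * _)%E.
have mE : measurable (normalize @^-1` A `&` (pball : set 'rV[R]_n)).
  by apply: measurableI; [exact: measurable_sector|exact: measurable_pball].
apply: etrans (lebesgue_rV_ortho oM mE).
apply: (f_equal (@lebesgue_rV R n)); apply/seteqP; split => z;
  by rewrite /pball/= enorm_ortho// normalize_ortho.
Qed.

Section integrals.
Variable m : {measure set 'rV[R]_n -> \bar R}.
Hypothesis minv : ortho_invariant m.
Local Open Scope ereal_scope.

Lemma ge0_integral_ortho M D (f : 'rV[R]_n -> \bar R) : isomx M -> measurable D ->
  measurable_fun setT f -> (forall z, 0 <= f z) ->
  \int[m]_(z in (fun z => (z *m M)%R) @^-1` D) f (z *m M)%R = \int[m]_(z in D) f z.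
Proof.
move=> oM mD mf f0; have mM := @measurable_mulmx R n M.
apply: (etrans (esym (ge0_integral_pushforward mM m mD _ _))).
- exact: measurable_funTS.
- by move=> z _.
- by apply: eq_measure_integral => A mA _; exact: minv.
Qed.

Lemma integral_ortho M D (f : 'rV[R]_n -> \bar R) : isomx M -> measurable D ->
  measurable_fun setT f ->
  \int[m]_(z in (fun z => (z *m M)%R) @^-1` D) f (z *m M)%R = \int[m]_(z in D) f z.
Proof.
move=> oM mD mf; rewrite integralE [RHS]integralE; congr (_ - _).
  rewrite -(ge0_integral_ortho oM mD (measurable_funepos mf)).
    by apply: eq_integral => z _; rewrite !funeposE.
  by move=> z; exact: funepos_ge0.
rewrite -(ge0_integral_ortho oM mD (measurable_funeneg mf)).
  by apply: eq_integral => z _; rewrite !funenegE.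
by move=> z; exact: funeneg_ge0.
Qed.

End integrals.

Lemma Rintegral_ortho (m : {measure set 'rV[R]_n -> \bar R}) M D D' (f : 'rV[R]_n -> R) :
  ortho_invariant m -> isomx M -> measurable D' -> measurable_fun setT f ->
  (fun z => (z *m M)%R) @^-1` D' = D ->
  \int[m]_(z in D) f (z *m M) = \int[m]_(z in D') f z.
Proof.
move=> minv oM mD mf <-; rewrite /Rintegral; congr fine.
by apply: (@integral_ortho m minv M D' (EFin \o f)) => //; exact/measurable_EFinP.
Qed.

Lemma frac_density_ortho s M z : isomx M -> frac_density s (z *m M) = frac_density s z.
Proof. by move=> oM; rewrite /frac_density enorm_ortho. Qed.

Lemma fracm_ortho_invariant s (s0 : 0 <= s) : ortho_invariant (fracm s0).
Proof.
move=> M A oM mA; rewrite !fracmE.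
have mdens : measurable_fun setT (EFin \o @frac_density R n s).
  by apply/measurable_EFinP; exact: measurable_frac_density.
have dens0 z : (0 <= (EFin \o @frac_density R n s) z)%E.
  by rewrite lee_fin frac_density_ge0.
apply: etrans (@ge0_integral_ortho (@lebesgue_rV R n) lebesgue_rV_ortho_invariant
  M A _ oM mA mdens dens0).
by apply: eq_integral => z _; rewrite /= frac_density_ortho.
Qed.

End ortho_invariance.

Section integrable_tools.
Context d (T : measurableType d) {R : realType} (m : {measure set T -> \bar R}).
Variables (D : set T) (mD : measurable D).
Implicit Types f g : T -> R.

Lemma le_integrableR f g : measurable_fun D f -> (forall z, D z -> `|f z| <= g z) ->
  m.-integrable D (EFin \o g) -> m.-integrable D (EFin \o f).
Proof.
move=> mf fg ig; apply: (le_integrable mD _ _ ig); first exact/measurable_EFinP.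
move=> z Dz; rewrite /= lee_fin (le_trans (fg z Dz))//; exact: ler_norm.
Qed.

Lemma integrable_sumR I (r : seq I) (f : I -> T -> R) :
  (forall i, m.-integrable D (EFin \o f i)) ->
  m.-integrable D (EFin \o (fun z => \sum_(j <- r) f j z)).
Proof.
move=> h.
have -> : EFin \o (fun z => \sum_(j <- r) f j z) = fun z => (\sum_(j <- r) (EFin \o f j) z)%E.
  by apply/funext => z /=; rewrite sumEFin.
by apply: integrable_sum.
Qed.

Lemma Rintegral_sum I (r : seq I) (f : I -> T -> R) :
  (forall i, m.-integrable D (EFin \o f i)) ->
  \int[m]_(z in D) (\sum_(i <- r) f i z) = \sum_(i <- r) \int[m]_(z in D) f i z.
Proof.
move=> h; elim: r => [|i r IH].
  rewrite big_nil (@eq_Rintegral _ _ _ _ _ (fun=> 0)) ?Rintegral_cst ?mul0r//.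
  by move=> z _; rewrite big_nil.
rewrite big_cons -IH -RintegralD//; last exact: integrable_sumR.
by apply: eq_Rintegral => z _; rewrite big_cons.
Qed.

End integrable_tools.

Section moments.
Context {R : realType} {n : nat}.
Implicit Types (A D : set 'rV[R]_n) (M : 'M[R]_n) (y z w : 'rV[R]_n).
Variables (m : {measure set 'rV[R]_n -> \bar R}).
Hypothesis minv : ortho_invariant m.

Lemma refl_fix w y : dotv y w = 0 -> y *m reflmx w = y.
Proof. by move=> yw; rewrite mul_reflmx yw mulr0 scale0r subr0. Qed.

Lemma dotv_refl w z : enorm w = 1 -> dotv (z *m reflmx w) w = - dotv z w.
Proof. by move=> w1; rewrite mul_reflmx !dotvE -enorm_sq w1; ring. Qed.

Lemma dotv_refl_orth w z y : dotv y w = 0 -> dotv (z *m reflmx w) y = dotv z y.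
Proof. by move=> yw; rewrite mul_reflmx !dotvE (dotvC w) yw; ring. Qed.

(** The symmetries fixing an axis replace an explicit parametrization of the
    cap in the computation of its moments. *)
Definition axial y D := forall M, isomx M -> y *m M = y ->
  (fun z => (z *m M)%R) @^-1` D = D.

Lemma axial_sector k (I : set R) y : axial y (sector k I y).
Proof. by move=> M oM yM; rewrite -[in LHS]yM preimage_sector_ortho. Qed.

Lemma measurable_dotvl y : measurable_fun setT (fun z : 'rV[R]_n => dotv z y).
Proof. exact: measurable_dotv. Qed.

Variables (y : 'rV[R]_n) (D : set 'rV[R]_n).
Hypotheses (mD : measurable D) (aD : axial y D) (y1 : enorm y = 1).

(** An integral that changes sign under a symmetry vanishes. *)
Lemma antisymmetric_integral w (f : 'rV[R]_n -> R) : enorm w = 1 -> dotv y w = 0 ->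
  measurable_fun setT f -> m.-integrable D (EFin \o f) ->
  (forall z, f (z *m reflmx w) = - f z) -> \int[m]_(z in D) f z = 0.
Proof.
move=> w1 yw mf intf fN.
have := Rintegral_ortho minv (ortho_refl w1) mD mf (aD (ortho_refl w1) (refl_fix yw)).
rewrite (@eq_Rintegral _ _ _ _ _ (fun z => -1 * f z)); last first.
  by move=> z _; rewrite fN mulN1r.
by rewrite RintegralZl//; lra.
Qed.

Lemma first_moment_orth w : m.-integrable D (EFin \o enorm) ->
  dotv y w = 0 -> \int[m]_(z in D) dotv z w = 0.
Proof.
move=> intz yw; have [->|w0] := eqVneq w 0.
  rewrite (@eq_Rintegral _ _ _ _ _ (fun=> 0)) ?Rintegral_cst ?mul0r// => z _.
  by rewrite dotvC dotv0.
pose v := normalize w; have v1 : enorm v = 1 by exact: enorm_normalize.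
have yv : dotv y v = 0 by rewrite /v /normalize dotvZr yw mulr0.
have wE z : dotv z w = enorm w * dotv z v.
  by rewrite /v /normalize dotvZr mulrA mulfV ?mul1r ?enorm_eq0.
apply: (antisymmetric_integral v1 yv); first exact: measurable_dotvl.
  apply: (@le_integrableR _ _ _ _ _ mD _ (fun z => enorm w * enorm z)).
  - by apply: measurable_funTS; exact: measurable_dotvl.
  - by move=> z _; rewrite mulrC normr_dotv.
  - exact: (integrableZl mD (enorm w) intz).
by move=> z; rewrite !wE dotv_refl// mulrN.
Qed.

(** Only the component of [w] along the axis contributes; the orthogonal one is
    reversed by a reflection. *)
Lemma first_moment w : m.-integrable D (EFin \o enorm) ->
  \int[m]_(z in D) dotv z w = dotv w y * \int[m]_(z in D) dotv z y.
Proof.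
move=> intz.
have intd v : m.-integrable D (EFin \o (fun z => dotv z v)).
  apply: (@le_integrableR _ _ _ _ _ mD _ (fun z => enorm v * enorm z)).
  - by apply: measurable_funTS; exact: measurable_dotvl.
  - by move=> z _; rewrite mulrC normr_dotv.
  - exact: (integrableZl mD (enorm v) intz).
pose w' := w - dotv w y *: y.
have yw' : dotv y w' = 0.
  by rewrite /w' !dotvE -enorm_sq y1 (dotvC y w); ring.
rewrite (@eq_Rintegral _ _ _ _ _ (fun z => dotv w y * dotv z y + dotv z w')).
  rewrite RintegralD//; last exact: (integrableZl mD (dotv w y) (intd y)).
  by rewrite RintegralZl// (first_moment_orth intz yw') addr0.
by move=> z _; rewrite /w' !dotvE; ring.
Qed.

(** Two directions orthogonal to the axis are exchanged by a symmetry. *)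
Lemma second_moment_orth w w' : enorm w = 1 -> enorm w' = 1 ->
  dotv y w = 0 -> dotv y w' = 0 ->
  \int[m]_(z in D) dotv z w ^+ 2 = \int[m]_(z in D) dotv z w' ^+ 2.
Proof.
move=> w1 w1' yw yw'; have [->//|ww'] := eqVneq w w'.
pose v := normalize (w - w').
have v1 : enorm v = 1 by rewrite enorm_normalize// subr_eq0.
have yv : dotv y v = 0 by rewrite /v /normalize !dotvE yw yw' subr0 mulr0.
have oM := ortho_refl v1.
have mf : measurable_fun setT (fun z : 'rV[R]_n => dotv z w' ^+ 2).
  by apply: measurable_funX; exact: measurable_dotvl.
rewrite -(Rintegral_ortho minv oM mD mf (aD oM (refl_fix yv))).
apply: eq_Rintegral => z _; congr (_ ^+ 2).
by rewrite -{1}(refl_swap w1 w1' ww') -/v dotv_ortho.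
Qed.

(** The reflection along [w] fixes both the axis and [w'] and reverses [w]. *)
Lemma cross_moment w w' : m.-integrable D (EFin \o (fun z => enorm z ^+ 2)) ->
  enorm w = 1 -> dotv y w = 0 -> dotv w w' = 0 ->
  \int[m]_(z in D) (dotv z w * dotv z w') = 0.
Proof.
move=> int2 w1 yw ww'.
have mf : measurable_fun setT (fun z : 'rV[R]_n => dotv z w * dotv z w').
  by apply: measurable_funM; exact: measurable_dotvl.
apply: (antisymmetric_integral w1 yw) => //.
  apply: (@le_integrableR _ _ _ _ _ mD _ (fun z => (enorm w * enorm w') * enorm z ^+ 2)).
  - exact: measurable_funTS.
  - move=> z _; rewrite normrM; apply: (@le_trans _ _ ((enorm z * enorm w) * (enorm z * enorm w'))).
      by apply: ler_pM => //; exact: normr_dotv.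
    by rewrite le_eqVlt; apply/orP; left; apply/eqP; ring.
  - exact: (integrableZl mD (enorm w * enorm w') int2).
by move=> z; rewrite dotv_refl// dotv_refl_orth 1?dotvC// mulNr.
Qed.

End moments.

Section quadratic_moment.
Context {R : realType} {n : nat}.
Variables (m : {measure set 'rV[R]_n.+2 -> \bar R}).
Hypothesis minv : ortho_invariant m.
Local Notation e i := (basisv i : 'rV[R]_n.+2).

Lemma quadE (H : 'M[R]_n.+2) z :
  dotv (z *m H) z = \sum_i \sum_j H i j * (dotv z (e i) * dotv z (e j)).
Proof.
rewrite /dotv exchange_big/=; apply: eq_bigr => j _.
rewrite mxE mulr_suml; apply: eq_bigr => i _.
by rewrite -!/(dotv _ _) !dotv_basisv; ring.
Qed.

Lemma dotv_basis (i j : 'I_n.+2) : i != j -> dotv (e i) (e j) = 0.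
Proof. by move=> ij; rewrite dotv_basisv basisvE val_eqE eq_sym (negbTE ij). Qed.

(** In the basis containing the axis the mixed moments vanish and the
    transverse second moments coincide. *)
Lemma quad_moment0 D (H : 'M[R]_n.+2) : measurable D -> axial (e 0) D ->
  m.-integrable D (EFin \o (fun z => enorm z ^+ 2)) ->
  \int[m]_(z in D) dotv (z *m H) z =
  H 0 0 * (\int[m]_(z in D) dotv z (e 0) ^+ 2) +
  (\tr H - H 0 0) * (\int[m]_(z in D) dotv z (e 1) ^+ 2).
Proof.
move=> mD aD int2.
have e1 (i : 'I_n.+2) : enorm (e i) = 1 by exact: enorm_basisv.
have intij (i j : 'I_n.+2) : m.-integrable D (EFin \o (fun z => H i j * (dotv z (e i) * dotv z (e j)))).
  apply: (@le_integrableR _ _ _ _ _ mD _ (fun z => `|H i j| * enorm z ^+ 2)).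
  - apply: measurable_funTS; apply: measurable_funM => //.
    by apply: measurable_funM; exact: measurable_dotvl.
  - move=> z _; rewrite !normrM ler_wpM2l// expr2.
    by apply: ler_pM => //; rewrite (le_trans (normr_dotv _ _))// e1 mulr1.
  - exact: (integrableZl mD `|H i j| int2).
have intij' (i j : 'I_n.+2) : m.-integrable D (EFin \o (fun z => dotv z (e i) * dotv z (e j))).
  apply: (@le_integrableR _ _ _ _ _ mD _ (fun z => enorm z ^+ 2)) => //.
  - by apply: measurable_funTS; apply: measurable_funM; exact: measurable_dotvl.
  - move=> z _; rewrite !normrM expr2.
    by apply: ler_pM => //; rewrite (le_trans (normr_dotv _ _))// e1 mulr1.
transitivity (\sum_i \sum_j H i j * \int[m]_(z in D) (dotv z (e i) * dotv z (e j))).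
  rewrite (@eq_Rintegral _ _ _ _ _ (fun z => \sum_i \sum_j H i j * (dotv z (e i) * dotv z (e j)))); last first.
    by move=> z _; exact: quadE.
  rewrite Rintegral_sum//; last first.
    by move=> i; exact: integrable_sumR.
  apply: eq_bigr => i _; rewrite Rintegral_sum//.
  by apply: eq_bigr => j _; rewrite RintegralZl.
transitivity (\sum_(i < n.+2) H i i * \int[m]_(z in D) (dotv z (e i) ^+ 2)).
  apply: eq_bigr => i _.
  have off (j : 'I_n.+2) : j != i -> H i j * \int[m]_(z in D) (dotv z (e i) * dotv z (e j)) = 0.
    move=> ji; have [i0|i0] := eqVneq i 0.
      under eq_Rintegral do rewrite mulrC.
      rewrite (cross_moment minv mD aD int2 (e1 j)) ?mulr0//.
        by rewrite (@dotv_basis 0)// eq_sym -i0.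
      by rewrite dotv_basis.
    rewrite (cross_moment minv mD aD int2 (e1 i)) ?mulr0//.
      by rewrite (@dotv_basis 0)// eq_sym.
    by rewrite dotv_basis// eq_sym.
  by rewrite (bigD1 i)//= big1 ?addr0.
rewrite (bigD1 0)//=; congr (_ + _).
rewrite /mxtrace [X in (X - _) * _](bigD1 0)//= addrAC subrr add0r mulr_suml.
apply: eq_bigr => i i0; congr (_ * _).
apply: (second_moment_orth minv mD aD) => //; first exact: (e1 1).
  by rewrite (@dotv_basis 0)// eq_sym.
by rewrite (@dotv_basis 0 1).
Qed.

(** In the general position the axis is rotated onto the first basis vector. *)
Lemma quad_moment k (I : set R) y (H : 'M[R]_n.+2) : measurable I -> enorm y = 1 ->
  m.-integrable (sector k I (e 0)) (EFin \o (fun z => enorm z ^+ 2)) ->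
  \int[m]_(z in sector k I y) dotv (z *m H) z =
  dotv (y *m H) y * (\int[m]_(z in sector k I (e 0)) dotv z (e 0) ^+ 2) +
  (\tr H - dotv (y *m H) y) * (\int[m]_(z in sector k I (e 0)) dotv z (e 1) ^+ 2).
Proof.
move=> mI y1 int2.
have [M oM eM] := ortho_exists (enorm_basisv (0 : 'I_n.+2)) y1.
have mq : measurable_fun setT (fun z : 'rV[R]_n.+2 => dotv (z *m H) z).
  by apply: measurable_dotv => //; exact: measurable_mulmx.
rewrite -eM -(Rintegral_ortho minv oM (measurable_sector_set k _ mI) mq (preimage_sector_ortho k I (e 0) oM)).
rewrite (@eq_Rintegral _ _ _ _ _ (fun z => dotv (z *m (M *m H *m M^T)) z)); last first.
  by move=> z _; rewrite !mulmxA -[LHS]dotvC dotv_orthoT// dotvC.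
rewrite quad_moment0//; last 2 first.
- exact: measurable_sector_set.
- exact: axial_sector.
have tE : \tr (M *m H *m M^T) = \tr H by rewrite mxtrace_mulC mulmxA isomxC ?mul1mx.
have hE : (M *m H *m M^T) 0 0 = dotv (e 0 *m M *m H) (e 0 *m M).
  rewrite [RHS]dotvC dotv_orthoT// (@dotv_basisvl _ _ _ 0) -!mulmxA.
  by rewrite (_ : e 0 = 'e_0) -?rowE ?mxE//; apply/rowP => j; rewrite !mxE eqxx.
by rewrite tE hE.
Qed.

End quadratic_moment.

(** * The normalizing constant and integrals over sectors *)

Section gamma.
Context {R : realType}.
Local Notation mu := (@lebesgue_measure R).

Lemma expRN_le (k : nat) (t : R) : 0 < t -> expR (- t) <= k.+1`!%:R * t `^ (- k.+1%:R).
Proof.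
move=> t0; have f0 : 0 < k.+1`!%:R :> R by rewrite ltr0n fact_gt0.
rewrite expRN powR_invn; last exact: ltW.

rewrite -[_^-1]mul1r ler_pdivrMr ?expR_gt0// mulrAC ler_pdivlMr ?exprn_gt0//.
rewrite mul1r -ler_pdivrMl// mulrC; apply: le_trans (expR_ge1Dxn k (ltW t0)).
by rewrite lerDr.
Qed.

(** A divergent integral would have real value 0, hence positivity needs
    convergence: at 0 by comparison with a power, at infinity by comparison
    with a negative power through [expRN_le]. *)
Lemma Gamma_gt0 (a : R) : 0 < a -> 0 < Gamma a.
Proof.
move=> a0; pose f (t : R) := t `^ (a - 1) * expR (- t).
have f_ge0 t : 0 <= f t by rewrite mulr_ge0 ?powR_ge0 ?expR_ge0.
have mf : measurable_fun setT f.
  apply: measurable_funM; first exact: measurable_powR.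
  by apply: measurableT_comp => //; exact: measurable_funN.
have emf (D : set R) : measurable D -> measurable_fun D (EFin \o f).
  by move=> mD; apply/measurable_EFinP; exact: measurable_funTS.
pose k := Num.truncn a.
have ak : a - k.+1%:R < 0 by rewrite subr_lt0 truncnS_gt.
have split01 : `]0%R, +oo[%classic = `]0%R, 1%R[ `|` `[1%R, +oo[%classic :> set R.
  by rewrite -itv_bndbnd_setU// bnd_simp.
have dis : [disjoint `]0%R, 1%R[ & `[1%R, +oo[%classic : set R].
  apply/disj_setPS => t [] /=; rewrite !in_itv/= andbT => /andP[_ t1].
  by rewrite leNgt t1.
have fin : (\int[mu]_(t in `]0%R, +oo[) (f t)%:E < +oo)%E.
  rewrite split01 ge0_integral_setU//=; last 2 first.
  - by rewrite -split01; apply: emf.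
  - by move=> t _; rewrite lee_fin.
  apply: lte_add_pinfty.
  - apply: (@le_lt_trans _ _ (\int[mu]_(t in `]0%R, 1%R[) (t `^ (a - 1))%:E)%E).
      apply: ge0_le_integral => //.
      + by move=> t _; rewrite lee_fin.
      + exact: emf.
      + exact: measurable_powR_itv.
      + move=> t; rewrite /= in_itv/= => /andP[t0 _]; rewrite lee_fin.
        by rewrite ler_piMr ?powR_ge0// expR_le1 oppr_le0 ltW.
    by rewrite integral_powR_0// ltry.
  - apply: (@le_lt_trans _ _ (\int[mu]_(t in `[1%R, +oo[) (k.+1`!%:R%:E * (t `^ (a - k.+1%:R - 1))%:E))%E).
      apply: ge0_le_integral => //.
      + by move=> t _; rewrite lee_fin.
      + exact: emf.
      + by apply: emeasurable_funM => //; exact: measurable_powR_itv.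
      + move=> t; rewrite /= in_itv/= andbT => t1; rewrite -EFinM lee_fin.
        have t0 : 0 < t by exact: lt_le_trans t1.
        rewrite /f mulrC (le_trans (ler_wpM2r (powR_ge0 _ _) (expRN_le k t0)))//.
        rewrite -mulrA -powRD; last by rewrite (gt_eqF t0) implybT.
        by rewrite (_ : - _ + _ = a - k.+1%:R - 1)//; ring.
    rewrite ge0_integralZl_EFin//; last 2 first.
    + by move=> t _; rewrite lee_fin powR_ge0.
    + exact: measurable_powR_itv.
    rewrite -integral_itv_obnd_cbnd; last exact: measurable_powR_itv.
    by rewrite integral_powR_y// -EFinM ltry.
rewrite /Gamma /Rintegral; apply: fine_gt0; rewrite fin andbT.
pose c := expR (- 2) * Num.min 1 (2 `^ (a - 1)).
have c0 : 0 < c.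
  by rewrite mulr_gt0 ?expR_gt0// lt_min ltr01 powR_gt0.
apply: (@lt_le_trans _ _ (\int[mu]_(t in `]1%R, 2%R[) c%:E)%E).
  rewrite integral_cst// [X in (_ * X)%E](_ : _ = 1%E) ?mule1//.
  have := @lebesgue_measure_itv R (Interval (BRight 1) (BLeft 2)).
  rewrite /= lte_fin ltr1n => itvE; apply: (etrans itvE).
  by rewrite -EFinB; congr EFin; ring.
apply: (@le_trans _ _ (\int[mu]_(t in `]1%R, 2%R[) (f t)%:E)%E); last first.
  apply: ge0_subset_integral => //=.
  - exact: emf.
  - by move=> t _; rewrite lee_fin.
  - move=> t; rewrite /= !in_itv/= andbT => /andP[t1 _]; exact: lt_trans t1.
apply: ge0_le_integral => //.
- by move=> t _; rewrite lee_fin ltW.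
- exact: emf.
- move=> t; rewrite /= in_itv/= => /andP[t1 t2]; rewrite lee_fin /c /f mulrC.
  apply: ler_pM; rewrite ?expR_ge0 ?le_min ?ler01 ?powR_ge0//; last first.
    by rewrite ler_expR lerN2 ltW.
  have t0 : 0 < t by exact: lt_trans t1.
  have [a1|a1] := leP 1 a.
    rewrite ge_min; apply/orP; left; rewrite -[X in X <= _](powRr0 t).
    by apply: ler_powR; [exact: ltW|rewrite subr_ge0].
  rewrite ge_min; apply/orP; right.
  rewrite -[a - 1]opprK !(powRN _ (- (a - 1))) lef_pV2 ?posrE ?powR_gt0//.
  by apply: ge0_ler_powR; rewrite ?nnegrE ?oppr_ge0 ?subr_le0 ?ltW.
Qed.

Lemma fracC_gt0 N (s : R) : 0 < s < 1 -> 0 < fracC N s.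
Proof.
move=> /andP[s0 s1]; rewrite /fracC.
have G1 : 0 < Gamma (N%:R / 2 + s).
  by apply: Gamma_gt0; rewrite ltr_wpDl// divr_ge0.
have G2 : 0 < Gamma (1 - s) by apply: Gamma_gt0; rewrite subr_gt0.
by rewrite divr_gt0// !mulr_gt0// powR_gt0// pi_gt0.
Qed.

End gamma.

Lemma integrable_cst_fin d (T : measurableType d) {R : realType}
    (m : {measure set T -> \bar R}) (D : set T) (c : R) :
  measurable D -> (m D < +oo)%E -> m.-integrable D (EFin \o fun=> c).
Proof.
by move=> mD Doo; apply: measurable_bounded_integrable => //; exact: bounded_cst.
Qed.

Lemma integrable_bounded d (T : measurableType d) {R : realType}
    (m : {measure set T -> \bar R}) (D : set T) (f : T -> R) (c : R) :
  measurable D -> (m D < +oo)%E -> measurable_fun D f ->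
  (forall z, D z -> `|f z| <= c) -> m.-integrable D (EFin \o f).
Proof.
move=> mD Doo mf fc; apply: (@le_integrableR _ _ _ _ _ mD _ (fun=> c)) => //.
exact: integrable_cst_fin.
Qed.

Section sector_integrals.
Context {R : realType} {n : nat}.
Variables (s : R) (s0 : 0 <= s) (k : R).
Local Notation N := n.+2.
Local Notation C := (fracC N s).
Local Notation m := (@fracm R N s s0).
Local Notation sigma := (@sphere_measure R N).
Local Notation mu := (@lebesgue_measure R).
Local Notation e i := (basisv i : 'rV[R]_N).
Local Notation cap1 y := (sector k [set 1%R] (y : 'rV[R]_N)).

Lemma measurable_cap1 y : measurable (cap1 y).
Proof. exact: measurable_sector_set. Qed.

Lemma sphere_measure_lty A : measurable A -> (sigma A < +oo)%E.
Proof. by move=> mA; rewrite ltey_eq sphere_measure_fin. Qed.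

Lemma integrable_sphere y (h : 'rV[R]_N -> R) (c : R) : measurable_fun setT h ->
  (forall z, enorm z = 1 -> `|h z| <= c) -> sigma.-integrable (cap1 y) (EFin \o h).
Proof.
move=> mh hc; apply: (integrable_bounded (c := c)).
- exact: measurable_cap1.
- by apply: sphere_measure_lty; exact: measurable_cap1.
- exact: measurable_funTS.
- by move=> z [_ /= z1]; exact: hc.
Qed.

Section radial.
Variables (I : set R) (q j : R).
Hypotheses (mI : measurable I) (I0 : I `<=` `]0, +oo[).
Hypothesis jE : (\int[mu]_(t in I) (t `^ (q - 2 * s - 1))%:E)%E = j%:E.

Lemma sector_integralE y (h : 'rV[R]_N -> R) (c : R) :
  measurable_fun setT h -> (forall z, 0 <= h z) ->
  (forall z, enorm z = 1 -> h z <= c) ->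
  m.-integrable (sector k I y) (EFin \o (fun z => enorm z `^ q * h (normalize z))) /\
  \int[m]_(z in sector k I y) (enorm z `^ q * h (normalize z)) =
  C * j * \int[sigma]_(z in cap1 y) h z.
Proof.
move=> mh h0 hc.
have E := @integral_sector R N s isT s0 k I y q h j mI I0 mh h0 jE.
have ih : sigma.-integrable (cap1 y) (EFin \o h).
  by apply: (integrable_sphere y (c := c) mh) => z z1; rewrite ger0_norm ?hc.
have fh := integrable_fin_num (measurable_cap1 y) ih.
have mf : measurable_fun setT (fun z : 'rV[R]_N => enorm z `^ q * h (normalize z)).
  apply: measurable_funM.
    by apply: (measurableT_comp (measurable_powR _)); exact: measurable_enorm.
  by apply: measurableT_comp => //; exact: measurable_normalize.
have f0 z : 0 <= enorm z `^ q * h (normalize z) by rewrite mulr_ge0 ?powR_ge0.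
split.
  apply/integrableP; split; first by apply/measurable_EFinP; exact: measurable_funTS.
  under eq_integral do rewrite /= ger0_norm//.
  by rewrite E -(fineK fh) -EFinM ltry.
by rewrite /Rintegral E fineM//.
Qed.

Definition cap_size : R := fine (sigma (cap1 (e 0))).

Lemma cap1_ortho y (f : 'rV[R]_N -> R) : enorm y = 1 -> measurable_fun setT f ->
  exists M : 'M[R]_N, [/\ isomx M, e 0 *m M = y &
  \int[sigma]_(z in cap1 y) f z = \int[sigma]_(z in cap1 (e 0)) f (z *m M)].
Proof.
move=> y1 mf; have [M oM eM] := ortho_exists (enorm_basisv (0 : 'I_N)) y1.
have pre : (fun z => (z *m M)%R) @^-1` cap1 y = cap1 (e 0).
  by rewrite -eM preimage_sector_ortho.
exists M; split; [exact: oM|exact: eM|].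
exact: esym (Rintegral_ortho sphere_measure_ortho_invariant oM (measurable_cap1 y) mf pre).
Qed.

Lemma sector_pow y : enorm y = 1 ->
  m.-integrable (sector k I y) (EFin \o (fun z => enorm z `^ q)) /\
  \int[m]_(z in sector k I y) (enorm z `^ q) = C * j * cap_size.
Proof.
move=> y1; have [] := @sector_integralE y (fun=> 1) 1 (measurable_cst _).
- by [].
- by [].
rewrite (_ : (fun z => _) = (fun z : 'rV[R]_N => enorm z `^ q)); last first.
  by apply/funext => z; rewrite mulr1.
move=> h1 h2; split => //; rewrite h2; congr (_ * _).
have [M [_ _ ->]] := cap1_ortho y1 (@measurable_cst _ _ _ _ setT (1 : R)).
by rewrite Rintegral_cst ?mul1r//; exact: measurable_cap1.
Qed.

End radial.

Lemma integral_cap1_axis y : enorm y = 1 ->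
  \int[sigma]_(z in cap1 y) dotv z y = \int[sigma]_(z in cap1 (e 0)) dotv z (e 0).
Proof.
move=> y1; have [M [oM eM ->]] := cap1_ortho y1 (measurable_dotvl y).
by apply: eq_Rintegral => z _; rewrite -eM dotv_ortho.
Qed.

Lemma dotv_normalize (y z : 'rV[R]_N) : enorm z * dotv (normalize z) y = dotv z y.
Proof.
have [->|z0] := eqVneq z 0; first by rewrite enorm0 mul0r dotv0.
by rewrite /normalize dotvZl mulrA mulfV ?mul1r ?enorm_eq0.
Qed.

Lemma sector_first (I : set R) (j : R) y : 0 <= k -> enorm y = 1 ->
  measurable I -> I `<=` `]0, +oo[ ->
  (\int[mu]_(t in I) (t `^ (1 - 2 * s - 1))%:E)%E = j%:E ->
  \int[m]_(z in sector k I y) dotv z y =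
  C * j * \int[sigma]_(z in cap1 (e 0)) dotv z (e 0).
Proof.
move=> k0 y1 mI I0 jE.
have mh : measurable_fun setT (fun z : 'rV[R]_N => `|dotv z y|).
  by apply: measurableT_comp => //; exact: measurable_dotvl.
have [] := @sector_integralE I 1 j mI I0 jE y (fun z => `|dotv z y|) 1 mh.
- by [].
- by move=> z z1; rewrite (le_trans (normr_dotv _ _))// z1 y1 mulr1.
move=> _; rewrite (@eq_Rintegral _ _ _ _ _ (fun z => dotv z y)); last first.
  move=> z; rewrite inE => -[kz _]; rewrite powRr1 ?enorm_ge0//.
  rewrite -[enorm z]ger0_norm ?enorm_ge0// -normrM dotv_normalize ger0_norm//.
  by rewrite dotvC (le_trans _ (ltW kz))// mulr_ge0 ?enorm_ge0.
move=> ->; congr (_ * _); rewrite -(integral_cap1_axis y1).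
apply: eq_Rintegral => z; rewrite inE => -[kz /= z1]; rewrite ger0_norm//.
by rewrite dotvC (le_trans _ (ltW kz))// mulr_ge0 ?enorm_ge0.
Qed.

Local Notation I1 := (\int[sigma]_(z in cap1 (e 0)) (dotv z (e 0) ^+ 2)).
Local Notation I2 := (\int[sigma]_(z in cap1 (e 0)) (dotv z (e 1) ^+ 2)).

Lemma sector_second (I : set R) (j : R) y (H : 'M[R]_N) : enorm y = 1 ->
  measurable I -> I `<=` `]0, +oo[ ->
  (\int[mu]_(t in I) (t `^ (2 - 2 * s - 1))%:E)%E = j%:E ->
  \int[m]_(z in sector k I y) dotv (z *m H) z =
  C * j * (dotv (y *m H) y * I1 + (\tr H - dotv (y *m H) y) * I2).
Proof.
move=> y1 mI I0 jE.
have pow2 : (fun z : 'rV[R]_N => enorm z `^ 2) = (fun z => enorm z ^+ 2).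
  by apply/funext => z; rewrite powR_mulrn ?enorm_ge0.
have [int2 _] := sector_pow mI I0 jE (enorm_basisv (0 : 'I_N)).
rewrite pow2 in int2.
rewrite (quad_moment (fracm_ortho_invariant s0) H mI y1 int2).
have mom (i : 'I_N) : \int[m]_(z in sector k I (e 0)) (dotv z (e i) ^+ 2) =
    C * j * \int[sigma]_(z in cap1 (e 0)) (dotv z (e i) ^+ 2).
  have mh : measurable_fun setT (fun z : 'rV[R]_N => dotv z (e i) ^+ 2).
    by apply: measurable_funX; exact: measurable_dotvl.
  have [] := @sector_integralE I 2 j mI I0 jE (e 0) (fun z => dotv z (e i) ^+ 2) 1 mh.
  - by move=> z; exact: sqr_ge0.
  - move=> z z1; rewrite -real_normK ?num_real// expr_le1//.
    by rewrite (le_trans (normr_dotv _ _))// z1 enorm_basisv mulr1.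
  move=> _ <-; apply: eq_Rintegral => z _.
  by rewrite powR_mulrn ?enorm_ge0// -exprMn dotv_normalize.
by rewrite (mom 0) (mom 1); ring.
Qed.

(** On the unit sphere the identity form is 1; its second moment is the sum of
    those along the axis and along [n.+1] transverse directions. *)
Lemma cap_sizeE : cap_size = I1 + n.+1%:R * I2.
Proof.
have int2 : sigma.-integrable (cap1 (e 0)) (EFin \o (fun z => enorm z ^+ 2)).
  apply: (integrable_sphere _ (c := 1)).
    by apply: measurable_funX; exact: measurable_enorm.
  by move=> z ->; rewrite expr1n normr1.
have := quad_moment sphere_measure_ortho_invariant 1%:M (measurable_set1 (1 : R))
  (enorm_basisv (0 : 'I_N)) int2.
rewrite mulmx1 -enorm_sq enorm_basisv expr1n mul1r mxtrace1.
rewrite (@eq_Rintegral _ _ _ _ _ (fun=> 1)); last first.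
  by move=> z; rewrite inE => -[_ /= z1]; rewrite mulmx1 -enorm_sq z1 expr1n.
rewrite Rintegral_cst ?mul1r; last exact: measurable_cap1.
move=> capE; apply: (etrans capE); congr (_ + _ * _).
by rewrite -[in LHS]natr1; ring.
Qed.

(** On a cap contained in a half-sphere the cosine lies between 0 and 1, so it
    dominates its square. *)
Lemma cap_first_ge : 0 <= k -> I1 <= \int[sigma]_(z in cap1 (e 0)) dotv z (e 0).
Proof.
move=> k0; have e01 : enorm (e 0) = 1 by exact: (enorm_basisv (0 : 'I_N)).
have le1 (z : 'rV[R]_N) : enorm z = 1 -> `|dotv z (e 0)| <= 1.
  by move=> z1; rewrite (le_trans (normr_dotv _ _))// z1 e01 mulr1.
apply: le_Rintegral.
- exact: measurable_cap1.
- apply: (integrable_sphere _ (c := 1)).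
    by apply: measurable_funX; exact: measurable_dotvl.
  by move=> z /le1 z1; rewrite normrX expr_le1.
- by apply: (integrable_sphere _ (c := 1)) => //; exact: measurable_dotvl.
- move=> z [kz /= z1]; have z0 : 0 <= dotv z (e 0).
    by rewrite dotvC (le_trans _ (ltW kz))// mulr_ge0 ?enorm_ge0.
  by rewrite expr2 ler_piMr// (le_trans _ (le1 z z1))// ler_norm.
Qed.

End sector_integrals.

(** * Differential calculus in R^n *)

Section real_mvt.
Context {R : realType}.

Lemma mvt1 (f df : R -> R) : (forall t : R, 0 <= t <= 1 -> is_derive t 1 f (df t)) ->
  exists2 t, 0 <= t <= 1 & f 1 - f 0 = df t.
Proof.
move=> fd; have [t| |t] := @MVT_segment R f df 0 1 ler01.
- by rewrite in_itv/= => /andP[/ltW t0 /ltW t1]; apply: fd; rewrite t0.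
- apply: derivable_within_continuous => t; rewrite in_itv/= => /fd.
  by case.
- by rewrite in_itv/= subr0 mulr1 => t01 E; exists t.
Qed.

(** The increment [c] may have either sign, which is what a change of one
    coordinate requires. *)
Lemma mvt0 (f df : R -> R) (c : R) :
  (forall t, 0 <= t <= 1 -> is_derive (t * c) 1 f (df (t * c))) ->
  exists2 t, 0 <= t <= 1 & f c - f 0 = df (t * c) * c.
Proof.
move=> fd; have [t t01|t t01] := @mvt1 (f \o ( *%R^~ c)) (fun t => df (t * c) * c).
  have dc : is_derive t 1 ( *%R^~ c : R -> R) c.
    have := is_deriveZ c (@is_derive_id _ _ t 1).
    rewrite (_ : _ \*: id = *%R^~ c); last by apply/funext => t' /=; rewrite mulrC.
    by rewrite [_ *: 1]mulr1.
  have h : is_derive (t * c) 1 f (df (t * c)) by exact: fd.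
  exact: (@is_derive1_comp R f ( *%R^~ c) t _ _ h dc).
by rewrite /= mul1r mul0r; exists t.
Qed.
End real_mvt.

Section topology.
Context {R : realType} {n : nat}.
Implicit Types (x y z : 'rV[R]_n) (r : R).

Lemma enorm_le_coord y (e : R) : (forall i, `|y 0 i| <= e) -> enorm y <= n%:R * e.
Proof.
move=> h; rewrite (le_trans (enorm_le_sum y))//.
rewrite (@le_trans _ _ (\sum_(i < n) e))//; first exact: ler_sum.
by rewrite sumr_const card_ord -[leLHS]mulr_natl.
Qed.

Lemma nbhs_coord y (P : set 'rV[R]_n) : nbhs y P <->
  exists2 e : R, 0 < e & forall z, (forall i, `|z 0 i - y 0 i| < e) -> P z.
Proof.
split.
  move=> /nbhs_ballP[e /= e0 yP]; exists e => // z h; apply: yP.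
  by split => // i j; rewrite !ord1 /ball/= distrC.
move=> [e e0 h]; apply/nbhs_ballP; exists e => //= z [_ yz]; apply: h => i.
by rewrite distrC; exact: yz.
Qed.

Lemma nbhs_eball y e : 0 < e -> nbhs y (eball y e).
Proof.
move=> e0; apply/nbhs_coord; exists (e / n.+1%:R); first by rewrite divr_gt0.
move=> z h; rewrite /eball/=.
apply: (@le_lt_trans _ _ (n%:R * (e / n.+1%:R))).
  by apply: enorm_le_coord => i; rewrite !mxE ltW.
by rewrite mulrCA gtr_pMr// ltr_pdivrMr// mul1r ltr_nat.
Qed.

Lemma nbhs_enorm y (P : set 'rV[R]_n) : nbhs y P <->
  exists2 e : R, 0 < e & eball y e `<=` P.
Proof.
split; last by move=> [e e0 yP]; apply: filterS yP _; exact: nbhs_eball.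
move=> /nbhs_coord[e e0 h]; exists e => // z; rewrite /eball/= => zy.
by apply: h => i; rewrite (le_lt_trans _ zy)// (le_trans _ (ler_coord_enorm _ i))// !mxE.
Qed.

Lemma eball_sub x r y : eball x r y -> eball y (r - enorm (y - x)) `<=` eball x r.
Proof.
move=> _ z; rewrite /eball/= ltrBrDr => h.
have -> : z - x = (z - y) + (y - x) by rewrite addrA subrK.
exact: le_lt_trans (enormD _ _) h.
Qed.

Lemma open_eball x r : open (eball x r).
Proof.
rewrite openE => y xy; apply/nbhs_enorm; exists (r - enorm (y - x)).
  by rewrite subr_gt0.
exact: eball_sub.
Qed.

Lemma eball_convex x r y z t : 0 <= t <= 1 -> eball x r y -> eball x r z ->
  eball x r (y + t *: (z - y)).
Proof.
move=> /andP[t0 t1] yr zr; rewrite /eball/=.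
have -> : y + t *: (z - y) - x = (1 - t) *: (y - x) + t *: (z - x).
  by rewrite scalerBl scale1r !scalerBr; apply/rowP => i; rewrite !mxE; ring.
rewrite (le_lt_trans (enormD _ _))// !enormZ ger0_norm ?subr_ge0// (ger0_norm t0).
move: yr zr; rewrite /eball/= => yr zr.
have [->|t0'] := eqVneq t 0; first by rewrite subr0 mul0r mul1r addr0.
have tp : 0 < t by rewrite lt_def t0'.
have : (1 - t) * enorm (y - x) <= (1 - t) * r by rewrite ler_wpM2l ?subr_ge0// ltW.
have : t * enorm (z - x) < t * r by rewrite ltr_pM2l.
lra.
Qed.

End topology.

Section line_derivative.
Context {R : realType} {n : nat}.
Implicit Types (f : 'rV[R]_n -> R) (y v h : 'rV[R]_n).

Lemma is_derive_line f y v t df :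
  is_derive (y + t *: v) v f df -> is_derive t 1 (fun t : R => f (y + t *: v)) df.
Proof.
move=> [fd fv].
have E : (fun h : R => h^-1 *: (((fun t : R => f (y + t *: v)) \o shift t) (h *: 1) - f (y + t *: v))) =
         (fun h : R => h^-1 *: ((f \o shift (y + t *: v)) (h *: v) - f (y + t *: v))).
  apply/funext => h /=; congr (_ *: (f _ - _)).
  by rewrite [h *: 1]mulr1 scalerDl addrCA.
by apply: DeriveDef; [rewrite /derivable E | rewrite /derive E].
Qed.

(** By the mean value theorem in the direction of the coordinate. *)
Lemma partial_increment f y (i : 'I_n) (c g e : R) :
  (forall t, 0 <= t <= 1 -> derivable f (y + (t * c) *: basisv i) (basisv i)) ->
  (forall t, 0 <= t <= 1 -> `|partial i f (y + (t * c) *: basisv i) - g| <= e) ->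
  `|f (y + c *: basisv i) - f y - c * g| <= e * `|c|.
Proof.
move=> fd fe.
have [t t01] := @mvt0 R (fun t : R => f (y + t *: basisv i)) (fun t => partial i f (y + t *: basisv i)) c
  (fun t ht => is_derive_line (derivableP (fd t ht))).
rewrite scale0r addr0 => ->; rewrite [c * g]mulrC -mulrBl normrM.
by rewrite ler_wpM2r// fe.
Qed.

Definition trunc_row (j : nat) h : 'rV[R]_n := \row_i (if (i < j)%N then h 0 i else 0).

Lemma trunc_row0 h : trunc_row 0 h = 0.
Proof. by apply/rowP => i; rewrite !mxE. Qed.

Lemma trunc_row_full h : trunc_row n h = h.
Proof. by apply/rowP => i; rewrite !mxE ltn_ord. Qed.

Lemma trunc_rowS (j : 'I_n) h : trunc_row j.+1 h = trunc_row j h + h 0 j *: basisv j.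
Proof.
apply/rowP => i; rewrite !mxE ltnS leq_eqVlt.
have [->|ij] := eqVneq i j; first by rewrite eqxx ltnn mulr1 add0r.
by rewrite val_eqE (negbTE ij) mulr0 addr0.
Qed.

(** First-order expansion of a function with continuous partial derivatives, by
    changing one coordinate after the other. *)
Lemma first_order_expansion f y (e d : R) : 0 < d ->
  (forall i (z : 'rV[R]_n), (forall k, `|z 0 k - y 0 k| < d) -> derivable f z (basisv i)) ->
  (forall i (z : 'rV[R]_n), (forall k, `|z 0 k - y 0 k| < d) -> `|partial i f z - partial i f y| <= e) ->
  forall h, (forall k, `|h 0 k| < d) ->
  `|f (y + h) - f y - \sum_i h 0 i * partial i f y| <= e * \sum_i `|h 0 i|.
Proof.
move=> d0 fd fe h hd.
pose y_ j := y + trunc_row j h.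
have close (j : 'I_n) t k : 0 <= t <= 1 ->
    `|(y_ j + (t * h 0 j) *: basisv j) 0 k - y 0 k| < d.
  move=> /andP[t0 t1]; rewrite !mxE.
  have [->|kj] := eqVneq k j.
    rewrite ltnn addr0 eqxx mulr1 addrAC subrr add0r normrM ger0_norm//.
    by rewrite (le_lt_trans _ (hd j))// ler_piMl.
  rewrite val_eqE (negbTE kj) mulr0 addr0 addrAC subrr add0r.
  by case: ifP => _; rewrite ?normr0.
have step (j : 'I_n) : `|f (y_ j.+1) - f (y_ j) - h 0 j * partial j f y| <= e * `|h 0 j|.
  rewrite /y_ trunc_rowS addrA -/(y_ j); apply: partial_increment => t t01.
    by apply: fd => k; exact: close.
  by apply: fe => k; exact: close.
have -> : f (y + h) - f y = \sum_(j < n) (f (y_ j.+1) - f (y_ j)).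
  rewrite -(big_mkord xpredT (fun j => f (y_ j.+1) - f (y_ j))) telescope_sumr//.
  by rewrite /y_ trunc_row_full trunc_row0 addr0.
rewrite -sumrB mulr_sumr (le_trans (ler_norm_sum _ _ _))//.
by apply: ler_sum => j _; exact: step.
Qed.

(** Only partial derivatives along the basis are given; their continuity yields
    all directional derivatives. *)
Lemma is_derive_partials f (U : set 'rV[R]_n) y v : open U -> U y ->
  (forall i z, U z -> derivable f z (basisv i)) ->
  (forall i, {for y, continuous (partial i f)}) ->
  is_derive y v f (\sum_i v 0 i * partial i f y).
Proof.
move=> oU Uy fd fc.
suff H : h^-1 *: ((f \o shift y) (h *: v) - f y) @[h --> 0^'] -->
    (\sum_i v 0 i * partial i f y).
  by apply: DeriveDef; [exact: cvgP H|exact: cvg_lim H].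
pose S := \sum_i `|v 0 i|.
have S0 : 0 <= S by apply: sumr_ge0.
apply/cvgrPdist_le => e e0.
pose e' := e / (S + 1).
have e'0 : 0 < e' by rewrite divr_gt0// ltr_wpDl.
have [d d0 hd] : exists2 d : R, 0 < d & forall z : 'rV[R]_n, (forall i, `|z 0 i - y 0 i| < d) ->
    U z /\ forall i, `|partial i f z - partial i f y| <= e'.
  apply/nbhs_coord.
  have near_partial : \forall z \near y, forall i : 'I_n, `|partial i f z - partial i f y| <= e'.
    apply: (@filter_forall _ 'I_n (fun i z => `|partial i f z - partial i f y| <= e')
      (nbhs y) (nbhs_filter y)) => i; have /cvgrPdist_le /(_ e' e'0) := fc i.
    by apply: filterS => z; rewrite distrC.
  by apply: filterS (filterI (open_nbhs_nbhs (conj oU Uy)) near_partial) => z [].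
have vd : 0 < d / (S + 1) by rewrite divr_gt0// ltr_wpDl.
near=> h.
have h0 : h != 0 by near: h; exact: nbhs_dnbhs_neq.
have hS : `|h| < d / (S + 1).
  near: h; apply: nbhs_dnbhs; apply/nbhs_ballP; exists (d / (S + 1)) => //= z.
  by rewrite /ball/= sub0r normrN.
have hv k : `|(h *: v) 0 k| < d.
  rewrite mxE normrM.
  have vk : `|v 0 k| <= S by rewrite /S (bigD1 k)//= lerDl sumr_ge0.
  apply: (@le_lt_trans _ _ (`|h| * (S + 1))).
    by rewrite ler_wpM2l// (le_trans vk)// lerDl.
  by rewrite -ltr_pdivlMr// ltr_wpDl.
have := @first_order_expansion f y e' d d0 (fun i z hz => fd i z (hd z hz).1)
  (fun i z hz => (hd z hz).2 i) (h *: v) hv.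
have -> : \sum_i (h *: v) 0 i * partial i f y = h * \sum_i v 0 i * partial i f y.
  by rewrite mulr_sumr; apply: eq_bigr => i _; rewrite mxE mulrA.
have -> : \sum_i `|(h *: v) 0 i| = `|h| * S.
  by rewrite mulr_sumr; apply: eq_bigr => i _; rewrite mxE normrM.
move=> H; rewrite /= [h *: v + y]addrC distrC.
set L := \sum_i _ in H *; set F := f (y + h *: v) - f y in H *.
have -> : h^-1 *: F - L = h^-1 * (F - h * L).
  by rewrite mulrBr mulrA mulVf// mul1r.
rewrite normrM normfV ler_pdivrMl ?normr_gt0// (le_trans H)//.
rewrite mulrCA ler_wpM2l// /e' mulrAC ler_pdivrMr ?ltr_wpDl//.
by rewrite ler_wpM2l ?(ltW e0)// lerDl.
Unshelve. all: by end_near. Qed.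

End line_derivative.

Section closure_extension.
Context {R : realType} {n : nat}.
Implicit Types (f : 'rV[R]_n -> R) (x y : 'rV[R]_n) (r : R).

(** Continuity up to the boundary is used inside the ball, where it is
    continuity in the ambient space. *)
Lemma extends_continuous f x r y : extends_to_closure x r f -> eball x r y ->
  {for y, continuous f}.
Proof.
move=> [g [gc gf]] yr.
have : {within eball x r, continuous g}.
  by apply: continuous_subspaceW gc => z; rewrite /eball /ecball/=; exact: ltW.
rewrite continuous_open_subspace; last exact: open_eball.
move=> /(_ y (mem_set yr)) cg.
have nb : nbhs y (eball x r) := open_nbhs_nbhs (conj (@open_eball R n x r) yr).
move=> A; rewrite -[f y](gf y yr) => /cg gA.
by apply: (@filterS2 _ (nbhs y) (nbhs_filter y) _ _ _ _ nb gA) => z /gf /= <-.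
Qed.

Lemma closed_ecball x r : closed (ecball x r).
Proof.
rewrite -[ecball x r]setCK; apply: open_closedC; rewrite openE => y yr.
have yr' : r < enorm (y - x) by rewrite ltNge; exact/negP.
apply/nbhs_enorm; exists (enorm (y - x) - r); first by rewrite subr_gt0.
move=> z; rewrite /eball/= ltrBrDr => zy zr.
have : enorm (y - x) <= enorm (z - y) + enorm (z - x).
  have -> : y - x = (y - z) + (z - x) by rewrite addrA subrK.
  by rewrite (enormBC z y) enormD.
by move=> h; have := le_trans h (lerD (lexx _) zr); rewrite leNgt zy.
Qed.

Lemma compact_ecball x r : compact (ecball x r).
Proof.
pose B := [set v : 'rV[R]_n | forall i, `[x 0 i - r, x 0 i + r]%classic (v 0 i)].
have cB : compact B.
  by apply: (@rV_compact _ n (fun i => `[x 0 i - r, x 0 i + r]%classic)) => i; exact: segment_compact.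
apply: (subclosed_compact (@closed_ecball x r) cB) => z zr i.
rewrite /= in_itv/= -ler_distlC distrC (le_trans _ zr)// (le_trans _ (ler_coord_enorm _ i))//.
by rewrite !mxE.
Qed.

Lemma extends_bounded f x r : extends_to_closure x r f ->
  exists K : R, forall y, eball x r y -> `|f y| <= K.
Proof.
move=> [g [gc gf]].
have /compact_bounded[M [_ hM]] := continuous_compact gc (@compact_ecball x r).
exists (`|M| + 1) => y yr; rewrite -gf//; apply: hM.
  by rewrite (le_lt_trans (ler_norm M))// ltrDl.
by exists y => //; rewrite /ecball/=; exact: ltW.
Qed.

End closure_extension.

Section opnorm.
Context {R : realType} {n : nat}.
Implicit Types (A B : 'M[R]_n) (v w : 'rV[R]_n).

Lemma dotv_mulmxT A v w : dotv (v *m A) w = dotv v (w *m A^T).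
Proof. by rewrite !dotv_mx trmx_mul trmxK mulmxA. Qed.

Lemma enorm_mulmx_le A v : enorm (v *m A^T) <= (\sum_i \sum_j `|A i j|) * enorm v.
Proof.
rewrite (le_trans (enorm_le_sum _))// mulr_suml; apply: ler_sum => i _.
rewrite mxE mulr_suml (le_trans (ler_norm_sum _ _ _))//; apply: ler_sum => j _.
by rewrite mxE normrM mulrC ler_wpM2l// ler_coord_enorm.
Qed.

Let S A := [set enorm (v *m A^T) | v in @esphere R n].

Let S_ub A : has_ubound (S A).
Proof.
exists (\sum_i \sum_j `|A i j|) => _ [v v1 <-].
by rewrite (le_trans (enorm_mulmx_le _ _))// (v1 : enorm v = 1) mulr1.
Qed.

Lemma opnorm_ge A v : enorm v = 1 -> enorm (v *m A^T) <= opnorm A.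
Proof. by move=> v1; apply: (ub_le_sup (S_ub A)); exists v. Qed.

Lemma opnorm_ge0 A : 0 <= opnorm A.
Proof.
rewrite /opnorm -/(S A); have [->|/set0P[_ [v v1 _]]] := eqVneq (S A) set0.
  by rewrite sup0.
exact: le_trans (enorm_ge0 _) (opnorm_ge A v1).
Qed.

Lemma enorm_mulmx A v : enorm (v *m A^T) <= opnorm A * enorm v.
Proof.
have [->|v0] := eqVneq v 0; first by rewrite mul0mx enorm0 mulr0.
have := opnorm_ge A (enorm_normalize v0).
rewrite /normalize -scalemxAl enormZ ger0_norm ?invr_ge0 ?enorm_ge0//.
by rewrite ler_pdivrMl ?enorm_gt0// mulrC.
Qed.

Lemma opnorm_le A (c : R) : 0 <= c -> (forall v, enorm v = 1 -> enorm (v *m A^T) <= c) ->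
  opnorm A <= c.
Proof.
move=> c0 h; rewrite /opnorm -/(S A); have [->|/set0P S0] := eqVneq (S A) set0.
  by rewrite sup0.
by apply: ge_sup => // _ [v v1 <-]; exact: h.
Qed.

Lemma opnorm_sum_le A : opnorm A <= \sum_i \sum_j `|A i j|.
Proof.
apply: opnorm_le => [|v v1].
  by apply: sumr_ge0 => i _; apply: sumr_ge0.
by rewrite (le_trans (enorm_mulmx_le _ _))// v1 mulr1.
Qed.

Lemma normr_bilin A v w : `|dotv (v *m A) w| <= opnorm A * (enorm v * enorm w).
Proof.
rewrite dotv_mulmxT (le_trans (normr_dotv _ _))// mulrCA ler_wpM2l ?enorm_ge0//.
exact: enorm_mulmx.
Qed.

End opnorm.

Lemma mxBE {R : realType} {n : nat} (A B : 'M[R]_n) i j : (A - B) i j = A i j - B i j.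
Proof. by rewrite !mxE. Qed.

(** The operator norm is a supremum of continuous functions of the matrix. *)
Lemma opnorm_lower_semicontinuous {R : realType} {n : nat} (h : 'rV[R]_n -> 'M[R]_n) y (c : R) :
  (forall i j, {for y, continuous (fun z => h z i j)}) -> c < opnorm (h y) ->
  \forall z \near y, c < opnorm (h z).
Proof.
move=> ch cy; have [c0|c0] := ltP c 0.
  by apply: (@filterE _ (nbhs y) (nbhs_filter y)) => z; exact: lt_le_trans c0 (opnorm_ge0 _).
have [v v1 cv] : exists2 v, enorm v = 1 & c < enorm (v *m (h y)^T).
  apply: contrapT => nv; have : opnorm (h y) <= c.
    apply: opnorm_le => // v v1; rewrite leNgt; apply/negP => cv.
    by apply: nv; exists v.
  by rewrite leNgt cy.
pose e := (enorm (v *m (h y)^T) - c) / (n%:R * n%:R + 1).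
have d0 : 0 < n%:R * n%:R + 1 :> R by rewrite ltr_wpDl// mulr_ge0.
have e0 : 0 < e by rewrite divr_gt0// subr_gt0.
have near_h : \forall z \near y, forall i j : 'I_n, `|h y i j - h z i j| <= e.
  apply: (@filter_forall _ 'I_n (fun i z => forall j : 'I_n,
    `|h y i j - h z i j| <= e) (nbhs y) (nbhs_filter y)) => i.
  apply: (@filter_forall _ 'I_n (fun j z =>
    `|h y i j - h z i j| <= e) (nbhs y) (nbhs_filter y)) => j.
  by have /cvgrPdist_le /(_ e e0) := ch i j.
apply: (@filterS _ (nbhs y) (nbhs_filter y) _ _ _ near_h) => z hz.
apply: (@lt_le_trans _ _ (enorm (v *m (h z)^T))); last exact: opnorm_ge.
have : enorm (v *m (h y)^T) <= enorm (v *m (h z)^T) + enorm (v *m (h y - h z)^T).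
  by rewrite (le_trans _ (enormD _ _))// -mulmxDr -linearD/= addrC subrK.
have : enorm (v *m (h y - h z)^T) <= n%:R * n%:R * e.
  rewrite (le_trans (enorm_mulmx_le _ _))// v1 mulr1.
  apply: (@le_trans _ _ (\sum_(i < n) \sum_(j < n) e)).
    by apply: ler_sum => i _; apply: ler_sum => j _; rewrite mxBE; exact: hz.
  by rewrite !sumr_const card_ord -mulrnA -[leLHS]mulr_natl natrM.
have : n%:R * n%:R * e < enorm (v *m (h y)^T) - c.
  by rewrite /e mulrCA gtr_pMr ?subr_gt0// ltr_pdivrMr// mul1r ltrDl.
lra.
Qed.

Section C2_ball.
Context {R : realType} {n : nat}.
Variables (u : 'rV[R]_n -> R) (x : 'rV[R]_n) (r : R).
Hypothesis uC2 : C2_closed_ball u x r.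
Implicit Types (y z v w : 'rV[R]_n).
Local Notation p := (grad u x).

Lemma is_derive_grad y v : eball x r y -> is_derive y v u (dotv v (grad u y)).
Proof.
case: uC2 => _ du _ cu _ yr.
have -> : dotv v (grad u y) = \sum_i v 0 i * partial i u y.
  by apply: eq_bigr => i _; rewrite mxE.
refine (@is_derive_partials R n u (eball x r) y v (@open_eball R n x r) yr _ _).
  by move=> i z; exact: du.
by move=> i; exact: extends_continuous (cu i) yr.
Qed.

Lemma is_derive_hessian y v w : eball x r y ->
  is_derive y v (fun z => dotv w (grad u z)) (dotv (v *m hessian u y) w).
Proof.
case: uC2 => _ _ d2u _ c2u yr.
have dpart i : is_derive y v (partial i u) (\sum_j v 0 j * partial j (partial i u) y).
  refine (@is_derive_partials R n (partial i u) (eball x r) y v (@open_eball R n x r) yr _ _).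
    by move=> j z; exact: d2u.
  by move=> j; exact: extends_continuous (c2u i j) yr.
have := is_derive_sum (fun i => is_deriveZ (w 0 i) (dpart i)).
rewrite (_ : \sum_(i < n) _ = fun z => dotv w (grad u z)); last first.
  by apply/funext => z; rewrite fct_sumE; apply: eq_bigr => i _; rewrite mxE.
rewrite (_ : \sum_(i < n) _ = dotv (v *m hessian u y) w)//.
apply: eq_bigr => i _; rewrite mxE [LHS]mulrC; congr (_ * _).
by apply: eq_bigr => j _; rewrite mxE.
Qed.

Lemma segment_in_ball (rho t : R) a b : 0 <= t <= 1 -> eball x rho (x + a) ->
  eball x rho (x + b) -> eball x rho (x + a + t *: (b - a)).
Proof.
move=> t01 ha hb; have := eball_convex t01 ha hb.
by rewrite (_ : x + b - (x + a) = b - a)// opprD addrACA subrr add0r.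
Qed.

Lemma eball_shift (rho : R) a : eball x rho (x + a) <-> enorm a < rho.
Proof. by rewrite /eball/= addrAC subrr add0r. Qed.

Lemma grad_increment a w : enorm a < r -> exists2 t, 0 <= t <= 1 &
  dotv w (grad u (x + a)) - dotv w p = dotv (a *m hessian u (x + t *: a)) w.
Proof.
move=> ar; have [t t01|t t01] := @mvt1 R (fun t => dotv w (grad u (x + t *: a)))
    (fun t => dotv (a *m hessian u (x + t *: a)) w).
  apply: (@is_derive_line _ _ (fun z => dotv w (grad u z))).
  apply: is_derive_hessian; apply/eball_shift; rewrite enormZ.
  case/andP: t01 => t0 t1; rewrite ger0_norm// (le_lt_trans _ ar)//.
  by rewrite ler_piMl ?enorm_ge0.
by rewrite scale1r scale0r addr0; exists t.
Qed.

(** The derivative of the first-order remainder is an increment of the gradient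
    over a distance at most [rho], hence at most [K * rho]. *)
Lemma remainder_lipschitz (K rho : R) a b :
  (forall y, eball x r y -> opnorm (hessian u y) <= K) ->
  rho < r -> enorm a <= rho -> enorm b <= rho ->
  `|u (x + b) - u (x + a) - dotv (b - a) p| <= K * rho * enorm (b - a).
Proof.
move=> hK rr arho brho.
have ar : eball x r (x + a) by apply/eball_shift; exact: le_lt_trans rr.
have br : eball x r (x + b) by apply/eball_shift; exact: le_lt_trans rr.
have [t t01|t t01] := @mvt1 R (fun t => u (x + a + t *: (b - a)))
    (fun t => dotv (b - a) (grad u (x + a + t *: (b - a)))).
  by apply: is_derive_line; apply: is_derive_grad; exact: segment_in_ball.
rewrite scale1r scale0r addr0 (_ : x + a + (b - a) = x + b); last first.
  by rewrite -addrA [a + _]addrC subrK.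
move=> ->; have crho : enorm (a + t *: (b - a)) <= rho.
  have -> : a + t *: (b - a) = (1 - t) *: a + t *: b.
    by apply/rowP => i; rewrite !mxE; ring.
  case/andP: t01 => t0 t1; rewrite (le_trans (enormD _ _))// !enormZ.
  rewrite ger0_norm ?subr_ge0// (ger0_norm t0).
  have h1 : (1 - t) * enorm a <= (1 - t) * rho by rewrite ler_wpM2l// subr_ge0.
  have h2 : t * enorm b <= t * rho by rewrite ler_wpM2l.
  lra.
rewrite -addrA; have [t' t'01 ->] := grad_increment (b - a) (le_lt_trans crho rr).
rewrite (le_trans (normr_bilin _ _ _))// -mulrA.
have Kr : opnorm (hessian u (x + t' *: (a + t *: (b - a)))) <= K.
  apply: hK; apply/eball_shift; rewrite enormZ.
  case/andP: t'01 => t0 t1; rewrite ger0_norm// (le_lt_trans _ rr)//.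
  by rewrite (le_trans _ crho)// ler_piMl ?enorm_ge0.
apply: ler_pM => //; first exact: opnorm_ge0.
  by rewrite mulr_ge0 ?enorm_ge0.
by rewrite ler_wpM2r ?enorm_ge0.
Qed.

(** The slope of [u] along the segment differs from its affine model by at most
    [t * delta * |z|^2], by the mean value theorem for the gradient. Adding and
    subtracting the corresponding parabola and applying the mean value theorem
    again gives the bound. *)
Lemma taylor2 (rho delta : R) z : rho <= r ->
  (forall y, eball x rho y -> opnorm (hessian u y - hessian u x) <= delta) ->
  enorm z < rho ->
  `|u (x + z) - u x - dotv z p - 2^-1 * dotv (z *m hessian u x) z| <=
  2^-1 * delta * enorm z ^+ 2.
Proof.
move=> rr hd zr; set q := dotv (z *m hessian u x) z.
have small t : 0 <= t <= 1 -> enorm (t *: z) < rho.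
  case/andP => t0 t1; rewrite enormZ ger0_norm// (le_lt_trans _ zr)//.
  by rewrite ler_piMl ?enorm_ge0.
pose c (e : R) := 2^-1 * (q + e * (delta * enorm z ^+ 2)).
pose f (e t : R) := u (x + t *: z) - t * dotv z p - c e * t ^+ 2.
have fd (e t : R) : 0 <= t <= 1 -> is_derive t 1 (f e : R -> R)
    (dotv z (grad u (x + t *: z)) - dotv z p - 2 * c e * t).
  move=> t01; have h1 : is_derive t 1 (fun t : R => u (x + t *: z)) (dotv z (grad u (x + t *: z))).
    apply: is_derive_line; apply: is_derive_grad; apply/eball_shift.
    exact: lt_le_trans (small t t01) rr.
  have h2 : is_derive t 1 (fun t : R => t * dotv z p) (dotv z p).
    have := is_deriveZ (dotv z p) (@is_derive_id _ _ t 1).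
    rewrite (_ : _ \*: id = (fun t : R => t * dotv z p)); last first.
      by apply/funext => t' /=; rewrite mulrC.
    by rewrite [_ *: 1]mulr1.
  have h3 : is_derive t 1 (fun t : R => c e * t ^+ 2) (2 * c e * t).
    have h : is_derive t 1 (c e \*: ((@id R) ^+ 2)) (c e *: ((2%:R * t ^+ 1) *: (1 : R))).
      exact: is_deriveZ.
    rewrite (_ : 2 * c e * t = c e *: ((2%:R * t ^+ 1) *: (1 : R))).
      exact: h.
    by rewrite [RHS]mulrA [RHS]mulr1 expr1; ring.
  exact: is_deriveB (is_deriveB h1 h2) h3.
have inc (t : R) : 0 <= t <= 1 ->
    `|dotv z (grad u (x + t *: z)) - dotv z p - t * q| <= t * (delta * enorm z ^+ 2).
  move=> t01; have [t' t'01 ->] := grad_increment z (lt_le_trans (small t t01) rr).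
  rewrite -scalemxAl dotvZl -mulrBr normrM ger0_norm; last by case/andP: t01.
  apply: ler_wpM2l; first by case/andP: t01.
  rewrite /q -[X in _ - X]mul1r mul1r -dotvNl -dotvDl -mulmxBr.
  rewrite (le_trans (normr_bilin _ _ _))// -expr2 ler_wpM2r ?sqr_ge0//.
  apply: hd; apply/eball_shift; rewrite scalerA; apply: small.
  case/andP: t01 => t0 t1; case/andP: t'01 => t'0 t'1.
  by rewrite mulr_ge0//= mulr_ile1.
have f0 e : f e 0 = u x by rewrite /f scale0r addr0 mul0r expr0n/= mulr0 !subr0.
have f1 e : f e 1 = u (x + z) - dotv z p - c e.
  by rewrite /f scale1r mul1r expr1n mulr1.
rewrite ler_norml; apply/andP; split.
  have [t t01] := mvt1 (fd (-1)); rewrite f0 f1.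
  have := inc t t01; rewrite ler_norml => /andP[h _].
  by move: h; rewrite /c; lra.
have [t t01] := mvt1 (fd 1); rewrite f0 f1.
have := inc t t01; rewrite ler_norml => /andP[_ h].
by move: h; rewrite /c; lra.
Qed.

Lemma hessian_bounded : exists K : R, forall y, eball x r y -> opnorm (hessian u y) <= K.
Proof.
case: uC2 => _ _ _ _ c2u.
have [K hK] : exists K : 'I_n -> 'I_n -> R, forall i j y, eball x r y ->
    `|partial j (partial i u) y| <= K i j.
  have h i j : {K | forall y, eball x r y -> `|partial j (partial i u) y| <= K}.
    by apply: cid; exact: extends_bounded (c2u i j).
  by exists (fun i j => sval (h i j)) => i j; exact: svalP (h i j).
exists (\sum_i \sum_j K j i) => y yr; rewrite (le_trans (opnorm_sum_le _))//.
by apply: ler_sum => i _; apply: ler_sum => j _; rewrite mxE; exact: hK.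
Qed.

(** If a value exceeded the essential supremum, lower semicontinuity would make
    a whole ball exceed it, and balls have positive measure. *)
Lemma opnorm_le_Cx y : eball x r y -> opnorm (hessian u y) <= 2 * Cx u x r.
Proof.
move=> yr; have [K hK] := hessian_bounded.
have K0 : 0 <= K by rewrite (le_trans (opnorm_ge0 _) (hK y yr)).
set F := EFin \o ((fun y => opnorm (hessian u y)) \_ (eball x r)).
have Fz z : F z = if z \in eball x r then (opnorm (hessian u z))%:E else 0%E.
  by rewrite /F /= patchE; case: ifP.
have F0 z : (0 <= F z)%E by rewrite Fz; case: ifP => // _; rewrite lee_fin opnorm_ge0.
have nn : (0 < @lebesgue_rV R n setT)%E.
  apply: lt_le_trans (lebesgue_rV_eball0_gt0 ltr01) _.
  by apply: le_measure; rewrite ?inE//; exact: measurable_eball.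
rewrite /Cx -/F unlock nn mulrA divff// mul1r.
set E := ess_sup _ _.
have FE : {ae @lebesgue_rV R n, forall z, ((abse \o F) z <= E)%E} by exact: ess_sup_ge.
have EK : (E <= K%:E)%E.
  apply/ess_supP; apply: nearW => z; rewrite -[(abse \o F) z]/(`|F z|%E) gee0_abs// Fz.
  by case: ifPn => [/set_mem/hK|_]; rewrite lee_fin.
have contra (c : R) : c < opnorm (hessian u y) -> ~ (E <= c%:E)%E.
  move=> cy Ec.
  have [c0|c0] := ltP c 0.
    have [N [mN N0 hN]] := FE.
    suff TN : (setT `<=` N)%classic.
      have : (@lebesgue_rV R n setT <= lebesgue_rV N)%E by apply: le_measure; rewrite ?inE.
      by rewrite [leRHS]N0 leNgt nn.
    move=> z _; apply: hN => h; have := le_trans h Ec.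
    by rewrite leNgt (lt_le_trans _ (abse_ge0 _)).
  have ch i j : {for y, continuous (fun z => hessian u z i j)}.
    rewrite (_ : (fun z => _) = partial i (partial j u)).
      by case: uC2 => _ _ _ _ c2u; exact: extends_continuous (c2u j i) yr.
    by apply/funext => z; rewrite mxE.
  have [d dgt0 hd] := proj1 (nbhs_enorm _ _)
    (filterI (open_nbhs_nbhs (conj (@open_eball R n x r) yr)) (opnorm_lower_semicontinuous ch cy)).
  have [N [mN N0 hN]] := FE.
  suff dN : (eball y d `<=` N)%classic.
    have : (lebesgue_rV (eball y d) <= lebesgue_rV N)%E.
      by apply: le_measure; rewrite ?inE//; exact: measurable_eball.
    by rewrite [leRHS]N0 leNgt lebesgue_rV_eball_gt0.
  move=> z /hd[zr hz]; apply: hN => h; have := le_trans h Ec.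
  rewrite -[(abse \o F) z]/(`|F z|%E) gee0_abs// Fz mem_set// lee_fin leNgt => /negP; apply.
  exact: hz.
case: (E) EK contra => [c _|//|_] contra /=.
  by rewrite leNgt; apply/negP => /contra; exact.
by exfalso; apply: (contra (opnorm (hessian u y) - 1)); [lra|exact: leNye].
Qed.

End C2_ball.

(** * Rotations in a plane *)

Section trigonometry.
Context {R : realType}.
Implicit Types t : R.

Lemma sin_scaled t : exists2 c, 0 <= c <= 1 & sin t = cos (c * t) * t.
Proof.
have dsin (c : R) : 0 <= c <= 1 -> is_derive (c * t) 1 sin (cos (c * t)).
  by move=> _; exact: is_derive_sin.
by have [c c01] := mvt0 dsin; rewrite sin0 subr0 => E; exists c.
Qed.

Lemma normr_sin_le t : `|sin t| <= `|t|.
Proof.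
have [c _ ->] := sin_scaled t.
by rewrite normrM ler_piMl// ler_norml cos_geN1 cos_le1.
Qed.

(** Concavity is avoided by halving the angle: sin t is at least t *
    cos(t/2)^2, and this square is at least 1/2. *)
Lemma sin_ge_half t : 0 <= t <= pi / 2 -> t <= 2 * sin t.
Proof.
move=> /andP[t0 t1]; have pi0 := @pi_gt0 R.
have [c /andP[c0 c1] E] := sin_scaled (t / 2).
have ht : t = t / 2 *+ 2 by rewrite -mulr_natr; field.
have cosh0 : 0 <= cos (t / 2).
  by apply: cos_ge0_pihalf; apply/andP; split; lra.
have coshc : cos (t / 2) <= cos (c * (t / 2)).
  have le : c * (t / 2) <= t / 2 by rewrite ler_piMl//; lra.
  have ge : 0 <= c * (t / 2) by rewrite mulr_ge0//; lra.
  have [->//|ne] := eqVneq (c * (t / 2)) (t / 2).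
  apply: ltW; rewrite ltr_cos ?in_itv/=; first by rewrite lt_neqAle ne.
    by apply/andP; split; lra.
  by apply/andP; split; lra.
have cost0 : 0 <= cos t by apply: cos_ge0_pihalf; apply/andP; split; lra.
have -> : sin t = t * (cos (t / 2) * cos (c * (t / 2))).
  by rewrite {1}ht sin_mulr2n E -mulr_natr; field.
have : cos t = 2 * cos (t / 2) ^+ 2 - 1 by rewrite {1}ht cos_mulr2n -mulr_natr; ring.
have : cos (t / 2) ^+ 2 <= cos (t / 2) * cos (c * (t / 2)).
  by rewrite expr2 ler_wpM2l.
set A := cos _ * cos _; set C2 := cos (t / 2) ^+ 2 => CA cE.
have A12 : 0 <= 2 * A - 1 by lra.
have := mulr_ge0 t0 A12; lra.
Qed.

(** A chord of the unit circle is at most its arc. *)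
Lemma chord_sq t t' : (cos t - cos t') ^+ 2 + (sin t - sin t') ^+ 2 <= (t - t') ^+ 2.
Proof.
pose h := (t - t') / 2; have E : t - t' = h *+ 2 by rewrite /h -mulr_natr; field.
have hs : sin h ^+ 2 <= h ^+ 2.
  by rewrite -(real_normK (num_real (sin h))) -(real_normK (num_real h)) ler_sqr ?nnegrE// normr_sin_le.
have cB := cosB t t'; rewrite [in LHS]E cos_mulr2n -mulr_natr in cB.
have c2 := cos2Dsin2 h; have ct := cos2Dsin2 t; have ct' := cos2Dsin2 t'.
have -> : (t - t') ^+ 2 = 4 * h ^+ 2 by rewrite E -mulr_natr; ring.
have -> : (cos t - cos t') ^+ 2 + (sin t - sin t') ^+ 2 =
  (cos t ^+ 2 + sin t ^+ 2) + (cos t' ^+ 2 + sin t' ^+ 2) - 2 * (cos t * cos t' + sin t * sin t').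
  by ring.
by rewrite ct ct' -cB; lra.
Qed.

End trigonometry.

Section rotation.
Context {R : realType} {n : nat}.
Implicit Types (y v z w : 'rV[R]_n) (t : R).

Lemma isomx_dotv (M : 'M[R]_n) :
  (forall z w, dotv (z *m M) (w *m M) = dotv z w) -> isomx M.
Proof.
move=> h; apply/matrixP => i j; rewrite mxE.
have dE (k : 'I_n) : 'e_k = basisv k :> 'rV[R]_n.
  by apply/rowP => l; rewrite !mxE eqxx val_eqE.
have := h (basisv i) (basisv j); rewrite dotv_basisv basisvE mxE val_eqE eq_sym => <-.
by rewrite /dotv; apply: eq_bigr => k _; rewrite -!dE -!rowE !mxE.
Qed.

(** The rotation by the angle [t] in the oriented plane of [y] and [v], for
    orthonormal [y] and [v]. *)
Definition rotmx y v t : 'M[R]_n :=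
  1%:M + (cos t - 1) *: (y^T *m y + v^T *m v) + sin t *: (y^T *m v - v^T *m y).

Lemma mul_rank1 z w w' : z *m (w^T *m w') = dotv z w *: w'.
Proof. by rewrite mulmxA [z *m w^T]mx11_scalar -dotv_mx mul_scalar_mx. Qed.

Lemma mul_rotmx y v t z : z *m rotmx y v t =
  z + (cos t - 1) *: (dotv z y *: y + dotv z v *: v) +
  sin t *: (dotv z y *: v - dotv z v *: y).
Proof.
rewrite /rotmx mulmxDr mulmxDr mulmx1 -scalemxAr -scalemxAr mulmxDr mulmxBr.
by rewrite !mul_rank1.
Qed.

Variables (y v : 'rV[R]_n).
Hypotheses (y1 : enorm y = 1) (v1 : enorm v = 1) (yv : dotv y v = 0).

Let yy : dotv y y = 1. Proof. by rewrite -enorm_sq y1 expr1n. Qed.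
Let vv : dotv v v = 1. Proof. by rewrite -enorm_sq v1 expr1n. Qed.
Let vy : dotv v y = 0. Proof. by rewrite dotvC. Qed.

Lemma ortho_rotmx t : isomx (rotmx y v t).
Proof.
apply: isomx_dotv => z w; rewrite !mul_rotmx !dotvE yy vv yv vy.
rewrite (dotvC y w) (dotvC v w); have := cos2Dsin2 t.
set c := cos t; set s := sin t => cs.
have s2 : s ^+ 2 = 1 - c ^+ 2 by rewrite -cs; ring.
transitivity (dotv z w + (dotv z y * dotv w y + dotv z v * dotv w v) * (s ^+ 2 - (1 - c ^+ 2))).
  by ring.
by rewrite s2 subrr mulr0 addr0.
Qed.

Lemma rotmx_axis t : y *m rotmx y v t = cos t *: y + sin t *: v.
Proof.
rewrite mul_rotmx yy yv; apply/rowP => i; rewrite !mxE; ring.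
Qed.

Lemma rotmx0 z : z *m rotmx y v 0 = z.
Proof. by rewrite mul_rotmx cos0 sin0 subrr !scale0r !addr0. Qed.

Lemma bessel z : dotv z y ^+ 2 + dotv z v ^+ 2 <= enorm z ^+ 2.
Proof.
have := dotv_ge0 (z - dotv z y *: y - dotv z v *: v).
rewrite enorm_sq !dotvE yy vv yv vy (dotvC y z) (dotvC v z); nra.
Qed.

Lemma enorm_rotmxB t t' z :
  enorm (z *m rotmx y v t - z *m rotmx y v t') ^+ 2 =
  ((cos t - cos t') ^+ 2 + (sin t - sin t') ^+ 2) * (dotv z y ^+ 2 + dotv z v ^+ 2).
Proof.
rewrite enorm_sq !mul_rotmx !dotvE yy vv yv vy (dotvC y z) (dotvC v z); ring.
Qed.

Lemma rotmx_step t t' z :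
  enorm (z *m rotmx y v t - z *m rotmx y v t') <= `|t - t'| * enorm z.
Proof.
rewrite -(@ler_pXn2r _ 2)// ?nnegrE ?mulr_ge0 ?enorm_ge0//.
rewrite enorm_rotmxB exprMn real_normK ?num_real//.
apply: ler_pM; rewrite ?addr_ge0 ?sqr_ge0//; [exact: chord_sq|exact: bessel].
Qed.

End rotation.

Section rotation_between.
Context {R : realType} {n : nat}.
Implicit Types (y z : 'rV[R]_n.+2).

(** When [y] and [y'] are parallel any unit vector orthogonal to [y'] completes
    the plane, and there is one because the dimension is at least 2. *)
Lemma plane_decomposition y' y : enorm y' = 1 -> enorm y = 1 ->
  exists t v, [/\ 0 <= t <= pi, enorm v = 1, dotv y' v = 0 &
    y = cos t *: y' + sin t *: v].
Proof.
move=> y'1 y1; pose c := dotv y y'; pose t := acos c.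
have c1 : -1 <= c <= 1.
  by rewrite -ler_norml (le_trans (normr_dotv _ _))// y1 y'1 mulr1.
have tpi : 0 <= t <= pi by rewrite acos_ge0// acos_lepi.
have ct : cos t = c by rewrite acosK// in_itv.
have st : sin t = Num.sqrt (1 - c ^+ 2) by rewrite sin_acos.
pose w := y - c *: y'.
have yw : dotv y' w = 0 by rewrite !dotvE (dotvC y' y) -enorm_sq y'1 -/c; ring.
have ww : enorm w = sin t.
  rewrite /enorm st; congr Num.sqrt.
  rewrite !dotvE (dotvC y' y) -!enorm_sq y1 y'1 -/c; ring.
have [w0|w0] := eqVneq w 0.
  have [M oM eM] := ortho_exists (enorm_basisv (0 : 'I_n.+2)) y'1.
  exists t, (basisv 1 *m M); split => //.
  - by rewrite enorm_ortho// (enorm_basisv (1 : 'I_n.+2)).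
  - by rewrite -eM dotv_ortho// (@dotv_basis _ _ 0 1).
  - rewrite -ww w0 enorm0 scale0r addr0 ct; apply/eqP; rewrite -subr_eq0.
    by rewrite -/w w0.
exists t, (normalize w); split => //.
- exact: enorm_normalize.
- by rewrite /normalize dotvZr yw mulr0.
- by rewrite -ww /normalize scalerA mulfV ?enorm_eq0// scale1r ct /w addrC subrK.
Qed.

(** Turning [y'] into [y] moves a vector of length [rho] along an arc that is
    covered by at most [2 * (1 + rho)] chords of length [|y - y'|] joining points
    at distance [rho] from the origin. *)
Lemma rotation_between y' y : enorm y' = 1 -> enorm y = 1 ->
  exists M : 'M[R]_n.+2, [/\ isomx M, y' *m M = y,
    forall z, enorm (z *m M - z) <= enorm (y - y') * enorm z &
    forall z (f : 'rV[R]_n.+2 -> R) (om : R),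
      (forall a b, enorm a = enorm z -> enorm b = enorm z ->
        enorm (a - b) <= enorm (y - y') -> `|f a - f b| <= om) ->
      `|f (z *m M) - f z| <= 2 * (1 + enorm z) * om].
Proof.
move=> y'1 y1; have [t [v [/andP[t0 tpi] v1 y'v yE]]] := plane_decomposition y'1 y1.
pose d := enorm (y - y').
have dE : d ^+ 2 = (cos t - 1) ^+ 2 + sin t ^+ 2.
  rewrite /d yE enorm_sq !dotvE (dotvC v y') y'v -!enorm_sq y'1 v1.
  ring.
have td : t / 2 <= d.
  rewrite -(@ler_pXn2r _ 2)// ?nnegrE ?enorm_ge0//; last by rewrite divr_ge0.
  have hs : t / 2 <= 2 * sin (t / 2).
    by apply: sin_ge_half; rewrite divr_ge0//= ler_pM2r.
  have -> : d ^+ 2 = (2 * sin (t / 2)) ^+ 2.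
    rewrite dE; have E : t = t / 2 *+ 2 by rewrite -mulr_natr; field.
    have sE : sin t = 2 * (cos (t / 2) * sin (t / 2)).
      by rewrite {1}E sin_mulr2n mulr2n; ring.
    have cE : cos t = 2 * cos (t / 2) ^+ 2 - 1.
      by rewrite {1}E cos_mulr2n mulr2n; ring.
    have CS : cos (t / 2) ^+ 2 = 1 - sin (t / 2) ^+ 2.
      exact: cos2sin2.
    rewrite sE cE CS !exprMn CS; ring.
  by rewrite ler_sqr ?nnegrE// ?divr_ge0//; apply: le_trans hs; rewrite divr_ge0.
exists (rotmx y' v t); split.
- exact: ortho_rotmx.
- by rewrite rotmx_axis.
- move=> z; rewrite -(@ler_pXn2r _ 2)// ?nnegrE ?mulr_ge0 ?enorm_ge0//.
  rewrite -[X in _ - X](rotmx0 y' v z) enorm_rotmxB// cos0 sin0 subr0 -dE exprMn.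
  by rewrite ler_wpM2l ?sqr_ge0// bessel.
move=> z f om hf.
pose k := (Num.truncn (enorm z)).+1.
have zk : enorm z < k%:R by exact: truncnS_gt.
have kz : k%:R <= 1 + enorm z.
  by rewrite /k -natr1 addrC lerD2l truncn_le ?enorm_ge0.
have om0 : 0 <= om.
  have := hf z z erefl erefl; rewrite !subrr normr0 enorm0; apply; exact: enorm_ge0.
pose h := t / (2 * k%:R).
pose q (j : nat) := z *m rotmx y' v (j%:R * h).
have k0 : 0 < k%:R :> R by rewrite ltr0n.
have h0 : 0 <= h by rewrite divr_ge0// mulr_ge0.
have qn j : enorm (q j) = enorm z by rewrite enorm_ortho//; exact: ortho_rotmx.
have step j : `|f (q j.+1) - f (q j)| <= om.
  apply: hf => //; rewrite (le_trans (rotmx_step y'1 v1 y'v _ _ _))//.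
  rewrite -natr1 mulrDl mul1r addrAC subrr add0r ger0_norm//.
  apply: le_trans td.
  have -> : t / 2 = h * k%:R by rewrite /h; field; rewrite gt_eqF.
  by rewrite ler_wpM2l// ltW.
have q0 : q 0%N = z by rewrite /q mul0r rotmx0.
have qk : q (2 * k)%N = z *m rotmx y' v t.
  by rewrite /q natrM /h mulrC divfK// mulf_neq0// gt_eqF.
have -> : f (z *m rotmx y' v t) - f z = \sum_(0 <= j < 2 * k) (f (q j.+1) - f (q j)).
  by rewrite (telescope_sumr (fun j => f (q j)))// qk q0.
rewrite (le_trans (ler_norm_sum _ _ _))//.
apply: (@le_trans _ _ (\sum_(0 <= j < 2 * k) om)); first by apply: ler_sum => j _.
rewrite sumr_const_nat subn0 -[leLHS]mulr_natl natrM.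
by rewrite ler_wpM2r// ler_wpM2l.
Qed.

End rotation_between.

(** * The local terms *)

Section midrange.
Context {R : realType} {n : nat}.
Implicit Types (u : 'rV[R]_n -> R) (x p z y : 'rV[R]_n) (H : 'M[R]_n).

(** The supremum is over an open ball, while the maximum of the quadratic model
    lies on its boundary. *)
Lemma quadratic_limit (a b eps S : R) : 0 < eps ->
  (forall t, 0 <= t < eps -> a * t + b * t ^+ 2 <= S) -> a * eps + b * eps ^+ 2 <= S.
Proof.
move=> e0 h; apply/ler_addgt0Pr => e egt0.
pose K := `|a| + 2 * `|b| * eps + 1.
have K0 : 0 < K by rewrite ltr_wpDl// addr_ge0// !mulr_ge0// ltW.
pose t := eps - Num.min eps (e / K).
have m0 : 0 < Num.min eps (e / K) by rewrite lt_min e0 divr_gt0.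
have t0 : 0 <= t < eps by rewrite /t subr_ge0 ge_min lexx/= ltrBlDr ltrDl.
have ht := h t t0; rewrite -lerBlDr (le_trans _ ht)// lerBlDr -lerBlDl.
have te : eps - t <= e / K by rewrite /t opprB addrCA subrr addr0 ge_min lexx orbT.
have te0 : 0 <= eps - t by rewrite subr_ge0 ltW//; case/andP: t0.
have -> : a * eps + b * eps ^+ 2 - (a * t + b * t ^+ 2) = (eps - t) * (a + b * (eps + t)).
  by ring.
apply: (@le_trans _ _ ((eps - t) * K)).
  apply: ler_wpM2l => //; rewrite /K.
  have h1 := ler_norm a.
  have h2 : b * (eps + t) <= `|b| * (2 * eps).
    case/andP: t0 => t00 t01; have bt : b * (eps + t) <= `|b| * (eps + t).
      by rewrite ler_wpM2r ?ler_norm// addr_ge0// ltW.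
    by rewrite (le_trans bt)// ler_wpM2l//; lra.
  lra.
by rewrite -ler_pdivlMr.
Qed.

(** Among the vectors of norm at most [eps], the quadratic function nearly
    attains its maximum in the direction of its linear part: moving away by [D]
    costs [|p| D^2 / (2 eps)] and gains at most [h eps D]. *)
Lemma quadratic_max p H (h eps : R) z : p != 0 -> 0 < eps -> 0 <= h ->
  (forall v w, `|dotv (v *m H) w| <= h * (enorm v * enorm w)) ->
  enorm z <= eps ->
  dotv z p + 2^-1 * dotv (z *m H) z <=
  eps * enorm p + 2^-1 * eps ^+ 2 * dotv (normalize p *m H) (normalize p) +
  eps ^+ 3 * h ^+ 2 / (2 * enorm p).
Proof.
move=> p0 eps0 h0 hH zeps.
have P0 : 0 < enorm p by rewrite enorm_gt0.
have y1 : enorm (normalize p) = 1 by exact: enorm_normalize.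
have zp : dotv z p = enorm p * dotv z (normalize p).
  by rewrite /normalize dotvZr mulrA mulfV ?mul1r// gt_eqF.
move: (normalize p) (enorm p) y1 P0 zp => y P y1 P0 zp.
pose e := eps *: y; pose D := enorm (z - e).
have e1 : enorm e = eps by rewrite enormZ y1 mulr1 gtr0_norm.
have D0 : 0 <= D by exact: enorm_ge0.
have D2 : D ^+ 2 <= 2 * eps * (eps - dotv z y).
  have yy : dotv y y = 1 by rewrite -enorm_sq y1 expr1n.
  rewrite /D enorm_sq /e !dotvE yy (dotvC y z) -(enorm_sq z).
  have : enorm z ^+ 2 <= eps ^+ 2 by rewrite ler_sqr ?nnegrE ?enorm_ge0// ltW.
  lra.
have quad : dotv (z *m H) z - dotv (e *m H) e <= 2 * (h * eps * D).
  have -> : dotv (z *m H) z - dotv (e *m H) e =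
      dotv ((z - e) *m H) z + dotv (e *m H) (z - e).
    by rewrite mulmxBl !dotvE; ring.
  have a1 := le_trans (ler_norm _) (hH (z - e) z).
  have a2 := le_trans (ler_norm _) (hH e (z - e)).
  have : enorm (z - e) * enorm z <= D * eps by rewrite ler_wpM2l.
  move=> /(ler_wpM2l h0) a3; rewrite e1 -/D in a2; lra.
have eHe : dotv (e *m H) e = eps ^+ 2 * dotv (y *m H) y.
  by rewrite /e -scalemxAl !dotvE; ring.
have key : - (P * D ^+ 2) / (2 * eps) + h * eps * D <= eps ^+ 3 * h ^+ 2 / (2 * P).
  rewrite -subr_ge0 (_ : _ - _ = (P * D - eps ^+ 2 * h) ^+ 2 / (2 * eps * P)).
    by rewrite divr_ge0 ?sqr_ge0// !mulr_ge0// ltW.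
  by field; rewrite !gt_eqF.
have lin : P * (dotv z y - eps) <= - (P * D ^+ 2) / (2 * eps).
  rewrite ler_pdivlMr ?mulr_gt0// -subr_ge0.
  rewrite (_ : _ - _ = P * (2 * eps * (eps - dotv z y) - D ^+ 2)); last by ring.
  by rewrite mulr_ge0 ?(ltW P0)// subr_ge0.
by move: quad; rewrite zp eHe; lra.
Qed.

(** The lower bound is tested on the segment from [x] in the direction of [p],
    the upper bound is [quadratic_max]. *)
Lemma sup_expansion u x p H (h delta eps : R) : p != 0 -> 0 < eps -> 0 <= h ->
  (forall v w, `|dotv (v *m H) w| <= h * (enorm v * enorm w)) -> 0 <= delta ->
  (forall z, enorm z < eps -> `|u (x + z) - u x - dotv z p - 2^-1 * dotv (z *m H) z| <=
     2^-1 * delta * enorm z ^+ 2) ->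
  forall A S, A = u x + eps * enorm p +
    2^-1 * eps ^+ 2 * dotv (normalize p *m H) (normalize p) ->
  S = sup [set u y | y in eball x eps] ->
  A - 2^-1 * delta * eps ^+ 2 <= S <= A + 2^-1 * delta * eps ^+ 2 +
    eps ^+ 3 * h ^+ 2 / (2 * enorm p).
Proof.
move=> p0 eps0 h0 hH delta0 hu A S AE SE.
have xin : eball x eps x by rewrite /eball/= subrr enorm0.
have ub y : eball x eps y -> u y <= A + 2^-1 * delta * eps ^+ 2 +
    eps ^+ 3 * h ^+ 2 / (2 * enorm p).
  move=> yeps; have yE : y = x + (y - x) by rewrite addrC subrK.
  have := hu (y - x) yeps; rewrite -yE ler_norml => /andP[_ h1].
  have := quadratic_max p0 eps0 h0 hH (ltW yeps).
  have : enorm (y - x) ^+ 2 <= eps ^+ 2.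
    by rewrite ler_sqr ?nnegrE ?enorm_ge0// ltW.
  move=> /(ler_wpM2l delta0); rewrite AE; lra.
have hub : has_ubound [set u y | y in eball x eps].
  by eexists => _ [y yeps <-]; exact: ub yeps.
rewrite SE; apply/andP; split; last by apply: ge_sup => [|_ [y /ub uy <-]//]; exists (u x), x.
have y1 : enorm (normalize p) = 1 by exact: enorm_normalize.
have yp : dotv (normalize p) p = enorm p.
  by rewrite /normalize dotvZl -enorm_sq expr2 mulrA mulVf ?mul1r// enorm_eq0.
rewrite AE {ub AE}; move: (normalize p) y1 yp => y y1 yp.
set Q := dotv (y *m H) y.
suff : enorm p * eps + (2^-1 * Q - 2^-1 * delta) * eps ^+ 2 <= S - u x by rewrite SE; lra.
apply: quadratic_limit => // t /andP[t0 teps].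
have zt : enorm (t *: y) = t by rewrite enormZ y1 mulr1 ger0_norm.
have := hu (t *: y); rewrite zt => /(_ teps); rewrite ler_norml => /andP[h1 _].
have : u (x + t *: y) <= S.
  rewrite SE; apply: (ub_le_sup hub); exists (x + t *: y) => //.
  by rewrite /eball/= addrAC subrr add0r zt.
have typ : dotv (t *: y) p = t * enorm p by rewrite dotvZl yp.
move: h1; rewrite typ -scalemxAl !dotvE -/Q; lra.
Qed.

(** The infimum is minus the supremum for [- u], whose linear part is [- p]: in
    the half-sum the first-order terms cancel and the second-order ones add
    up. *)
Lemma midrange_expansion u x p H (h delta eps : R) : p != 0 -> 0 < eps -> 0 <= h ->
  (forall v w, `|dotv (v *m H) w| <= h * (enorm v * enorm w)) -> 0 <= delta ->
  (forall z, enorm z < eps -> `|u (x + z) - u x - dotv z p - 2^-1 * dotv (z *m H) z| <=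
     2^-1 * delta * enorm z ^+ 2) ->
  `|2^-1 * (sup [set u y | y in eball x eps] + inf [set u y | y in eball x eps]) - u x -
    2^-1 * eps ^+ 2 * dotv (normalize p *m H) (normalize p)| <=
  2^-1 * delta * eps ^+ 2 + eps ^+ 3 * h ^+ 2 / (4 * enorm p).
Proof.
move=> p0 eps0 h0 hH delta0 hu.
have := sup_expansion p0 eps0 h0 hH delta0 hu erefl erefl.
have hH' v w : `|dotv (v *m (- H)) w| <= h * (enorm v * enorm w).
  by rewrite mulmxN dotvNl normrN.
have p0' : - p != 0 by rewrite oppr_eq0.
have hu' z : enorm z < eps ->
    `|(- u (x + z)) - (- u x) - dotv z (- p) - 2^-1 * dotv (z *m (- H)) z| <=
    2^-1 * delta * enorm z ^+ 2.
  move=> /hu; rewrite mulmxN !dotvE -normrN; congr (`|_| <= _); ring.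
have := @sup_expansion (fun y => - u y) x _ _ _ _ _ p0' eps0 h0 hH' delta0 hu' _ _ erefl erefl.
rewrite enormN.
have -> : normalize (- p) = - normalize p by rewrite /normalize enormN scalerN.
have -> : dotv (- normalize p *m (- H)) (- normalize p) =
    - dotv (normalize p *m H) (normalize p).
  by rewrite mulmxN mulNmx opprK dotvNr.
have -> : [set - u y | y in eball x eps] = [set - y | y in [set u y | y in eball x eps]].
  by rewrite image_comp.
rewrite /inf/=; set S := sup _; set S' := sup _.
set Q := dotv _ _; move=> /andP[a1 a2] /andP[b1 b2].
have P0 : 0 < enorm p by rewrite enorm_gt0.
have eE : eps ^+ 3 * h ^+ 2 / (4 * enorm p) = 2^-1 * (eps ^+ 3 * h ^+ 2 / (2 * enorm p)).
  by field; rewrite gt_eqF.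
rewrite eE ler_norml; move: a1 a2 b1 b2.
set E := eps ^+ 3 * h ^+ 2 / _; move=> a1 a2 b1 b2.
by apply/andP; split; lra.
Qed.

End midrange.

Section integrable_algebra.
Context d (T : measurableType d) {R : realType} (m : {measure set T -> \bar R}).
Variables (D : set T) (mD : measurable D).
Implicit Types f g : T -> R.

Lemma integrableDR f g : m.-integrable D (EFin \o f) -> m.-integrable D (EFin \o g) ->
  m.-integrable D (EFin \o (fun z => f z + g z)).
Proof. by move=> intf intg; have := integrableD mD intf intg. Qed.

Lemma integrableZR (c : R) f : m.-integrable D (EFin \o f) ->
  m.-integrable D (EFin \o (fun z => c * f z)).
Proof. by move=> intf; have := integrableZl mD c intf. Qed.

Lemma normr_Rintegral_le f g : m.-integrable D (EFin \o f) ->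
  m.-integrable D (EFin \o g) -> (forall z, D z -> `|f z| <= g z) ->
  `|\int[m]_(z in D) f z| <= \int[m]_(z in D) g z.
Proof.
move=> intf intg fg; apply: (le_trans (le_normr_Rintegral mD intf)).
by apply: le_Rintegral => //; exact: integrable_norm intf.
Qed.

End integrable_algebra.

Section ball_average.
Context {R : realType} {n : nat}.
Local Notation N := n.+2.
Local Notation leb := (@lebesgue_rV R N).
Local Notation mu := (@lebesgue_measure R).
Local Notation e i := (basisv i : 'rV[R]_N).
Implicit Types (x p z : 'rV[R]_N) (H : 'M[R]_N).

Lemma measurable_origin : measurable [set 0 : 'rV[R]_N].
Proof.
rewrite (_ : [set 0] = enorm @^-1` [set 0 : R]).
  exact: (measurable_preimage measurable_enorm (measurable_set1 (0 : R))).
by apply/seteqP; split => z /= => [->|/eqP]; rewrite ?enorm0// enorm_eq0 => /eqP.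
Qed.

Lemma lebesgue_origin : leb [set 0] = 0%E.
Proof.
have fin : leb [set 0] \is a fin_num.
  rewrite ge0_fin_numE//; apply: le_lt_trans (lebesgue_rV_eball0_fin 1).
  apply: le_measure; rewrite ?inE; [exact: measurable_origin|exact: measurable_eball|].
  by move=> z ->; rewrite /eball/= subrr enorm0.
have := lebesgue_rV_scale (ltr0n R 2) measurable_origin.
rewrite (_ : _ @^-1` _ = [set 0]); last first.
  apply/seteqP; split => z /= => [/eqP|->]; last by rewrite scaler0.
  by rewrite scaler_eq0 pnatr_eq0/= => /eqP.
rewrite -(fineK fin) -EFinM => -[] /eqP; rewrite -subr_eq0 -{1}[fine _]mul1r -mulrBl.
rewrite mulf_eq0 => /orP[|/eqP ->//].
rewrite subr_eq0 eq_sym => /eqP h; exfalso.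
have : (2 : R) ^- N < 1 by rewrite invf_lt1 ?exprn_gt0// exprn_egt1// ltr1n.
by rewrite h ltxx.
Qed.

Variable eps : R.
Hypothesis eps0 : 0 < eps.
Local Notation B := (eball (0 : 'rV[R]_N) eps).
Local Notation V := (fine (leb B)).

Lemma in_ball0 z : B z <-> enorm z < eps.
Proof. by rewrite /eball/= subr0. Qed.

Let mB : measurable B. Proof. exact: measurable_eball. Qed.
Let Bfin : (leb B < +oo)%E. Proof. exact: lebesgue_rV_eball0_fin. Qed.

Lemma integrable_ball (f : 'rV[R]_N -> R) (c : R) : measurable_fun setT f ->
  (forall z, B z -> `|f z| <= c) -> leb.-integrable B (EFin \o f).
Proof.
move=> mf fc; apply: (integrable_bounded (c := c)) => //; exact: measurable_funTS.
Qed.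

Lemma ball_volume : leb B = ((eps ^+ N / N%:R)%:E * @sphere_measure R N setT)%E.
Proof.
have mS : measurable [set z : 'rV[R]_N | 0 < enorm z < eps].
  have -> : [set z : 'rV[R]_N | 0 < enorm z < eps] = [set z | enorm z \in `]0, eps[].
    by apply/seteqP; split => z /=; rewrite in_itv.
  exact: measurable_shell.
have -> : B = [set 0] `|` [set z | 0 < enorm z < eps].
  apply/seteqP; split => z.
    rewrite in_ball0 => zeps; have [->|z0] := eqVneq z 0; first by left.
    by right; rewrite /= enorm_gt0 z0.
  by case=> [->|/= /andP[_ h]]; rewrite in_ball0// enorm0.
rewrite measureU//; last 2 first.
- exact: measurable_origin.
- by rewrite -subset0 => z [-> /=]; rewrite enorm0 ltxx.
rewrite [X in (X + _)%E]lebesgue_origin add0e.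
have := lebesgue_sector (@measurableT _ 'rV[R]_N) eps0.
rewrite preimage_setT !setTI => volE; apply: (etrans volE).
rewrite /sphere_measure preimage_setT setTI muleA -EFinM divfK// pnatr_eq0//.
Qed.

Lemma ball_volume_gt0 : 0 < V.
Proof. by rewrite fine_gt0// lebesgue_rV_eball0_gt0//= Bfin. Qed.

Lemma ball_second : \int[leb]_(z in B) (enorm z ^+ 2) = eps ^+ 2 * N%:R / (N%:R + 2) * V.
Proof.
pose f (t : R) : R := t `^ 2 * \1_(`]0, eps[%classic : set R) t.
have mf : measurable_fun setT f.
  by apply: measurable_funM => //; exact: measurable_powR.
have f0 t : 0 <= f t by rewrite mulr_ge0// powR_ge0.
have N2 : 0 < N%:R + 2 :> R by rewrite ltr_wpDl.
have fj : (\int[mu]_t (f t * radial_weight (n := N) t)%:E)%E = (eps `^ (N%:R + 2) / (N%:R + 2))%:E.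
  rewrite -integral_powR_0// [RHS]integral_mkcond; apply: eq_integral => t _.
  rewrite patchE /f indicE; case: ifPn => [/set_mem|tI]; last by rewrite mulr0 mul0r.
  rewrite /= in_itv/= => /andP[t0 _]; rewrite /radial_weight t0 !mulr1.
  rewrite -powRD; last by rewrite (gt_eqF t0) implybT.
  by congr (_ `^ _)%:E; ring.
have := @polar_integral R N isT f (fun=> 1) _ mf f0 (@measurable_cst _ _ _ _ setT (1 : R)) (fun=> ler01) fj.
rewrite integral_cst// mul1e => polE.
have -> : \int[leb]_(z in B) (enorm z ^+ 2) =
    fine (\int[leb]_z (1 * (f (enorm z) * (0 < enorm z)%R%:R))%:E)%E.
  rewrite /Rintegral; congr fine; rewrite [LHS]integral_mkcond; apply: eq_integral => z _.
  rewrite patchE mul1r /f indicE.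
  have -> : (enorm z \in (`]0, eps[%classic : set R)) = (0 < enorm z < eps).
    by apply/idP/idP; rewrite inE/= in_itv.
  have -> : (z \in B) = (enorm z < eps).
    by apply/idP/idP; rewrite inE => /in_ball0.
  have [->|z0] := eqVneq z 0.
    by rewrite enorm0 ltxx mulr0 expr0n/=; case: ifP.
  have ez : 0 < enorm z by rewrite enorm_gt0.
  rewrite ez mulr1 powR_mulrn ?enorm_ge0//=.
  by case: ifP; rewrite ?mulr1// mulr0.
have Sf : @sphere_measure R N setT \is a fin_num by exact: sphere_measure_fin.
transitivity (fine ((eps `^ (N%:R + 2) / (N%:R + 2))%:E * @sphere_measure R N setT)%E).
  by congr fine; exact: polE.
rewrite ball_volume -(fineK Sf) -!EFinM /=.
move: (fine (sphere_measure _)) => S.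
have -> : eps `^ (N%:R + 2) = eps ^+ 2 * eps ^+ N.
  by rewrite -natrD powR_mulrn ?ltW// addnC exprD.
have N0 : N%:R != 0 :> R by rewrite pnatr_eq0.
move: N2 N0; move: (N%:R : R) => k k2 k0; field.
by rewrite k0 gt_eqF.
Qed.

Lemma ball_axial y : axial y B.
Proof. by move=> M oM _; apply/seteqP; split => z; rewrite /= !in_ball0 enorm_ortho. Qed.

Lemma ball_int2 : leb.-integrable B (EFin \o (fun z => enorm z ^+ 2)).
Proof.
apply: (integrable_ball (c := eps ^+ 2)).
  by apply: measurable_funX; exact: measurable_enorm.
move=> z /in_ball0 zeps; rewrite ger0_norm ?sqr_ge0//.
by rewrite ler_sqr ?nnegrE ?enorm_ge0// ltW.
Qed.

(** All directions are equivalent in a ball, so that each of the [N] diagonal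
    entries carries the same share of the second moment. *)
Lemma ball_quad H : \int[leb]_(z in B) dotv (z *m H) z = \tr H * (eps ^+ 2 / (N%:R + 2)) * V.
Proof.
have inv := @lebesgue_rV_ortho_invariant R N.
have e01 : enorm (e 0) = 1 by exact: (enorm_basisv (0 : 'I_N)).
have e11 : enorm (e 1) = 1 by exact: (enorm_basisv (1 : 'I_N)).
pose J i := \int[leb]_(z in B) (dotv z (e i) ^+ 2).
have J01 : J 0%N = J 1%N.
  have [M oM eM] := ortho_exists e01 e11.
  have mf : measurable_fun setT (fun z : 'rV[R]_N => dotv z (e 1) ^+ 2).
    by apply: measurable_funX; exact: measurable_dotvl.
  rewrite /J -(Rintegral_ortho inv oM mB mf (D := B)); last first.
    by apply/seteqP; split => z; rewrite /= !in_ball0 enorm_ortho.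
  by apply: eq_Rintegral => z _; rewrite -eM dotv_ortho.
have q H' : \int[leb]_(z in B) dotv (z *m H') z = \tr H' * J 0%N.
  rewrite (quad_moment0 inv H' mB (@ball_axial (e 0)) ball_int2) -/(J 0%N) -/(J 1%N) -J01.
  ring.
have := q 1%:M; rewrite mxtrace1.
rewrite (@eq_Rintegral _ _ _ _ _ (fun z => enorm z ^+ 2)); last first.
  by move=> z _; rewrite mulmx1 enorm_sq.
rewrite ball_second q => E.
have -> : J 0%N = eps ^+ 2 / (N%:R + 2) * V.
  have N0 : N%:R != 0 :> R by rewrite pnatr_eq0.
  apply: (mulfI N0); rewrite -E; ring.
ring.
Qed.

Lemma ball_linear p : \int[leb]_(z in B) dotv z p = 0.
Proof.
apply: (@first_moment_orth R N leb lebesgue_rV_ortho_invariant 0 B mB (@ball_axial 0)).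
  apply: (integrable_ball (c := eps)); first exact: measurable_enorm.
  by move=> z /in_ball0 zeps; rewrite ger0_norm ?enorm_ge0// ltW.
exact: dotv0.
Qed.

Lemma ball_shift x (u : 'rV[R]_N -> R) (M : R) : measurable_fun setT u ->
  (forall z, `|u z| <= M) ->
  avg leb (eball x eps) u = (\int[leb]_(z in B) u (x + z)) / V.
Proof.
move=> mu_ uM; have ms := measurable_shift x.
have pre : (fun z : 'rV[R]_N => z + x) @^-1` (eball x eps) = B.
  by apply/seteqP; split => z; rewrite /eball/= addrK subr0.
have mE := measurable_eball x eps.
have den : leb (eball x eps) = leb B.
  by apply: (etrans (esym (lebesgue_rV_shift x mE))); apply: (f_equal leb); exact: pre.
have num : (\int[leb]_(z in eball x eps) (u z)%:E = \int[leb]_(z in B) (u (x + z)%R)%:E)%E.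
  transitivity (\int[pushm ms leb]_(z in eball x eps) (u z)%:E)%E.
    by apply: eq_measure_integral => A mA _; apply/esym; exact: lebesgue_rV_shift.
  apply: (etrans (integral_pushforward ms _ _ mE)).
  - exact/measurable_EFinP.
  - rewrite pre; apply: (integrable_ball (c := M) (f := fun z => u (z + x))).
      exact: measurableT_comp ms.
    by move=> z _; exact: uM.
  - by rewrite pre; apply: eq_integral => z _; rewrite /= addrC.
by rewrite /avg num den.
Qed.

(** The linear part has zero average and the quadratic part contributes the
    trace. *)
Lemma ball_average x p H (delta M : R) (u : 'rV[R]_N -> R) : measurable_fun setT u ->
  (forall z, `|u z| <= M) ->
  (forall z, enorm z < eps -> `|u (x + z) - u x - dotv z p - 2^-1 * dotv (z *m H) z| <=
     2^-1 * delta * enorm z ^+ 2) ->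
  `|avg leb (eball x eps) u - u x - eps ^+ 2 / (2 * (N%:R + 2)) * \tr H| <=
  2^-1 * delta * (eps ^+ 2 * N%:R / (N%:R + 2)).
Proof.
move=> mu_ uM hu; rewrite (ball_shift x mu_ uM).
have V0 := ball_volume_gt0.
have mux : measurable_fun setT (fun z : 'rV[R]_N => u (x + z)).
  have ms : measurable_fun setT (fun z : 'rV[R]_N => x + z) by exact: measurable_rowD.
  exact: measurableT_comp mu_ ms.
have mq : measurable_fun setT (fun z : 'rV[R]_N => dotv (z *m H) z).
  by apply: measurable_dotv => //; exact: measurable_mulmx.
pose E z := u (x + z) - u x - dotv z p - 2^-1 * dotv (z *m H) z.
have mE : measurable_fun setT E.
  apply: measurable_funB; last exact: measurable_funM.
  apply: measurable_funB; last exact: measurable_dotvl.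
  exact: measurable_funB.
have iE : leb.-integrable B (EFin \o E).
  apply: (@le_integrableR _ _ _ _ _ mB _ (fun z => 2^-1 * delta * enorm z ^+ 2)).
  - exact: measurable_funTS.
  - by move=> z /in_ball0; exact: hu.
  - exact: (integrableZl mB (2^-1 * delta) ball_int2).
have iqq : leb.-integrable B (EFin \o (fun z => dotv (z *m H) z)).
  apply: (@le_integrableR _ _ _ _ _ mB _ (fun z => opnorm H * enorm z ^+ 2)).
  - exact: measurable_funTS.
  - by move=> z _; rewrite expr2 normr_bilin.
  - exact: integrableZR ball_int2.
have iq : leb.-integrable B (EFin \o (fun z => 2^-1 * dotv (z *m H) z)).
  exact: integrableZR.
have ip : leb.-integrable B (EFin \o (fun z => dotv z p)).
  apply: (integrable_ball (c := eps * enorm p)); first exact: measurable_dotvl.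
  move=> z /in_ball0 zeps; rewrite (le_trans (normr_dotv _ _))//.
  by rewrite ler_wpM2r ?enorm_ge0// ltW.
have ic : leb.-integrable B (EFin \o fun=> u x) by exact: integrable_cst_fin.
have -> : \int[leb]_(z in B) u (x + z) =
    u x * V + 2^-1 * (\tr H * (eps ^+ 2 / (N%:R + 2)) * V) + \int[leb]_(z in B) E z.
  rewrite (@eq_Rintegral _ _ _ _ _ (fun z => (((fun=> u x) z + dotv z p) +
      2^-1 * dotv (z *m H) z) + E z)); last by move=> z _; rewrite /E; ring.
  have i1 : leb.-integrable B (EFin \o (fun z => (fun=> u x) z + dotv z p)).
    exact: integrableDR.
  have i2 : leb.-integrable B
      (EFin \o (fun z => ((fun=> u x) z + dotv z p) + 2^-1 * dotv (z *m H) z)).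
    exact: integrableDR i1 iq.
  rewrite (RintegralD mB i2 iE) (RintegralD mB i1 iq) (RintegralD mB ic ip).
  rewrite Rintegral_cst// ball_linear addr0 RintegralZl//.
  by rewrite ball_quad.
have bE : `|\int[leb]_(z in B) E z| <= 2^-1 * delta * (eps ^+ 2 * N%:R / (N%:R + 2)) * V.
  rewrite -[leRHS]mulrA -ball_second -RintegralZl//; last exact: ball_int2.
  apply: normr_Rintegral_le => //; first exact: integrableZR ball_int2.
  by move=> z /in_ball0; exact: hu.
have N2 : 0 < N%:R + 2 :> R by rewrite ltr_wpDl.
rewrite (_ : _ - _ = (\int[leb]_(z in B) E z) / V); last first.
  by field; rewrite !gt_eqF.
by rewrite normrM normfV (gtr0_norm V0) ler_pdivrMr.
Qed.

End ball_average.

(** * Integrals over truncated cones *)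

Section modulus_of_continuity.
Context {R : realType} {n : nat}.
Variables (u : 'rV[R]_n.+1 -> R) (x : 'rV[R]_n.+1) (r M : R).
Hypotheses (r0 : 0 < r) (uM : forall z, `|u z| <= M).

Let S a := [set d | exists z z', [/\ ~ ecball x r z, ~ ecball x r z',
  enorm (z - z') <= a & d = `|u z - u z'|]].

Let S_ub a : has_ubound (S a).
Proof.
exists (2 * M) => _ [z [z' [_ _ _ ->]]].
by rewrite (le_trans (ler_normB _ _))// mulr2n mulrDl mul1r lerD.
Qed.

Lemma le_modulus a z z' : ~ ecball x r z -> ~ ecball x r z' -> enorm (z - z') <= a ->
  `|u z - u z'| <= modulus u x r a.
Proof. by move=> hz hz' za; apply: (ub_le_sup (S_ub a)); exists z, z'. Qed.

(** There are points outside the ball, so the supremum defining the modulus is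
    over a nonempty set. *)
Lemma zero_oscillation a : 0 <= a -> S a 0.
Proof.
move=> a0; pose z := x + (2 * r) *: basisv 0.
have hz : ~ ecball x r z.
  rewrite /ecball/= /z addrAC subrr add0r enormZ (enorm_basisv (0 : 'I_n.+1)) mulr1.
  rewrite ger0_norm; last by rewrite mulr_ge0// ltW.
  by apply/negP; rewrite -ltNge mulr2n mulrDl mul1r ltrDl.
by exists z, z; split => //; rewrite subrr ?enorm0 ?normr0.
Qed.

Lemma modulus_ge0 a : 0 <= a -> 0 <= modulus u x r a.
Proof. by move=> a0; apply: (ub_le_sup (S_ub a)); exact: zero_oscillation. Qed.

Lemma modulus_le a b : 0 <= a -> a <= b -> modulus u x r a <= modulus u x r b.
Proof.
move=> a0 ab; apply: ge_sup; first by exists 0; exact: zero_oscillation.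
move=> _ [z [z' [hz hz' za ->]]]; apply: le_modulus => //; exact: le_trans ab.
Qed.

End modulus_of_continuity.

Section nonlocal.
Context {R : realType} {n : nat}.
Variables (s k : R).
Hypotheses (s0 : 0 <= s) (hs : 2^-1 < s < 1) (k0 : 0 <= k).
Local Notation N := n.+2.
Local Notation C := (fracC N s).
Local Notation mu := (@lebesgue_measure R).
Local Notation e i := (basisv i : 'rV[R]_N).
Implicit Types (x y z w : 'rV[R]_N) (a b q : R).

Local Notation m := (@fracm R N s s0).
Local Notation A := (@cap_size R n k).

Lemma sub_oo a b : 0 <= a -> (`]a, b[ : set R) `<=` `]0, +oo[.
Proof. by move=> a0 t; rewrite /= !in_itv/= andbT => /andP[/(le_lt_trans a0)]. Qed.

Lemma sub_oy a : 0 <= a -> (`]a, +oo[ : set R) `<=` `]0, +oo[.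
Proof. by move=> a0 t; rewrite /= !in_itv/= !andbT => /(le_lt_trans a0). Qed.

Lemma measurable_secoo a b y : measurable (sector k `]a, b[ y).
Proof. exact: measurable_sector_set. Qed.

Lemma measurable_secoy a y : measurable (sector k `]a, +oo[ y).
Proof. exact: measurable_sector_set. Qed.

Lemma sector_measureE (I : set R) y (j : R) : enorm y = 1 -> measurable I ->
  I `<=` `]0, +oo[ -> (\int[mu]_(t in I) (t `^ (0 - 2 * s - 1))%:E)%E = j%:E ->
  m (sector k I y) = (C * j * A)%:E.
Proof.
move=> y1 mI I0 jE; have [intq E] := sector_pow s0 k mI I0 jE y1.
have mS := measurable_sector_set k y mI.
pose f0 : 'rV[R]_N -> \bar R := fun z => (enorm z `^ 0)%:E.
have E0 : (\int[m]_(z in sector k I y) f0 z)%E = m (sector k I y).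
  have -> : f0 = cst 1%E by apply/funext => z; rewrite /f0 powRr0.
  by rewrite integral_cst// mul1e.
have fin := integrable_fin_num mS intq.
by rewrite -[LHS]fineK -?E0// [in LHS]E0 -E /Rintegral E0.
Qed.

Lemma sector_sphere0 b y : 0 < b -> enorm y = 1 -> m (sector k [set b] y) = 0%E.
Proof.
move=> b0 y1; rewrite (@sector_measureE _ _ 0)// ?mulr0 ?mul0r//.
  by move=> t /= ->; rewrite in_itv/= b0.
by rewrite integral_set1.
Qed.

Lemma sector_far_measure a y : 0 < a -> enorm y = 1 ->
  m (sector k `]a, +oo[ y) = (C * (a `^ (- 2 * s) / (2 * s)) * A)%:E.
Proof.
move=> a0 y1; have sgt : 0 < s by case/andP: hs => h _; apply: lt_trans h.
rewrite (@sector_measureE _ _ (a `^ (0 - 2 * s) / - (0 - 2 * s)))//.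
- by rewrite sub0r opprK mulNr.
- exact: sub_oy (ltW a0).
- by apply: integral_powR_y => //; lra.
Qed.

(** A sphere is negligible, so a sector may be cut along it. *)
Lemma sector_cut a b y (f : 'rV[R]_N -> R) : 0 <= a -> a < b -> enorm y = 1 ->
  m.-integrable (sector k `]a, +oo[ y) (EFin \o f) ->
  \int[m]_(z in sector k `]a, +oo[ y) f z =
  \int[m]_(z in sector k `]a, b[ y) f z + \int[m]_(z in sector k `]b, +oo[ y) f z.
Proof.
move=> a0 ab y1 intf; have b0 : 0 < b by exact: le_lt_trans a0 ab.
have E : sector k `]a, +oo[ y =
    sector k `]a, b[ y `|` (sector k [set b] y `|` sector k `]b, +oo[ y).
  apply/seteqP; split => z; rewrite /sector/= !in_itv/= ?andbT.
    move=> [-> az]; have [zb|zb|zb] := ltgtP (enorm z) b.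
    - by left; rewrite az.
    - by right; right.
    - by right; left.
  by case=> [[-> /andP[]]|[[-> ->]|[-> /(lt_trans ab)]]].
have mU : measurable (sector k [set b] y `|` sector k `]b, +oo[ y).
  by apply: measurableU; exact: measurable_sector_set.
rewrite E in intf *; rewrite Rintegral_setU//; last 2 first.
- exact: measurable_secoo.
- apply/disj_setPS => z [[_ /=]]; rewrite in_itv/= => /andP[_ zb].
  by case=> -[_ /=]; rewrite ?in_itv/= ?andbT => h; move: zb; rewrite ?h ?ltxx// ltNge ltW.
congr (_ + _); have intU : m.-integrable (sector k [set b] y `|` sector k `]b, +oo[ y) (EFin \o f).
  by apply: integrableS intf; [apply: measurableU => //; exact: measurable_secoo|exact: mU|right].
rewrite Rintegral_setU//; last 3 first.
- exact: measurable_sector_set.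
- exact: measurable_secoy.
- apply/disj_setPS => z [[_ /= zb] [_ /=]]; rewrite in_itv/= andbT zb ltxx.
  by [].
rewrite /Rintegral null_set_integral ?add0r//.
- exact: measurable_sector_set.
- apply/measurable_EFinP; have := integrableS mU (measurable_sector_set _ _ (measurable_set1 b)) (@subsetUl _ _ _) intU.
  by move=> /measurable_int /measurable_EFinP.
- exact: sector_sphere0.
Qed.

End nonlocal.

Section cone_integrals.
Context {R : realType} {n : nat}.
Variables (s k : R) (u : 'rV[R]_n.+2 -> R) (x : 'rV[R]_n.+2) (r M eps : R).
Hypotheses (s0 : 0 <= s) (hs : 2^-1 < s < 1) (k0 : 0 <= k).
Hypotheses (mu_ : measurable_fun setT u) (uM : forall z, `|u z| <= M).
Hypotheses (uC2 : C2_closed_ball u x r) (eps0 : 0 < eps) (epsr : eps < r).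
Local Notation N := n.+2.
Local Notation C := (fracC N s).
Local Notation mu := (@lebesgue_measure R).
Local Notation e i := (basisv i : 'rV[R]_N).
Implicit Types (y z w : 'rV[R]_N) (a b q : R).

Local Notation m := (@fracm R N s s0).
Local Notation A := (@cap_size R n k).
Local Notation B := (\int[@sphere_measure R N]_(z in sector k [set 1%R] (e 0)) dotv z (e 0)).
Local Notation p := (grad u x).

Let r0 : 0 < r. Proof. exact: lt_trans epsr. Qed.
Let sgt0 : 0 < s. Proof. by case/andP: hs => h _; apply: lt_trans h. Qed.

Lemma integrable_far a y (f : 'rV[R]_N -> R) (c : R) : 0 < a -> enorm y = 1 ->
  measurable_fun setT f -> (forall z, `|f z| <= c) ->
  m.-integrable (sector k `]a, +oo[ y) (EFin \o f).
Proof.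
move=> a0 y1 mf fc; apply: (integrable_bounded (c := c)).
- exact: measurable_secoy.
- by rewrite (sector_far_measure k s0 hs) ?ltry.
- exact: measurable_funTS.
- by move=> z _.
Qed.

(** The radial integral is kept in the form [(b^g - a^g) / g], which covers
    negative [g]: for [q = 1] the exponent is [1 - 2 * s < 0]. *)
Lemma sector_near_pow a b q y : 0 < a -> a < b -> enorm y = 1 -> q - 2 * s != 0 ->
  m.-integrable (sector k `]a, b[ y) (EFin \o (fun z => enorm z `^ q)) /\
  \int[m]_(z in sector k `]a, b[ y) (enorm z `^ q) =
  C * ((b `^ (q - 2 * s) - a `^ (q - 2 * s)) / (q - 2 * s)) * A.
Proof.
move=> a0 ab y1 q0; apply: sector_pow => //; first exact: sub_oo (ltW a0).
exact: integral_powR_oo.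
Qed.

Lemma sector_far_pow a q y : 0 < a -> enorm y = 1 -> q - 2 * s < 0 ->
  m.-integrable (sector k `]a, +oo[ y) (EFin \o (fun z => enorm z `^ q)) /\
  \int[m]_(z in sector k `]a, +oo[ y) (enorm z `^ q) =
  C * (a `^ (q - 2 * s) / - (q - 2 * s)) * A.
Proof.
move=> a0 y1 q0; apply: sector_pow => //; first exact: sub_oy (ltW a0).
exact: integral_powR_y.
Qed.

Definition cone_int y := \int[m]_(z in sector k `]eps, +oo[ y) u (x + z).
(** The radial integral of [t ^ (- 2 * s)] over the interval from [eps] to [r],
    which carries the first-order part of [u]. *)
Definition first_radial := (eps `^ (1 - 2 * s) - r `^ (1 - 2 * s)) / (2 * s - 1).
(** The bound [2 * Cx] on the Hessian times the radial integral of
    [t ^ (1 - 2 * s)] over the interval from [eps] to [r]. *)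
Definition near_radial := Cx u x r * (r `^ (2 - 2 * s) - eps `^ (2 - 2 * s)) / (1 - s).
(** The radial integral of [(1 + t) * t ^ (- 1 - 2 * s)] beyond [r]. *)
Definition far_radial := r `^ (- 2 * s) / (2 * s) + r `^ (1 - 2 * s) / (2 * s - 1).

Lemma measurable_ux : measurable_fun setT (fun z => u (x + z)).
Proof.
have -> : (fun z => u (x + z)) = (fun z => u (z + x)).
  by apply/funext => z; rewrite addrC.
exact: (measurableT_comp mu_ (measurable_shift x)).
Qed.

(** A rotation taking [y'] to [y] turns the difference into an integral over
    the cone around [y']. For [eps < |z| < r] the increment of [u] between [z]
    and its image is linear up to [remainder_lipschitz], and the linear part is
    a first moment. For [|z| > r] the image is reached by chords of length at
    most [|y - y'|] that stay outside the ball, and [rotation_between] bounds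
    their number. *)
Lemma cone_int_difference y y' : enorm y = 1 -> enorm y' = 1 ->
  `|cone_int y - cone_int y' - C * first_radial * B * (dotv p y - dotv p y')| <=
  C * A * (near_radial * enorm (y - y') +
           2 * far_radial * modulus u x r (enorm (y - y'))).
Proof.
move=> y1 y'1; have [Q [oQ Qy Qd Qom]] := rotation_between y'1 y1.
set d := enorm (y - y'); have mux := measurable_ux.
have mQ := @measurable_mulmx R N Q.
have muQ : measurable_fun setT (fun z : 'rV[R]_N => u (x + z *m Q)).
  exact: (measurableT_comp mux mQ).
pose g (z : 'rV[R]_N) := u (x + z *m Q) - u (x + z).
have pre I : (fun z => (z *m Q)%R) @^-1` sector k I y = sector k I y'.
  by rewrite -Qy preimage_sector_ortho.
have minv := @fracm_ortho_invariant R N s s0.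
have mg : measurable_fun setT g by apply: measurable_funB.
have gE : cone_int y - cone_int y' = \int[m]_(z in sector k `]eps, +oo[ y') g z.
  have -> : cone_int y = \int[m]_(z in sector k `]eps, +oo[ y') u (x + z *m Q).
    exact: esym (Rintegral_ortho minv oQ (measurable_secoy k eps y) mux (pre _)).
  rewrite RintegralB//; first exact: measurable_secoy.
  - exact: (integrable_far (c := M)).
  - exact: (integrable_far (c := M)).
have intg : m.-integrable (sector k `]eps, +oo[ y') (EFin \o g).
  apply: (integrable_far (c := M + M)) => // z.
  by rewrite (le_trans (ler_normB _ _))// lerD.
rewrite gE (sector_cut (ltW eps0) epsr y'1 intg).
have mnear := measurable_secoo k eps r y'; have mfar := measurable_secoy k r y'.
have s12 : 1 - 2 * s < 0 by case/andP: hs => h _; rewrite subr_lt0 mulrC -ltr_pdivrMr// div1r.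
have s1 : 0 < 1 - s by case/andP: hs => _ h; rewrite subr_gt0.
have [int1 _] := @sector_near_pow eps r 1 y' eps0 epsr y'1 (ltr0_neq0 s12).
have s22 : 0 < 2 - 2 * s by lra.
have [int2 E2] := @sector_near_pow eps r 2 y' eps0 epsr y'1 (lt0r_neq0 s22).
have [int0 E0] := @sector_far_pow r 0 y' r0 y'1 ltac:(lra).
have [intf1 E1] := @sector_far_pow r 1 y' r0 y'1 s12.
pose l (z : 'rV[R]_N) := dotv (z *m Q - z) p.
have ml : measurable_fun setT l.
  apply: (measurableT_comp (measurable_dotvl p)).
  by apply: measurable_rowB.
have lb z : `|l z| <= enorm p * d * (enorm z `^ 1).
  rewrite powRr1 ?enorm_ge0// (le_trans (normr_dotv _ _))// mulrC -mulrA.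
  by rewrite ler_wpM2l ?enorm_ge0.
have int1c c : m.-integrable (sector k `]eps, r[ y') (EFin \o (fun z => c * enorm z `^ 1)).
  exact: integrableZR.
have intl : m.-integrable (sector k `]eps, r[ y') (EFin \o l).
  apply: (le_integrableR mnear (measurable_funTS ml) _ (int1c (enorm p * d))) => z _.
  exact: lb.
have intgn : m.-integrable (sector k `]eps, r[ y') (EFin \o g).
  apply: integrableS intg; [exact: measurable_secoy|by []|].
  by move=> z; rewrite /sector/= !in_itv/= andbT => -[? /andP[]].
have lE : \int[m]_(z in sector k `]eps, r[ y') l z =
    C * first_radial * B * (dotv p y - dotv p y').
  have fm w : enorm w = 1 -> \int[m]_(z in sector k `]eps, r[ w) dotv z p =
      dotv p w * (C * first_radial * B).
    move=> w1; have mw := measurable_secoo k eps r w.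
    have [intw _] := @sector_near_pow eps r 1 w eps0 epsr w1 (ltr0_neq0 s12).
    have intw1 : m.-integrable (sector k `]eps, r[ w) (EFin \o enorm).
      apply: eq_integrable intw => //z _.
      by rewrite /= powRr1 ?enorm_ge0.
    rewrite (first_moment minv mw (@axial_sector _ _ k _ w) w1 p intw1).
    congr (_ * _); have i1 := integral_powR_oo eps0 epsr (ltr0_neq0 s12).
    rewrite (sector_first s0 k0 w1 (measurable_itv _) (sub_oo (ltW eps0)) i1).
    congr (_ * _ * _); rewrite /first_radial; field.
    by rewrite -opprB oppr_eq0 (ltr0_neq0 s12).
  have intzp : m.-integrable (sector k `]eps, r[ y') (EFin \o (fun z => dotv z p)).
    apply: (le_integrableR mnear _ _ (int1c (enorm p))) => [|z _].
      by apply: measurable_funTS; exact: measurable_dotvl.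
    by rewrite powRr1 ?enorm_ge0// mulrC; exact: normr_dotv.
  have mdQ : measurable_fun setT (fun z : 'rV[R]_N => dotv (z *m Q) p).
    exact: (measurableT_comp (measurable_dotvl p) mQ).
  have intzQp : m.-integrable (sector k `]eps, r[ y') (EFin \o (fun z => dotv (z *m Q) p)).
    apply: (le_integrableR mnear (measurable_funTS mdQ) _ (int1c (enorm p))) => z _.
    rewrite powRr1 ?enorm_ge0// mulrC (le_trans (normr_dotv _ _))//.
    by rewrite enorm_ortho.
  transitivity (\int[m]_(z in sector k `]eps, r[ y') (dotv (z *m Q) p - dotv z p)).
    by apply: eq_Rintegral => z _; rewrite /l dotvDl dotvNl.
  rewrite RintegralB//.
  have -> : \int[m]_(z in sector k `]eps, r[ y') dotv (z *m Q) p =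
      \int[m]_(z in sector k `]eps, r[ y) dotv z p.
    exact: (Rintegral_ortho minv oQ (measurable_secoo k eps r y) (measurable_dotvl p) (pre _)).
  rewrite !fm// -mulrBl; exact: mulrC.
have nearb : `|\int[m]_(z in sector k `]eps, r[ y') (g z - l z)| <= C * A * (near_radial * d).
  pose K := 2 * Cx u x r * d.
  apply: (@le_trans _ _ (\int[m]_(z in sector k `]eps, r[ y') (K * enorm z `^ 2))).
    apply: normr_Rintegral_le => //.
    - apply: eq_integrable (integrableDR mnear intgn (integrableZR mnear (-1) intl)) => //.
      by move=> z _ /=; rewrite mulN1r.
    - exact: integrableZR.
    - move=> z [_]; rewrite /= in_itv/= => /andP[_ zr].
      have hK := @opnorm_le_Cx R N u x r uC2.
      have := @remainder_lipschitz R N u x r uC2 _ _ z (z *m Q) hK zr (lexx _).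
      rewrite enorm_ortho// => /(_ (lexx _)) h; rewrite /g /l (le_trans h)//.
      have Cx0 : 0 <= 2 * Cx u x r.
        apply: le_trans (opnorm_ge0 _) (hK x _).
        by rewrite /eball/= subrr enorm0.
      rewrite (_ : K * _ = 2 * Cx u x r * enorm z * (d * enorm z)); last first.
        by rewrite powR_mulrn ?enorm_ge0// /K; ring.
      apply: ler_wpM2l; last exact: Qd.
      by rewrite mulr_ge0 ?enorm_ge0.
  rewrite RintegralZl// E2 /K /near_radial le_eqVlt; apply/orP; left; apply/eqP.
  by field; rewrite !lt0r_neq0.
have farb : `|\int[m]_(z in sector k `]r, +oo[ y') g z| <=
    C * A * (2 * far_radial * modulus u x r d).
  pose om := modulus u x r d.
  have intb : m.-integrable (sector k `]r, +oo[ y')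
      (EFin \o (fun z => 2 * om * enorm z `^ 0 + 2 * om * enorm z `^ 1)).
    by apply: integrableDR => //; exact: integrableZR.
  apply: (@le_trans _ _ (\int[m]_(z in sector k `]r, +oo[ y')
      (2 * om * enorm z `^ 0 + 2 * om * enorm z `^ 1))).
    apply: normr_Rintegral_le => //.
      apply: integrableS intg; [exact: measurable_secoy|by []|].
      by move=> z; rewrite /sector/= !in_itv/= !andbT => -[? /(lt_trans epsr)].
    move=> z [_]; rewrite /= in_itv/= andbT => zr.
    have := Qom z (fun z => u (x + z)) om; rewrite powRr0 powRr1 ?enorm_ge0// => h.
    apply: (le_trans (h _)); last first.
      by rewrite le_eqVlt; apply/orP; left; apply/eqP; ring.
    move=> a b az bz ab; apply: (le_modulus uM).
    - by apply/negP; rewrite addrAC subrr add0r az -ltNge.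
    - by apply/negP; rewrite addrAC subrr add0r bz -ltNge.
    - by rewrite opprD addrACA subrr add0r.
  rewrite RintegralD//; [|exact: integrableZR|exact: integrableZR].
  rewrite !RintegralZl// E0 E1 /far_radial -/om !sub0r mulNr le_eqVlt.
  apply/orP; left; apply/eqP; field.
  by rewrite (gt_eqF sgt0)/= -opprB oppr_eq0 (ltr0_neq0 s12).
have -> : \int[m]_(z in sector k `]eps, r[ y') g z =
    \int[m]_(z in sector k `]eps, r[ y') (g z - l z) + \int[m]_(z in sector k `]eps, r[ y') l z.
  by rewrite RintegralB// subrK.
rewrite lE (addrAC _ _ (\int[m]_(z in sector k `]r, +oo[ y') g z)) addrK mulrDr.
by rewrite (le_trans (ler_normD _ _))// lerD.
Qed.

End cone_integrals.

(** * Comparison of cones with different axes *)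

(** Here [d] is the displacement of the axis, which costs [P * d ^+ 2]. If it
    pays off, one of the two gains covers half of the cost: then
    [d <= 2 * c / P], or [d] belongs to the set whose supremum is taken; hence
    [d <= m] and the gains are monotone. *)
Lemma quadratic_loss_le {R : realType} (P c W m1 : R) (om Q : R -> R) (d : R) :
  0 < P -> 0 <= c -> 0 <= W -> (forall a, 0 <= a -> 0 <= om a) ->
  (forall a b, 0 <= a -> a <= b -> om a <= om b) ->
  (forall a, Q a = 4 * W * om a / P) -> 2 * c <= m1 * P -> 0 <= d <= 2 ->
  let m := Num.max m1 (sup [set a | 0 <= a <= 2 /\ a ^+ 2 <= Q a]) in
  [/\ 0 <= m & c * d + 2 * W * om d - P * d ^+ 2 <= c * m + 2 * W * om m].
Proof.
move=> P0 c0 W0 om0 omle QE m1P /andP[d0 d2]; set S := [set a | _] => m.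
have S_ub : has_ubound S by exists 2 => a [/andP[]].
have leS a : 0 <= a <= 2 -> a ^+ 2 <= Q a -> a <= m.
  by move=> a02 aQ; rewrite le_max (ub_le_sup S_ub (conj a02 aQ)) orbT.
have m0 : 0 <= m.
  apply: leS; first by rewrite lexx ler0n.
  by rewrite expr0n/= QE divr_ge0 ?mulr_ge0 ?om0// ltW.
split=> //; have R0 : 0 <= c * m + 2 * W * om m.
  by rewrite addr_ge0 ?mulr_ge0 ?om0.
have [h|h] := leP (P * d ^+ 2) (c * d + 2 * W * om d); last first.
  by rewrite (le_trans _ R0)// subr_le0 ltW.
suff dm : d <= m.
  apply: (@le_trans _ _ (c * d + 2 * W * om d)).
    by rewrite gerBl mulr_ge0 ?sqr_ge0// ltW.
  by rewrite lerD ?ler_wpM2l ?omle// mulr_ge0.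
have [cd|cd] := leP (P * d ^+ 2) (2 * (c * d)).
  have [->//|dn0] := eqVneq d 0; have dgt : 0 < d by rewrite lt0r dn0.
  rewrite le_max; apply/orP; left; rewrite -(ler_pM2r P0) (le_trans _ m1P)//.
  by rewrite -(ler_pM2r dgt); move: cd; rewrite expr2; lra.
apply: leS; first by rewrite d0.
by rewrite QE ler_pdivlMr// mulrC; lra.
Qed.

Section comparison.
Context {R : realType} {n : nat}.
Variables (s k pp : R) (u : 'rV[R]_n.+2 -> R) (x : 'rV[R]_n.+2) (r M eps : R).
Hypotheses (s0 : 0 <= s) (hs : 2^-1 < s < 1) (k0 : 0 <= k) (hp : 2 <= pp).
Hypotheses (mu_ : measurable_fun setT u) (uM : forall z, `|u z| <= M).
Hypotheses (uC2 : C2_closed_ball u x r) (eps0 : 0 < eps) (epsr : eps < r).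
Hypothesis px0 : grad u x != 0.
Local Notation N := n.+2.
Local Notation C := (fracC N s).
Local Notation e i := (basisv i : 'rV[R]_N).
Local Notation A := (@cap_size R n k).
Local Notation B := (\int[@sphere_measure R N]_(z in sector k [set 1%R] (e 0)) dotv z (e 0)).
Local Notation p := (grad u x).
Local Notation Np := (N%:R + pp - 2).
Hypotheses (A0 : 0 < A) (AB : (pp - 1) / Np * A <= B).
Implicit Types y : 'rV[R]_N.

Local Notation I := (cone_int k u x eps s0).
Local Notation mm := (m_eps pp s u x r eps).
Local Notation K := (first_radial s r eps).
Local Notation c := (near_radial s u x r eps).
Local Notation W := (far_radial s r).

Let r0 : 0 < r. Proof. exact: lt_trans epsr. Qed.
Let s_gt : 0 < 2 * s - 1. Proof. by case/andP: hs => h _; lra. Qed.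
Let s_lt : 0 < 1 - s. Proof. by case/andP: hs => _ h; lra. Qed.
Let p0 : 0 < enorm p. Proof. by rewrite enorm_gt0. Qed.
Let Np0 : 0 < Np.
Proof. by rewrite -addrA ltr_wpDr ?ltr0n// subr_ge0. Qed.
Let C0 : 0 < C.
Proof. by apply: fracC_gt0; apply/andP; split; move: s_gt s_lt; lra. Qed.

Lemma Cx_ge0 : 0 <= Cx u x r.
Proof.
have xr : eball x r x by rewrite /eball/= subrr enorm0.
by have := le_trans (opnorm_ge0 _) (opnorm_le_Cx uC2 xr); rewrite pmulr_rge0.
Qed.

Lemma near_radial_ge0 : 0 <= c.
Proof.
rewrite divr_ge0 ?(ltW s_lt)// mulr_ge0 ?Cx_ge0// subr_ge0.
by rewrite ge0_ler_powR ?nnegrE ?ltW//; move: s_lt; lra.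
Qed.

Lemma far_radial_ge0 : 0 <= W.
Proof. by rewrite addr_ge0// divr_ge0 ?powR_ge0// ?(ltW s_gt)// mulr_ge0. Qed.

Lemma powR_diff_gt0 : 0 < eps `^ (1 - 2 * s) - r `^ (1 - 2 * s).
Proof.
rewrite subr_gt0 -(opprB (2 * s)) !powRN ltf_pV2 ?posrE ?powR_gt0//.
by rewrite gt0_ltr_powR// nnegrE ltW.
Qed.

Lemma first_radial_gt0 : 0 < K.
Proof. by rewrite divr_gt0// powR_diff_gt0. Qed.

(** The linear part of [u] costs a multiple of the squared displacement of the
    axis, with a factor bounded below through the first moment of the cap.
    [quadratic_loss_le] applies with this cost and with the gains allowed by
    [cone_int_difference]; the maximum there is the quantity [m_eps]. *)
Lemma cone_int_gain y y' : enorm y = 1 -> enorm y' = 1 ->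
  dotv p y - dotv p y' = - (enorm p / 2 * enorm (y - y') ^+ 2) ->
  0 <= mm /\ I y - I y' <= C * A * (c * mm + 2 * W * modulus u x r mm).
Proof.
move=> y1 y'1 pE; set d := enorm (y - y') in pE *.
pose P := (pp - 1) / Np * (enorm p / 2) * K.
have pp1 : 0 < pp - 1 by move: hp; lra.
have K0 := first_radial_gt0; have D0 := powR_diff_gt0.
have P0 : 0 < P by rewrite !mulr_gt0// invr_gt0.
have d02 : 0 <= d <= 2.
  by rewrite enorm_ge0 (le_trans (enormB _ _))// y1 y'1.
have QE a : (N%:R + pp - 2) / (pp - 1) * (8 * modulus u x r a / enorm p) *
    (((2 * s - 1) / (2 * s) * r `^ (- 2 * s) + r `^ (1 - 2 * s)) /
     (eps `^ (1 - 2 * s) - r `^ (1 - 2 * s))) = 4 * W * modulus u x r a / P.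
  rewrite /P /far_radial /first_radial.
  move: (r `^ (- 2 * s)) (r `^ (1 - 2 * s)) (eps `^ (1 - 2 * s)) D0 => w1 w2 w3 D0.
  move: (Np) Np0 (enorm p) p0 => q q0 t t0; have sgt : 0 < s by move: s_gt; lra.
  field.
  by rewrite ?(lt0r_neq0 q0) ?(lt0r_neq0 t0) ?(lt0r_neq0 D0) ?(lt0r_neq0 pp1)
    ?(lt0r_neq0 sgt) ?(lt0r_neq0 s_gt).
have m1P : 2 * c <= (16 * (N%:R + pp - 2) / (pp - 1) * (Cx u x r / enorm p) *
     ((2 * s - 1) / (1 - s)) *
     ((r `^ (2 - 2 * s) - eps `^ (2 - 2 * s)) /
      (eps `^ (1 - 2 * s) - r `^ (1 - 2 * s)))) * P.
  have -> : 2 * c = 4^-1 * (8 * c) by field.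
  have c0 := near_radial_ge0.
  rewrite [leRHS](_ : _ = 8 * c); first by lra.
  rewrite /P /near_radial /first_radial.
  move: (r `^ (2 - 2 * s)) (eps `^ (2 - 2 * s)) (r `^ (1 - 2 * s)) (eps `^ (1 - 2 * s)) D0
    => w1 w2 w3 w4 D0.
  move: (Np) Np0 (enorm p) p0 => q q0 t t0.
  field.
  by rewrite ?(lt0r_neq0 q0) ?(lt0r_neq0 t0) ?(lt0r_neq0 D0) ?(lt0r_neq0 pp1)
    ?(lt0r_neq0 s_lt) ?(lt0r_neq0 s_gt).
have [m0 h] := quadratic_loss_le P0 near_radial_ge0 far_radial_ge0
  (modulus_ge0 x r0 uM) (modulus_le x r0 uM) QE m1P d02.
split=> //; rewrite -/mm in h.
have CA0 : 0 < C * A by rewrite mulr_gt0.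
apply: (@le_trans _ _ (C * A * (c * d + 2 * W * modulus u x r d - P * d ^+ 2))); last first.
  by rewrite ler_wpM2l// ltW.
have := cone_int_difference s0 hs k0 mu_ uM uC2 eps0 epsr y1 y'1.
rewrite -/d pE => /(le_trans (ler_norm _)) hd.
have : C * K * ((pp - 1) / Np * A) * (enorm p / 2 * d ^+ 2) <=
    C * K * B * (enorm p / 2 * d ^+ 2).
  rewrite ler_wpM2r ?mulr_ge0 ?sqr_ge0 ?invr_ge0 ?enorm_ge0//.
  by rewrite ler_wpM2l// mulr_ge0 ?(ltW C0) ?(ltW K0).
rewrite /P; move: hd; lra.
Qed.

Lemma dotv_normalizer : dotv p (normalize p) = enorm p.
Proof.
by rewrite /normalize dotvZr -enorm_sq expr2 mulrA mulVf ?mul1r ?lt0r_neq0.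
Qed.

Lemma dotv_p_normalize y : dotv p y = enorm p * dotv (normalize p) y.
Proof. by rewrite /normalize dotvZl mulrA mulfV ?mul1r ?lt0r_neq0. Qed.

(** Near its maximum at the gradient direction the scalar product with [p]
    decreases quadratically: [<p, y> - |p| = - |p| * |y - p/|p||^2 / 2]. *)
Lemma cone_int_above y : enorm y = 1 ->
  I y - I (normalize p) <= C * A * (c * mm + 2 * W * modulus u x r mm).
Proof.
move=> y1; have n1 := enorm_normalize px0; apply: (proj2 (cone_int_gain y1 n1 _)).
by rewrite dotv_normalizer dotv_p_normalize (enorm_sqB y1 n1) (dotvC y); field.
Qed.

Lemma cone_int_below y : enorm y = 1 ->
  I (- normalize p) - I y <= C * A * (c * mm + 2 * W * modulus u x r mm).
Proof.
move=> y1; have n1 : enorm (- normalize p) = 1 by rewrite enormN enorm_normalize.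
apply: (proj2 (cone_int_gain n1 y1 _)).
by rewrite (enorm_sqB n1 y1) dotvNr dotv_normalizer dotv_p_normalize dotvNl; field.
Qed.

End comparison.

(** The two discrepancies [sup F - F a] and [F b - inf F] are nonnegative and
    enter with opposite signs, so that a single bound suffices. *)
Lemma midpoint_sup_inf {R : realType} {T : Type} (S : set T) (F : T -> R) a b (c : R) :
  S a -> S b -> (forall y, S y -> F y - F a <= c) -> (forall y, S y -> F b - F y <= c) ->
  `|2^-1 * (sup [set F y | y in S] + inf [set F y | y in S]) - 2^-1 * (F a + F b)| <=
  2^-1 * c.
Proof.
move=> Sa Sb Fa Fb; set G := [set _ | _ in _].
have G0 : G !=set0 by exists (F a), a.
have ubG : has_ubound G.
  by exists (F a + c) => _ [y Sy <-]; rewrite -lerBlDl; exact: Fa.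
have lbG : has_lbound G.
  by exists (F b - c) => _ [y Sy <-]; rewrite lerBlDr -lerBlDl; exact: Fb.
have aS : F a <= sup G by apply: ub_le_sup => //; exists a.
have bI : inf G <= F b by apply: ge_inf => //; exists b.
have Sle : sup G <= F a + c.
  by apply: ge_sup => // _ [y Sy <-]; rewrite -lerBlDl; exact: Fa.
have Ige : F b - c <= inf G.
  by apply: lb_le_inf => // _ [y Sy <-]; rewrite lerBlDr -lerBlDl; exact: Fb.
by rewrite ler_norml; apply/andP; split; lra.
Qed.

(** * The nonlocal operator *)

Lemma integrable_setUR d (T : measurableType d) {R : realType} (m : {measure set T -> \bar R})
    (D1 D2 : set T) (f : T -> R) : measurable D1 -> measurable D2 -> [disjoint D1 & D2] ->
  m.-integrable D1 (EFin \o f) -> m.-integrable D2 (EFin \o f) ->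
  m.-integrable (D1 `|` D2) (EFin \o f).
Proof.
move=> mD1 mD2 D12 /integrableP[mf1 i1] /integrableP[mf2 i2].
have mf : measurable_fun (D1 `|` D2) (EFin \o f) by apply/measurable_funU.
apply/integrableP; split => //; rewrite ge0_integral_setU//; first exact: lte_add_pinfty.
exact: measurableT_comp.
Qed.

Section averages.
Context {R : realType} {n : nat}.
Variables (s alpha : R) (u : 'rV[R]_n.+2 -> R) (x : 'rV[R]_n.+2) (r M eps : R).
Hypotheses (s0 : 0 <= s) (hs : 2^-1 < s < 1) (halpha : 0 < alpha <= pi / 2).
Hypotheses (mu_ : measurable_fun setT u) (uM : forall z, `|u z| <= M).
Hypotheses (uC2 : C2_closed_ball u x r) (eps0 : 0 < eps) (epsr : eps < r).
Local Notation N := n.+2.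
Local Notation C := (fracC N s).
Local Notation k := (cos alpha).
Local Notation e i := (basisv i : 'rV[R]_N).
Local Notation m := (@fracm R N s s0).
Local Notation A := (@cap_size R n k).
Local Notation p := (grad u x).
Local Notation I := (cone_int k u x eps s0).
Local Notation y0 := (normalize p).
Local Notation H := (hessian u x).
Local Notation I1 := (\int[@sphere_measure R N]_(z in sector k [set 1%R] (e 0)) (dotv z (e 0) ^+ 2)).
Local Notation I2 := (\int[@sphere_measure R N]_(z in sector k [set 1%R] (e 0)) (dotv z (e 1) ^+ 2)).
Implicit Types y z : 'rV[R]_N.

(** The mass of the truncated cone, whatever its axis. *)
Definition cone_mass := C * (eps `^ (- 2 * s) / (2 * s)) * A.

Let alpha_pi : 0 <= alpha <= pi.
Proof.
case/andP: halpha => a0 api; rewrite (ltW a0) (le_trans api)// ler_pdivrMr//.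
by rewrite ler_peMr ?pi_ge0// ler1n.
Qed.

Lemma cos_aperture_ge0 : 0 <= k.
Proof.
apply: cos_ge0_pihalf; case/andP: halpha => a0 ->; rewrite andbT.
by rewrite (le_trans _ (ltW a0))// oppr_le0 divr_ge0// pi_ge0.
Qed.

Lemma cone_sector a y : 0 <= a -> enorm y = 1 ->
  cone alpha a%:E +oo y = sector k `]a, +oo[ y.
Proof.
move=> a0 y1; rewrite coneE//; congr (sector k _ y).
by apply/seteqP; split => t /=; rewrite in_itv/= andbT lte_fin ltry andbT.
Qed.

Lemma cap_areaE : cap_area (N:=N) alpha = A.
Proof. by rewrite /cap_area capE. Qed.

Lemma cone_avgE y : enorm y = 1 -> cone_avg s alpha eps u x y = I y / cone_mass.
Proof.
move=> y1; rewrite /cone_avg /avg (cone_sector (ltW eps0) y1).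
have hV := sector_far_measure k s0 hs eps0 y1.
have -> : fine (frac_measure s (sector k `]eps, +oo[ y)) = cone_mass.
  by have -> : frac_measure s (sector k `]eps, +oo[ y) = m (sector k `]eps, +oo[ y) by [];
    rewrite hV.
congr (_ / _); rewrite /cone_int /Rintegral; congr fine.
Qed.

Local Notation Lz := (fun z => u (x + z) + u (x - z) - 2 * u x).

Lemma LspE : p != 0 -> Lsp s alpha u x = \int[m]_(z in sector k `]0, +oo[ y0) Lz z.
Proof.
move=> p0; rewrite /Lsp (cone_sector (lexx 0) (enorm_normalize p0)).
by rewrite /Rintegral.
Qed.

Lemma measurable_reflect : measurable_fun setT (fun z => u (x - z)).
Proof. exact: (measurableT_comp (measurable_ux x mu_) (@measurable_opprV R N)). Qed.

Lemma measurable_second_difference : measurable_fun setT Lz.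
Proof.
apply: measurable_funB => //; apply: measurable_funD; first exact: measurable_ux.
exact: measurable_reflect.
Qed.

(** The reflection in the origin maps a cone onto the opposite one. *)
Lemma cone_int_opp y : enorm y = 1 ->
  \int[m]_(z in sector k `]eps, +oo[ y) u (x - z) = I (- y).
Proof.
move=> y1; pose Q : 'M[R]_N := - 1%:M.
have oQ : isomx Q by rewrite /isomx /Q mulNmx mul1mx linearN/= trmx1 opprK.
have QE z : z *m Q = - z by rewrite mulmxN mulmx1.
have pre : (fun z => (z *m Q)%R) @^-1` sector k `]eps, +oo[ (- y) = sector k `]eps, +oo[ y.
  by rewrite -(QE y) preimage_sector_ortho.
have h := Rintegral_ortho (@fracm_ortho_invariant R N s s0) oQ (measurable_secoy k eps (- y))
  (measurable_ux x mu_) pre.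
apply: etrans h.
by apply: eq_Rintegral => z _; rewrite QE.
Qed.

(** A bounded function is integrable away from the origin; near the origin this
    is an assumption, fulfilled by the second difference because it is
    quadratically small. *)
Lemma integrable_glue y (f : 'rV[R]_N -> R) (c : R) : enorm y = 1 ->
  measurable_fun setT f -> (forall z, `|f z| <= c) ->
  m.-integrable (sector k `]0, eps[ y) (EFin \o f) ->
  m.-integrable (sector k `]0, +oo[ y) (EFin \o f).
Proof.
move=> y1 mf fc intf.
have e20 : 0 < eps / 2 by rewrite divr_gt0.
have mge : measurable (sector k `[eps, +oo[ y) by exact: measurable_sector_set.
have intg : m.-integrable (sector k `[eps, +oo[ y) (EFin \o f).
  have h := integrable_far k s0 hs e20 y1 mf fc.
  apply: integrableS h => //; first exact: measurable_secoy.
  move=> z; rewrite /sector/= !in_itv/= !andbT => -[? ez]; split=> //.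
  by apply: lt_le_trans ez; rewrite ltr_pdivrMr// ltr_pMr// ltr1n.
have -> : sector k `]0, +oo[ y = sector k `]0, eps[ y `|` sector k `[eps, +oo[ y.
  apply/seteqP; split => z; rewrite /sector/= !in_itv/= !andbT.
    by move=> [-> z0]; have [ze|ze] := ltP (enorm z) eps; [left; rewrite z0|right].
  by case=> [[-> /andP[]]|[-> /(lt_le_trans eps0)]].
apply: integrable_setUR => //; first exact: measurable_secoo.
apply/disj_setPS => z [[_ /=]]; rewrite in_itv/= => /andP[_ ze] [_ /=].
by rewrite in_itv/= andbT leNgt ze.
Qed.

(** Beyond [eps] the operator is the sum of two opposite cone integrals, and
    below [eps] the second difference is the Hessian form up to the oscillation
    of the Hessian. The form integrates to a combination of its axial value and
    its trace, by [sector_second]. *)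
Lemma Lsp_expansion (delta : R) : p != 0 ->
  (forall y, eball x eps y -> opnorm (hessian u y - H) <= delta) ->
  `|Lsp s alpha u x - (I y0 + I (- y0) - 2 * u x * cone_mass) -
    C * (eps `^ (2 - 2 * s) / (2 - 2 * s)) *
      (dotv (y0 *m H) y0 * I1 + (\tr H - dotv (y0 *m H) y0) * I2)| <=
  delta * (C * (eps `^ (2 - 2 * s) / (2 - 2 * s)) * A).
Proof.
move=> p0 hd; have y1 := enorm_normalize p0; rewrite LspE//.
move: (y0) y1 => y y1; set f := Lz; pose q z := dotv (z *m H) z.
have mf : measurable_fun setT f by exact: measurable_second_difference.
have mnear := measurable_secoo k 0 eps y.
have s22 : 0 < 2 - 2 * s by case/andP: hs => _ h; lra.
have jE := integral_powR_0 eps0 s22.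
have sub0 := sub_oo (lexx (0 : R)) (b := eps).
have [int2 E2] := sector_pow s0 k (measurable_itv `]0, eps[) sub0 jE y1.
have Eq := sector_second s0 k H y1 (measurable_itv `]0, eps[) sub0 jE.
have fq z : enorm z < eps -> `|f z - q z| <= delta * enorm z `^ 2.
  move=> ze; have h1 := taylor2 uC2 (ltW epsr) hd ze.
  have := taylor2 uC2 (ltW epsr) hd (z := - z); rewrite enormN => /(_ ze).
  rewrite mulNmx !dotvNl dotvNr opprK -/(q z) => h2.
  rewrite powR_mulrn ?enorm_ge0// /f.
  move: h1 h2; rewrite -/(q z) !ler_norml => /andP[h1 h1'] /andP[h2 h2'].
  by apply/andP; split; lra.
have intq : m.-integrable (sector k `]0, eps[ y) (EFin \o q).
  apply: (le_integrableR mnear _ _ (integrableZR mnear (opnorm H) int2)).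
    apply: measurable_funTS; apply: measurable_sum => i; apply: measurable_funM.
      by apply: measurable_fun_coord; exact: measurable_mulmx.
    exact: measurable_coord.
  move=> z _; rewrite powR_mulrn ?enorm_ge0// expr2; exact: normr_bilin.
have intd : m.-integrable (sector k `]0, eps[ y) (EFin \o (fun z => f z - q z)).
  apply: (le_integrableR mnear _ _ (integrableZR mnear delta int2)).
    apply: measurable_funB; [exact: measurable_funTS|].
    by move/measurable_int : intq => /measurable_EFinP.
  by move=> z [_]; rewrite /= in_itv/= => /andP[_]; exact: fq.
have intn : m.-integrable (sector k `]0, eps[ y) (EFin \o f).
  apply: eq_integrable (integrableDR mnear intd intq) => //.
  by move=> z _ /=; rewrite subrK.
have fM z : `|f z| <= M + M + 2 * M.
  rewrite /f (le_trans (ler_normB _ _))//; apply: lerD; last by rewrite normrM ger0_norm// ler_wpM2l.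
  by rewrite (le_trans (ler_normD _ _))// lerD.
rewrite (sector_cut (lexx 0) eps0 y1 (integrable_glue y1 mf fM intn)).
have intu : m.-integrable (sector k `]eps, +oo[ y) (EFin \o (fun z => u (x + z))).
  by apply: (integrable_far k s0 hs eps0 y1 _ (c := M)) => //; exact: measurable_ux.
have intr : m.-integrable (sector k `]eps, +oo[ y) (EFin \o (fun z => u (x - z))).
  by apply: (integrable_far k s0 hs eps0 y1 _ (c := M)) => //; exact: measurable_reflect.
have intc : m.-integrable (sector k `]eps, +oo[ y) (EFin \o (fun=> 2 * u x)).
  exact: (integrable_far k s0 hs eps0 y1 _ (c := `|2 * u x|)).
have -> : \int[m]_(z in sector k `]eps, +oo[ y) f z = I y + I (- y) - 2 * u x * cone_mass.
  have mfar := measurable_secoy k eps y.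
  rewrite /f RintegralB//; last exact: integrableDR.
  by rewrite RintegralD// cone_int_opp// Rintegral_cst// (sector_far_measure k s0 hs).
rewrite addrK -Eq -RintegralB//.
rewrite -[X in delta * X]E2 -RintegralZl//.
apply: normr_Rintegral_le => //; first exact: integrableZR.
by move=> z [_]; rewrite /= in_itv/= => /andP[_]; exact: fq.
Qed.

End averages.

(** * The asymptotic expansion *)

Lemma opnormB {R : realType} {n : nat} (A B : 'M[R]_n) :
  opnorm (A - B) <= opnorm A + opnorm B.
Proof.
apply: opnorm_le => [|v v1]; first by rewrite addr_ge0 ?opnorm_ge0.
rewrite linearB/= mulmxBr (le_trans (enormB _ _))// -[leRHS]mulr1 -v1 mulrDl.
by rewrite lerD ?enorm_mulmx.
Qed.

Section assembly.
Context {R : realType}.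
Variables (N pp s eps delta : R).
Hypotheses (N0 : 0 < N) (hp : 2 <= pp) (s0 : 0 < s) (s1 : 0 < 1 - s).
Local Notation Np := (N + pp - 2).
Local Notation D := (Np + 2 * s).

Lemma Np_gt0 : 0 < Np. Proof. by move: N0 hp; lra. Qed.
Lemma D_gt0 : 0 < D. Proof. by move: N0 hp s0; lra. Qed.

(** The aperture makes the axial and transverse moments of the cap proportional
    to [pp - 1] and [1]. Hence the coefficient of the axial value [h11] is
    [pp - 2] once the trace is separated, in accordance with the weights of the
    midrange and of the ball average. *)
Lemma operator_share (X Xi Y C A I1 I2 L J1 J2 ux h11 tr : R) :
  X * Xi = 1 -> X * Y = eps ^+ 2 -> 0 <= X -> 0 < C -> 0 < A ->
  I1 = (pp - 1) * I2 -> A = Np * I2 ->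
  let V := C * (Xi / (2 * s)) * A in
  `|L - (J1 + J2 - 2 * ux * V) -
    C * (Y / (2 - 2 * s)) * (h11 * I1 + (tr - h11) * I2)| <=
  delta * (C * (Y / (2 - 2 * s)) * A) ->
  `|(1 - s) * s / (C * A) * (Np / D) * X * L -
    ((1 - s) * Np / D * (2^-1 * (J1 / V + J2 / V) - ux) +
     s * eps ^+ 2 / (2 * D) * ((pp - 2) * h11 + tr))| <=
  s * Np / D * (2^-1 * delta * eps ^+ 2).
Proof.
move=> XXi XY X0 C0 A0 I1E AE V; set c := _ * X; set E := L - _ - _ => hE.
have Np0 := Np_gt0; have D0 := D_gt0.
have c0 : 0 <= c by rewrite !mulr_ge0 ?invr_ge0 ?mulr_ge0 ?(ltW C0) ?(ltW A0) ?(ltW s1)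
  ?(ltW s0) ?(ltW Np0) ?(ltW D0).
have I20 : I2 != 0 by apply: contraTneq A0 => I20; rewrite AE I20 mulr0 ltxx.
have Xi0 : Xi != 0.
  by apply/eqP => h; move: XXi; rewrite h mulr0 => /esym/eqP; rewrite oner_eq0.
have Xn0 : X != 0.
  by apply/eqP => h; move: XXi; rewrite h mul0r => /esym/eqP; rewrite oner_eq0.
have s22 : 0 < 2 - 2 * s by move: s1; lra.
rewrite [X in `|X|](_ : _ = c * E).
  rewrite normrM ger0_norm// (le_trans (ler_wpM2l c0 hE))// le_eqVlt; apply/orP; left.
  apply/eqP; rewrite -XY /c; field.
  by rewrite (lt0r_neq0 D0) (lt0r_neq0 s22) (lt0r_neq0 A0) (lt0r_neq0 C0).
rewrite /E /c /V I1E -XY AE.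
have -> : Xi = X^-1 by apply: (mulfI Xn0); rewrite XXi mulfV.
move: (Np) Np0 D0 => q Np0 D0; field.
by rewrite (lt0r_neq0 s22) (lt0r_neq0 s0) Xn0 (lt0r_neq0 D0) I20 (lt0r_neq0 Np0) (lt0r_neq0 C0).
Qed.

(** The weights add up to 1. The oscillation of the Hessian enters with
    coefficients proportional to [pp - 2], [N] and [N + pp - 2], the first two
    adding up to the third. *)
Lemma mean_value_split (F F0 mid avg ux h11 tr cL c1 e3 : R) :
  `|F - F0| <= 2^-1 * c1 ->
  `|mid - ux - 2^-1 * eps ^+ 2 * h11| <= 2^-1 * delta * eps ^+ 2 + e3 ->
  `|avg - ux - eps ^+ 2 / (2 * (N + 2)) * tr| <= 2^-1 * delta * (eps ^+ 2 * N / (N + 2)) ->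
  `|cL - ((1 - s) * Np / D * (F0 - ux) +
     s * eps ^+ 2 / (2 * D) * ((pp - 2) * h11 + tr))| <=
    s * Np / D * (2^-1 * delta * eps ^+ 2) ->
  `|(1 - s) * Np / D * F + s * (pp - 2) / D * mid + s * (N + 2) / D * avg - ux - cL| <=
  (1 - s) * Np / D * (2^-1 * c1) + s * Np / D * eps ^+ 2 * delta + s * (pp - 2) / D * e3.
Proof.
move=> h1 h2 h3 h4; have Np0 := Np_gt0; have D0 := D_gt0.
have a1 : 0 <= (1 - s) * Np / D by rewrite divr_ge0 ?mulr_ge0 ?ltW.
have a2 : 0 <= s * (pp - 2) / D by rewrite divr_ge0 ?mulr_ge0 ?subr_ge0// ltW.
have N20 : 0 < N + 2 by rewrite addr_gt0.
have a3 : 0 <= s * (N + 2) / D by rewrite divr_ge0 ?mulr_ge0 ?ltW.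
set E1 := F - F0 in h1; set E2 := mid - ux - _ in h2; set E3 := avg - ux - _ in h3.
set E4 := cL - _ in h4.
have -> : (1 - s) * Np / D * F + s * (pp - 2) / D * mid + s * (N + 2) / D * avg - ux - cL =
    (1 - s) * Np / D * E1 + s * (pp - 2) / D * E2 + s * (N + 2) / D * E3 - E4.
  by rewrite /E1 /E2 /E3 /E4; field; rewrite (lt0r_neq0 N20) (lt0r_neq0 D0).
have -> : (1 - s) * Np / D * (2^-1 * c1) + s * Np / D * eps ^+ 2 * delta +
    s * (pp - 2) / D * e3 =
  (1 - s) * Np / D * (2^-1 * c1) + s * (pp - 2) / D * (2^-1 * delta * eps ^+ 2 + e3) +
  s * (N + 2) / D * (2^-1 * delta * (eps ^+ 2 * N / (N + 2))) +
  s * Np / D * (2^-1 * delta * eps ^+ 2).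
  by field; rewrite (lt0r_neq0 N20) (lt0r_neq0 D0).
rewrite (le_trans (ler_normB _ _))// lerD// (le_trans (ler_normD _ _))// lerD//.
  by rewrite (le_trans (ler_normD _ _))// lerD// normrM ger0_norm// ler_wpM2l.
by rewrite normrM ger0_norm// ler_wpM2l.
Qed.

End assembly.

(** The transverse moment cannot vanish: the quotient would be 0 by convention,
    while [p - 1 >= 1]. *)
Lemma aperture_moments {R : realType} {n : nat} (p alpha : R) : 2 <= p ->
  @is_aperture R n.+2 p alpha ->
  let k := cos alpha in
  let J i := \int[@sphere_measure R n.+2]_(z in sector k [set 1%R] (basisv 0))
    (dotv z (basisv i) ^+ 2) in
  [/\ J 0%N = (p - 1) * J 1%N, @cap_size R n k = (n.+2%:R + p - 2) * J 1%N &
      0 < @cap_size R n k].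
Proof.
move=> hp [halpha]; rewrite capE//; last first.
  case/andP: halpha => a0 api; rewrite (ltW a0) (le_trans api)// ler_pdivrMr//.
  by rewrite ler_peMr ?pi_ge0// ler1n.
move=> pE k J; rewrite -!/(J _) in pE.
have J1 : J 1%N != 0.
  by apply/eqP => h; move: pE; rewrite -/(J 1%N) h invr0 mulr0; lra.
have J0 : J 0%N = (p - 1) * J 1%N by rewrite pE divfK.
have AE : @cap_size R n k = (n.+2%:R + p - 2) * J 1%N.
  rewrite cap_sizeE -/(J 0%N) -/(J 1%N) J0 -mulrDl; congr (_ * _).
  by rewrite -[n.+2]addn1 -[n.+1 in RHS]addn1 !natrD -addn1 natrD; ring.
split=> //; rewrite AE mulr_gt0//.
  by rewrite -addrA ltr_wpDr ?ltr0n// subr_ge0.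
by rewrite lt0r J1/=; apply: Rintegral_ge0 => z _; exact: sqr_ge0.
Qed.

Theorem theorem4p2 (R : realType) (N : nat) (p s alpha : R)
    (u : 'rV[R]_N -> R) (x : 'rV[R]_N) (r : R)
    (hN : (2 <= N)%N) (hp : 2 <= p) (hs : 2^-1 < s < 1)
    (halpha : @is_aperture R N p alpha)
    (u_bounded : exists M : R, forall z, `|u z| <= M)
    (u_borel : measurable_fun setT u)
    (hr : 0 < r)
    (u_C2 : C2_closed_ball u x r)
    (grad_neq0 : grad u x != 0)
    (u_unif_cont : unif_cont_outside u x r) :
  forall eps : R, 0 < eps < r ->
    eps * opnorm (hessian u x) <= enorm (grad u x) ->
    let px := enorm (grad u x) in
    let C := Cx u x r in
    let m := m_eps p s u x r eps in
    let Np := N%:R + p - 2 in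
    `| Abar p s alpha eps u x - u x
       - (1 - s) * s / (fracC N s * @cap_area R N alpha) * (Np / (Np + 2 * s))
         * eps `^ (2 * s) * Lsp s alpha u x |
    <= 4 * s * Np / (Np + 2 * s) * C
         * (r `^ (2 - 2 * s) - eps `^ (2 - 2 * s)) * eps `^ (2 * s) * m
     + (1 - s) * Np / (Np + 2 * s)
         * (r `^ (- 2 * s) + 2 * s / (2 * s - 1) * r `^ (1 - 2 * s))
         * eps `^ (2 * s) * modulus u x r m
     + s * Np / (Np + 2 * s) * eps ^+ 2
         * sup [set opnorm (hessian u y - hessian u x) | y in eball x eps]
     + 2 * s * (p - 2) / (Np + 2 * s) * eps ^+ 3
         * (opnorm (hessian u x) ^+ 2 / px).
Proof.
move=> eps /andP[eps0 epsr] _; cbv zeta.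
move: u x hN halpha u_bounded u_borel u_C2 grad_neq0 u_unif_cont.
case: N => [|[|n]] u x // _ halpha [M uM] mu_ uC2 p0 _.
set px := enorm (grad u x); set m := m_eps p s u x r eps; set Np := n.+2%:R + p - 2.
have s_gt : 0 < s by case/andP: hs => h _; apply: lt_trans h.
have s_lt : 0 < 1 - s by case/andP: hs => _ h; rewrite subr_gt0.
have s21 : 0 < 2 * s - 1 by case/andP: hs => h _; lra.
have s0 := ltW s_gt.
have [I1E AE A0] := aperture_moments hp halpha.
set k := cos alpha in I1E AE A0; case: halpha => halpha _.
have k0 : 0 <= k := cos_aperture_ge0 halpha.
set J0 := \int[_]_(z in _) _ in I1E; set J1 := \int[_]_(z in _) _ in I1E AE.
have N0 : 0 < n.+2%:R :> R by rewrite ltr0n.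
have Np0 : 0 < Np := Np_gt0 N0 hp; have D0 : 0 < Np + 2 * s := D_gt0 N0 hp s_gt.
have C0 : 0 < fracC n.+2 s by apply: fracC_gt0; rewrite s_gt -subr_gt0.
pose y0 := normalize (grad u x); have y1 : enorm y0 = 1 := enorm_normalize p0.
have ny1 : enorm (- y0) = 1 by rewrite enormN.
have px0 : 0 < px by rewrite /px enorm_gt0.
pose H := hessian u x; pose h := opnorm H.
have AB : (p - 1) / Np * @cap_size R n k <=
    \int[@sphere_measure R n.+2]_(z in sector k [set 1%R] (basisv 0)) dotv z (basisv 0).
  rewrite AE mulrA divfK ?lt0r_neq0// -I1E; exact: cap_first_ge.
pose S := [set opnorm (hessian u y - H) | y in eball x eps].
have S_ub : has_ubound S.
  have [K hK] := hessian_bounded uC2; exists (K + h) => _ [y ye <-].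
  rewrite (le_trans (opnormB _ _))// lerD2r; apply: hK.
  exact: lt_trans ye epsr.
have hd y : eball x eps y -> opnorm (hessian u y - H) <= sup S.
  by move=> ye; apply: ub_le_sup => //; exists y.
have d0 : 0 <= sup S.
  apply: le_trans (opnorm_ge0 _) (hd x _).
  by rewrite /eball/= subrr enorm0.
have tay z (ze : enorm z < eps) := taylor2 uC2 (ltW epsr) hd ze.
have hH v w : `|dotv (v *m H) w| <= h * (enorm v * enorm w) := normr_bilin _ _ _.
have mid := midrange_expansion p0 eps0 (opnorm_ge0 H) hH d0 tay.
have avg := ball_average eps0 mu_ uM tay.
pose I := cone_int k u x eps s0; pose V := cone_mass s alpha eps (n := n).
pose X := eps `^ (2 * s); pose Y := eps `^ (2 - 2 * s).
have X0 : 0 < X by exact: powR_gt0.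
have XXi : X * eps `^ (- 2 * s) = 1.
  by rewrite /X -powRD ?(gt_eqF eps0) ?implybT// mulNr subrr powRr0.
have XY : X * Y = eps ^+ 2.
  by rewrite /X /Y -powRD ?(gt_eqF eps0) ?implybT// addrC subrK powR_mulrn// ltW.
have V0 : 0 < V.
  apply: mulr_gt0 => //; apply: mulr_gt0 => //.
  by rewrite divr_gt0 ?powR_gt0// mulr_gt0.
(* the gain allowed by [cone_int_gain], divided by the mass of the cone *)
pose c1 := 2 * s * X * (near_radial s u x r eps * m +
  2 * far_radial s r * modulus u x r m).
have c1V : fracC n.+2 s * @cap_size R n k * (near_radial s u x r eps * m +
    2 * far_radial s r * modulus u x r m) = c1 * V.
  have Xn : X != 0 by rewrite lt0r_neq0.
  have Xi : eps `^ (- 2 * s) = X^-1 by apply: (mulfI Xn); rewrite XXi mulfV.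
  by rewrite /c1 /V /cone_mass Xi -/k; field; rewrite Xn lt0r_neq0.
have cavg y : enorm y = 1 -> cone_avg s alpha eps u x y = I y / V.
  exact: (cone_avgE u x s0 hs halpha eps0).
have nonlocal : `|2^-1 * (sup [set cone_avg s alpha eps u x y | y in @esphere R n.+2] +
    inf [set cone_avg s alpha eps u x y | y in @esphere R n.+2]) -
    2^-1 * (I y0 / V + I (- y0) / V)| <= 2^-1 * c1.
  rewrite -!cavg//; apply: midpoint_sup_inf => // y yS; rewrite !cavg// -mulrBl ler_pdivrMr//.
    rewrite -c1V.
    exact: (cone_int_above s0 hs k0 hp mu_ uM uC2 eps0 epsr p0 A0 AB).
  rewrite -c1V.
  exact: (cone_int_below s0 hs k0 hp mu_ uM uC2 eps0 epsr p0 A0 AB).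
have Lexp := Lsp_expansion s0 hs halpha mu_ uM uC2 eps0 epsr p0 hd.
have share := operator_share N0 hp s_gt s_lt XXi XY (ltW X0) C0 A0 I1E AE Lexp.
have key := mean_value_split N0 hp s_gt s_lt nonlocal mid avg share.
rewrite /Abar cap_areaE//; apply: (le_trans key).
have m0 : 0 <= m.
  apply: (proj1 (cone_int_gain s0 hs k0 hp mu_ uM uC2 eps0 epsr p0 A0 AB y1 y1 _)).
  by rewrite !subrr enorm0 expr0n/= mulr0 oppr0.
have r0 : 0 < r by exact: lt_trans epsr.
apply: lerD; [apply: lerD => //|].
  pose G := s * Np / (Np + 2 * s) * Cx u x r *
    (r `^ (2 - 2 * s) - eps `^ (2 - 2 * s)) * X * m.
  have R0 : 0 <= r `^ (2 - 2 * s) - eps `^ (2 - 2 * s).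
    rewrite subr_ge0 ge0_ler_powR ?nnegrE ?(ltW r0) ?(ltW eps0) ?(ltW epsr)//.
    by move: s_lt; clear; lra.
  have G0 : 0 <= G.
    apply: mulr_ge0 => //; apply: mulr_ge0; last exact: ltW.
    apply: mulr_ge0 => //; apply: mulr_ge0; last exact: (Cx_ge0 uC2 eps0 epsr).
    by rewrite divr_ge0 ?mulr_ge0// ltW.
  rewrite [leLHS](_ : _ = G + (1 - s) * Np / (Np + 2 * s)
         * (r `^ (- 2 * s) + 2 * s / (2 * s - 1) * r `^ (1 - 2 * s))
         * X * modulus u x r m); last first.
    rewrite /G /c1 /near_radial /far_radial -/Np.
    move: (modulus u x r m) (r `^ (- 2 * s)) (r `^ (1 - 2 * s)) => om w1 w2.
    move: (r `^ (2 - 2 * s) - eps `^ (2 - 2 * s)) (Np) D0 => w3 q D0.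
    field.
    by rewrite (lt0r_neq0 D0) (lt0r_neq0 s21) (lt0r_neq0 s_gt) (lt0r_neq0 s_lt).
  rewrite lerD2r [leRHS](_ : _ = 4 * G); first by move: G0; clear; lra.
  by rewrite /G -/X; ring.
have T0 : 0 <= s * (p - 2) / (Np + 2 * s) * (eps ^+ 3 * h ^+ 2 / px).
  by rewrite !mulr_ge0 ?invr_ge0 ?subr_ge0 ?exprn_ge0 ?(ltW D0) ?(ltW px0) ?(ltW eps0)
    ?opnorm_ge0.
rewrite [leLHS](_ : _ = 4^-1 * (s * (p - 2) / (Np + 2 * s) * (eps ^+ 3 * h ^+ 2 / px))).
  rewrite [leRHS](_ : _ = 2 * (s * (p - 2) / (Np + 2 * s) * (eps ^+ 3 * h ^+ 2 / px))).
    by move: T0; clear; lra.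
  by rewrite -/H -/h; ring.
rewrite -/Np -/px; rewrite -/h; move: (Np) D0 (px) px0 (h) => q D0 t t0 w; field.
by rewrite (lt0r_neq0 t0) (lt0r_neq0 D0).
Qed.
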